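(* Let $P$ be a $d$-polytope with $2d$ vertices, of which at most $d-2$ are nonsimple. Then $P$ is either a simplicial $d$-prism or a pyramid. Furthermore, this is best possible: there are $4$-polytopes with eight vertices, exactly three of them nonsimple, which are neither simplicial $4$-prisms nor pyramids (namely, polytopes $Q_4^1$ and $Q_4^2$ with the properties listed in the context).
   Context: A $d$-polytope is a convex polytope of dimension $d$. A vertex of a $d$-polytope is simple if exactly $d$ edges of the polytope are incident to it (equivalently, it lies in exactly $d$ facets), and nonsimple otherwise. A polytope is a pyramid if it is the convex hull of a facet and one further vertex outside that facet. A simplicial $d$-prism is a prism whose base is a $(d-1)$-simplex; here the term is understood up to combinatorial equivalence (isomorphism of face lattices). $Q_4^1$ and $Q_4^2$ are two combinatorially inequivalent $4$-polytopes, known from earlier work, each with eight vertices, exactly three of them nonsimple, and with isomorphic graphs; $Q_4^1$ has eight facets and $Q_4^2$ has seven facets. Combinatorially, $Q_4^2$ is obtained from $Q_4^1$ by gluing two simplex facets of $Q_4^1$ along a common ridge (triangle) $R$ to create a bipyramid over $R$, which is a facet of $Q_4^2$. *)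

(* Defs.v *)
From HB Require Import structures.
From mathcomp Require Import all_boot all_order all_algebra.
From mathcomp Require Import all_classical all_reals all_analysis.

Set Implicit Arguments.
Unset Strict Implicit.
Unset Printing Implicit Defensive.

Import Order.TTheory GRing.Theory Num.Theory.
Import numFieldNormedType.Exports.

Local Open Scope classical_set_scope.
Local Open Scope ring_scope.

Section Polytopes.
Variables (R : realType) (n : nat).
Implicit Types (A B C P Q F G : set 'rV[R]_n) (x v : 'rV[R]_n).

Definition conv A : set 'rV[R]_n := smallest (@convex_set R 'rV[R]_n) A.

Definition affine_set A : Prop :=
  forall x y (t : R), A x -> A y -> A ((1 - t) *: x + t *: y).

Definition aff A : set 'rV[R]_n := smallest affine_set A.

(* The empty set has no dimension in this sense (its dimension would be -1). *)
Definition has_dim A (k : nat) : Prop :=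
  exists x (V : {vspace 'rV[R]_n}),
    \dim V = k /\ aff A = [set y | y - x \in V].

Definition relint A : set 'rV[R]_n :=
  [set x | A x /\ \forall y \near x, aff A y -> A y].

Definition affinely_independent k (p : 'I_k -> 'rV[R]_n) : Prop :=
  forall l : 'I_k -> R, \sum_i l i = 0 -> \sum_i l i *: p i = 0 ->
    forall i, l i = 0.

Definition polytope P : Prop :=
  exists S : set 'rV[R]_n, finite_set S /\ P = conv S.

Definition dpolytope (d : nat) P : Prop := polytope P /\ has_dim P d.

Definition simplex (k : nat) P : Prop :=
  exists p : 'I_k.+1 -> 'rV[R]_n, affinely_independent p /\ P = conv (range p).

(* The inequality x *m c <= b is valid on P; c = 0 yields the improper faces
   P (b = 0) and set0 (b = 1). *)
Definition faces P : set (set 'rV[R]_n) :=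
  [set F | exists (c : 'cV[R]_n) (b : R),
    (forall x, P x -> (x *m c) 0 0 <= b) /\
    F = [set x | P x /\ (x *m c) 0 0 = b]].

Definition vertices P : set 'rV[R]_n := [set x | faces P [set x]].

Definition edges P : set (set 'rV[R]_n) := [set F | faces P F /\ has_dim F 1].

Definition facets P : set (set 'rV[R]_n) :=
  [set F | faces P F /\ exists k, has_dim F k /\ has_dim P k.+1].

Definition ridges P : set (set 'rV[R]_n) :=
  [set F | faces P F /\ exists k, has_dim F k /\ has_dim P k.+2].

Definition simple_vertex P v : Prop :=
  vertices P v /\
  exists d, has_dim P d /\ ([set E | edges P E /\ E v] #= `I_d)%card.

Definition nonsimple_vertices P : set 'rV[R]_n :=
  [set v | vertices P v /\ ~ simple_vertex P v].

Definition pyramid P : Prop :=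
  exists F v, [/\ facets P F, vertices P v, ~ F v & P = conv (F `|` [set v])].

Definition prism_over B P : Prop :=
  exists v, (forall x, aff B x -> ~ aff B (x + v)) /\
    P = conv (B `|` [set x + v | x in B]).

Definition bipyramid_over B P : Prop :=
  exists a b, [/\ a <> b,
    exists z, relint (conv [set a; b]) `&` relint B = [set z] &
    P = conv (B `|` [set a; b])].

Definition adjacent P x y : Prop :=
  [/\ vertices P x, vertices P y, x <> y & exists E, [/\ edges P E, E x & E y]].

End Polytopes.

Section Combinatorics.
Variables (R : realType) (n m : nat).

(* Isomorphism of face lattices. *)
Definition comb_equiv (P : set 'rV[R]_n) (Q : set 'rV[R]_m) : Prop :=
  exists phi : set 'rV[R]_n -> set 'rV[R]_m,
    set_bij (faces P) (faces Q) phi /\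
    forall F G, faces P F -> faces P G -> (F `<=` G <-> phi F `<=` phi G).

Definition graph_iso (P : set 'rV[R]_n) (Q : set 'rV[R]_m) : Prop :=
  exists f : 'rV[R]_n -> 'rV[R]_m,
    set_bij (vertices P) (vertices Q) f /\
    forall x y, vertices P x -> vertices P y ->
      (adjacent P x y <-> adjacent Q (f x) (f y)).

(* Up to the relabelling f of vertices, the facets of Q (as vertex sets) are
   those of P, except that the simplex facets F1 and F2, which share the ridge
   F1 `&` F2, are merged into one facet, a bipyramid over that ridge. The
   vertex sets of the facets determine the face lattice. *)
Definition glued_along_ridge (P : set 'rV[R]_n) (Q : set 'rV[R]_m) : Prop :=
  exists (f : 'rV[R]_n -> 'rV[R]_m) (F1 F2 : set 'rV[R]_n),
    let B := conv (f @` (vertices F1 `|` vertices F2)) in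
    [/\ set_bij (vertices P) (vertices Q) f,
        [/\ facets P F1, facets P F2, F1 <> F2 & ridges P (F1 `&` F2)],
        (exists k, simplex k F1) /\ (exists k, simplex k F2),
        [set vertices G | G in facets Q] =
          [set f @` vertices G | G in facets P `\` [set F1; F2]] `|`
          [set f @` (vertices F1 `|` vertices F2)] &
        facets Q B /\ bipyramid_over (conv (f @` vertices (F1 `&` F2))) B].

End Combinatorics.

Definition simplicial_prism (R : realType) (n d : nat) (P : set 'rV[R]_n) :
    Prop :=
  exists (k : nat) (B Q : set 'rV[R]_n),
    [/\ d = k.+1, simplex k B, prism_over B Q & comb_equiv P Q].

(* Main.v *)
Require Import Defs.
From HB Require Import structures.
From mathcomp Require Import all_boot all_order all_algebra.
From mathcomp Require Import all_classical all_reals all_analysis.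
From mathcomp Require Import ring lra zify.

(** Fix a polytope with vertices [q x], for [x] in a finite set [A], and replace
every point by the vector [p x = (q x, 1)]. Then faces of the polytope are the
zero sets of linear functionals that are nonnegative on these vectors, and the
dimension of a face is one less than the rank of its vectors; Farkas' lemma
provides every vertex with an exposing functional ([polytope_config]). The
first half of the theorem thus becomes a statement about such configurations:
a configuration of rank [d + 1] with at most [2 d] vertices, at most [d - 2] of
them nonsimple, is a pyramid or has the combinatorics of a simplicial prism
([pyr_or_prismlike]).

The main tool is the simplex method: a functional that can be increased from a
vertex can be increased along an edge ([improving_nbr]). So a vertex and its
neighbours span the configuration, and at a simple vertex the coordinates with
respect to this basis are nonnegative. Hence faces through a simple vertex
correspond to subsets of its neighbours, and a facet through it omits exactly
one neighbour ([one_outside]). Moreover, unless the polytope is a pyramid, of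
two adjacent simple vertices the first has a neighbour, other than the second,
which is not adjacent to the second ([nonnbr_exists]).

The combinatorial statement is proved by induction on [d] for polytopes that
are not pyramids. If some facet is a simplex with simple vertices only, then
joining each of its vertices to its neighbour outside the facet gives a prism
([simplex_all_simple]). Otherwise some facet is not a simplex, but has at most
[d - 3] nonsimple vertices, so by induction it is a pyramid or a prism. If all
such facets were pyramids, exchanging apexes in the largest ones would exhibit
at most [d - 2] vertices that separate the graph, contrary to a form of Balinski's
theorem ([no_good_nbr], [not_separated]). So there is a facet which is a prism;
only two vertices are left outside it, and looking at the facets adjacent to it
shows that the whole polytope is a prism ([prism_facet_extend]).

The faces of a prism are determined by its bases and by the matching between
them ([prism_faces]), which yields the combinatorial equivalence with a
geometric prism ([prismlike_simplicial_prism]).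

For the second half, two explicit polytopes are given by integer tables whose
validity is evaluated. Facets are the maximal proper faces, so their number is
a combinatorial invariant ([comb_equiv_facets]); a simplicial 4-prism has at
most six of them, the examples have eight and seven. *)

Set Implicit Arguments.
Unset Strict Implicit.
Unset Printing Implicit Defensive.

Import Order.TTheory GRing.Theory Num.Theory.
Import numFieldNormedType.Exports.

(** * Configurations of vectors and their faces *)

Section Configurations.
(* The operations on sets below are those of finite sets. *)
Import boot.fintype boot.finset.
Local Open Scope ring_scope.
Variables (R : realFieldType) (N : nat) (T : finType) (p : T -> 'rV[R]_N).
Implicit Types (A B C D E F K S X Y : {set T}) (c f g h : 'cV[R]_N) (u v w x y z : T).

Definition ev c x : R := (p x *m c) 0 0.

(** A face of the cone spanned by the vectors [p x], recorded as the set of the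
indices that lie on it. *)
Definition is_face A B : Prop :=
  exists2 c, (forall x, x \in A -> 0 <= ev c x)
           & B = [set x in A | ev c x == 0].

Definition convex_position A : Prop := forall x, x \in A -> is_face A [set x].

Definition hspan A : {vspace 'rV[R]_N} := <<[seq p x | x <- enum A]>>%VS.

Definition rk A : nat := \dim (hspan A).

Definition nbrs A v : {set T} :=
  [set u in A | (u != v) && `[< is_face A [set v; u] >]].

Definition simple A v : bool := (v \in A) && (#|nbrs A v|.+1 == rk A).

(** The index [x] is the apex, and [A :\ x] the base. *)
Definition pyr A : Prop := exists2 x, x \in A & is_face A (A :\ x).

(** The combinatorics of a simplicial prism: [K] is one base, [s] exchanges the
two ends of every edge between the bases, and the remaining facets omit one
such edge each. *)
Definition prism_data A K (s : T -> T) : Prop :=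
  [/\ K \subset A,
      forall x, x \in A -> [/\ s x \in A, s (s x) = x & (s x \in K) = (x \notin K)],
      is_face A K & forall x, x \in A -> is_face A (A :\: [set x; s x])].

Definition prismlike d A : Prop :=
  exists K s, #|K| = d /\ prism_data A K s.

Definition nonsimple A : {set T} := [set x in A | ~~ simple A x].

(** The smallest face that contains [S]. *)
Definition hull A S : {set T} :=
  A :&: \bigcap_(B : {set T} | `[< is_face A B >] && (S \subset B)) B.

Lemma set2_sub A x y : x \in A -> y \in A -> [set x; y] \subset A.
Proof. by move=> xA yA; apply/subsetP => z; rewrite !inE => /orP[]/eqP->. Qed.

Lemma evD c c' x : ev (c + c') x = ev c x + ev c' x.
Proof. by rewrite /ev mulmxDr mxE. Qed.

Lemma evZ k c x : ev (k *: c) x = k * ev c x.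
Proof. by rewrite /ev -scalemxAr mxE. Qed.

Lemma evN c x : ev (- c) x = - ev c x.
Proof. by rewrite /ev mulmxN mxE. Qed.

Lemma evB c c' x : ev (c - c') x = ev c x - ev c' x.
Proof. by rewrite evD evN. Qed.

Lemma ev0 x : ev 0 x = 0.
Proof. by rewrite /ev mulmx0 mxE. Qed.

Lemma ev_sum (I : finType) (P : pred I) (c : I -> 'cV[R]_N) x :
  ev (\sum_(i | P i) c i) x = \sum_(i | P i) ev (c i) x.
Proof. by rewrite /ev mulmx_sumr summxE. Qed.

Lemma mem_hspan A x : x \in A -> p x \in hspan A.
Proof. by move=> xA; apply/memv_span/map_f; rewrite mem_enum. Qed.

Lemma hspanS A B : A \subset B -> (hspan A <= hspan B)%VS.
Proof.
move=> /subsetP AB; apply/span_subvP => _ /mapP[x xA ->].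
by apply/mem_hspan/AB; rewrite mem_enum in xA.
Qed.

Lemma hspan_ev0 B c (w : 'rV[R]_N) :
  (forall x, x \in B -> ev c x = 0) -> w \in hspan B -> (w *m c) 0 0 = 0.
Proof.
move=> c0 wB; suff /subvP/(_ w wB) :
    (hspan B <= lker (linfun (mulmxr c : 'rV[R]_N -> 'M[R]_(1, 1))))%VS.
  by rewrite memv_ker lfunE /= => /eqP ->; rewrite mxE.
apply/span_subvP => _ /mapP[x xB ->]; rewrite memv_ker lfunE /=.
apply/eqP/matrixP => i j; rewrite !ord1 [RHS]mxE; apply: c0.
by rewrite mem_enum in xB.
Qed.

Lemma sep_hspan B (w : 'rV[R]_N) : w \notin hspan B ->
  exists2 c, (forall x, x \in B -> ev c x = 0) & (w *m c) 0 0 = 1.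
Proof.
move=> wB; pose f := (\1 - projv (hspan B))%VF.
have fB x : x \in B -> f (p x) = 0.
  by move=> xB; rewrite add_lfunE opp_lfunE id_lfunE projv_id ?subrr ?mem_hspan.
have : f w != 0.
  apply: contra wB; rewrite add_lfunE opp_lfunE id_lfunE subr_eq0 => /eqP ->.
  exact: memv_proj.
case/rV0Pn => j fj; exists ((f w 0 j)^-1 *: col j (lin1_mx f)).
  move=> x xB; rewrite evZ /ev.
  have -> : (p x *m col j (lin1_mx f)) 0 0 = (p x *m lin1_mx f) 0 j.
    by rewrite !mxE; apply: eq_bigr => k _; rewrite !mxE.
  by rewrite mul_rV_lin1 /= fB // mxE mulr0.
rewrite -scalemxAr mxE.
have -> : (w *m col j (lin1_mx f)) 0 0 = (w *m lin1_mx f) 0 j.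
  by rewrite !mxE; apply: eq_bigr => k _; rewrite !mxE.
by rewrite mul_rV_lin1 mulVf.
Qed.

Lemma rkS A B : A \subset B -> (rk A <= rk B)%N.
Proof. by move=> AB; apply/dimvS/hspanS. Qed.

Lemma rk_card A : (rk A <= #|A|)%N.
Proof. by rewrite cardE -(size_map p); exact: dim_span. Qed.

Lemma rkU A B : (rk (A :|: B) <= rk A + rk B)%N.
Proof.
apply: leq_trans (dimv_add_leqif (hspan A) (hspan B)).
apply/dimvS/span_subvP => _ /mapP[x + ->]; rewrite mem_enum in_setU => /orP[] xAB.
  by apply: (subvP (addvSl _ _)); apply: mem_hspan.
by apply: (subvP (addvSr _ _)); apply: mem_hspan.
Qed.

Lemma rk_subfree A B : B \subset A -> rk A = #|A| -> rk B = #|B|.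
Proof.
move=> BA rA; apply/eqP; rewrite eqn_leq rk_card /=.
have EA : B :|: (A :\: B) = A by rewrite -{1}(setIidPr BA) setID.
have := leq_trans (rkU B (A :\: B)) (leq_add (leqnn _) (rk_card (A :\: B))).
by rewrite EA rA cardsDS //; have := subset_leq_card BA; lia.
Qed.

Lemma rk_card_free A x : rk A = #|A| -> x \in A -> p x \notin hspan (A :\ x).
Proof.
move=> rA xA; apply/negP => pA.
have : (rk A <= rk (A :\ x))%N.
  apply/dimvS/span_subvP => _ /mapP[y yA ->].
  rewrite mem_enum in yA; have [->//|yx] := eqVneq y x.
  by apply/mem_hspan; rewrite !inE yx.
rewrite rA (cardsD1 x A) xA => /(leq_trans)/(_ (rk_card _)).
by rewrite ltnn.
Qed.

Lemma dual_functional A x : rk A = #|A| -> x \in A ->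
  exists2 c, (forall y, y \in A -> y != x -> ev c y = 0) & ev c x = 1.
Proof.
move=> rA xA; have [c c0 c1] := sep_hspan (rk_card_free rA xA).
by exists c => // y yA yx; apply: c0; rewrite !inE yx.
Qed.

Lemma rk_ltn_sep A B : (rk B < rk A)%N ->
  exists c, [/\ forall x, x \in B -> ev c x = 0 & exists2 x, x \in A & ev c x != 0].
Proof.
move=> rBA; have /existsP[x /andP[xA xB]] : [exists x, (x \in A) && (p x \notin hspan B)].
  apply: contraLR rBA; rewrite negb_exists -leqNgt => /forallP AB.
  apply/dimvS/span_subvP => _ /mapP[y yA ->]; rewrite mem_enum in yA.
  by have := AB y; rewrite yA /= negbK.
have [c c0 c1] := sep_hspan xB; exists c; split => //; exists x => //.
by rewrite [ev c x]c1 oner_eq0.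
Qed.

Lemma rk_eq_ev0 A B c : B \subset A -> rk B = rk A ->
  (forall x, x \in B -> ev c x = 0) -> forall x, x \in A -> ev c x = 0.
Proof.
move=> BA rBA cB x xA; apply: (hspan_ev0 cB).
suff -> : hspan B = hspan A by exact: mem_hspan.
by apply/eqP; rewrite eqEdim hspanS //= -/(rk A) -/(rk B) rBA.
Qed.

(** * Faces and edges *)

Lemma face_sub A B : is_face A B -> B \subset A.
Proof. by case=> c _ ->; apply/subsetP => x; rewrite inE => /andP[]. Qed.

Lemma face_refl A : is_face A A.
Proof.
exists 0 => [x _|]; first by rewrite ev0.
by apply/setP => x; rewrite !inE ev0 eqxx andbT.
Qed.

Lemma faceI A B C : is_face A B -> is_face A C -> is_face A (B :&: C).
Proof.
move=> [c c0 ->] [c' c'0 ->]; exists (c + c') => [x xA|].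
  by rewrite evD addr_ge0 ?c0 ?c'0.
apply/setP => x; rewrite !inE evD; case xA : (x \in A) => //=.
by rewrite paddr_eq0 ?c0 ?c'0.
Qed.

Lemma face_restrict A B C : is_face A C -> C \subset B -> B \subset A ->
  is_face B C.
Proof.
move=> [c c0 EC] /subsetP CB /subsetP BA; exists c => [x /BA/c0//|].
apply/setP => x; rewrite !inE; have [xB|xB] /= := boolP (x \in B).
  by rewrite EC inE BA.
by apply/negbTE; apply: contra xB => /CB.
Qed.

(** If [f] defines [B] in [A] and [g] defines [C] in [B], then [M f + g] defines [C]
in [A] as soon as [M] is so large that [M f] outweighs [g] outside [B]. *)
Lemma face_trans A B C : is_face A B -> is_face B C -> is_face A C.
Proof.
move=> [f f0 EB] [g g0 EC].
have [M MP] : exists M, forall x, x \in A -> x \notin B -> 0 < M * ev f x + ev g x.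
  (* The sum bounds every ratio [|g| / f] outside [B]. *)
  exists (1 + \sum_(x in A :\: B) `|ev g x| / ev f x) => x xA xB.
  have fx : 0 < ev f x.
    by rewrite lt_def f0 // andbT; apply: contra xB; rewrite EB inE xA.
  rewrite -subr_gt0 subr0 -(pmulr_lgt0 _ (x := (ev f x)^-1)) ?invr_gt0 // mulrDl mulfK ?gt_eqF //.
  rewrite (bigD1 x) ?inE ?xA ?xB //=.
  have : - (ev g x / ev f x) <= `|ev g x| / ev f x.
    by rewrite -mulNr ler_pM2r ?invr_gt0 // -normrN ler_norm.
  have : 0 <= \sum_(i in A :\: B | i != x) `|ev g i| / ev f i.
    apply: sumr_ge0 => i /andP[]; rewrite inE => /andP[_ iA] _.
    by rewrite divr_ge0 ?f0.
  lra.
exists (M *: f + g) => [x xA|].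
  rewrite evD evZ; have [xB|xB] := boolP (x \in B); last by rewrite ltW ?MP.
  by move: (xB); rewrite EB inE => /andP[_ /eqP ->]; rewrite mulr0 add0r g0.
apply/setP => x; rewrite EC !inE evD evZ; have [xB|xB] /= := boolP (x \in B).
  by move: (xB); rewrite EB inE => /andP[-> /eqP ->]; rewrite mulr0 add0r.
case xA : (x \in A) => //=; apply/esym/negbTE; rewrite gt_eqF // MP //.
Qed.

Lemma convpos_face A B : convex_position A -> is_face A B -> convex_position B.
Proof.
move=> cA fB x xB; have BA := face_sub fB.
by apply: face_restrict (cA x (subsetP BA x xB)) _ BA; rewrite sub1set.
Qed.

Lemma exposing A x : convex_position A -> x \in A ->
  exists c, [/\ ev c x = 0 & forall y, y \in A -> y != x -> 0 < ev c y].
Proof.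
move=> cA xA; have [c c0 Ec] := cA x xA; exists c; split.
  by have /setP/(_ x) := Ec; rewrite !inE eqxx xA => /esym/eqP.
move=> y yA yx; rewrite lt_def c0 // andbT.
by have /setP/(_ y) := Ec; rewrite !inE (negbTE yx) yA /= => <-.
Qed.

(** No vertex lies on the line through two others: combine exposing functionals of
[x] and [y] so that they cancel that of [z] on [x] and [y]. *)
Lemma noncollinear A x y z : convex_position A -> x \in A -> y \in A -> z \in A ->
  x != y -> x != z -> y != z ->
  exists c, [/\ ev c x = 0, ev c y = 0 & 0 < ev c z].
Proof.
move=> cA xA yA zA xy xz yz.
have [f [fx fP]] := exposing cA xA; have [g [gy gP]] := exposing cA yA.
have [h [hz hP]] := exposing cA zA.
have fy : 0 < ev f y by rewrite fP // eq_sym.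
have fz : 0 < ev f z by rewrite fP // eq_sym.
have gx : 0 < ev g x by rewrite gP.
have gz : 0 < ev g z by rewrite gP // eq_sym.
have hx : 0 < ev h x by rewrite hP.
have hy : 0 < ev h y by rewrite hP.
exists ((ev h y / ev f y) *: f + (ev h x / ev g x) *: g - h).
rewrite !evD !evN !evZ fx gy hz !mulr0 addr0 add0r oppr0 addr0.
split; rewrite ?divfK ?subrr ?gt_eqF //.
by rewrite addr_gt0 // !mulr_gt0 ?invr_gt0.
Qed.

(** One step of the simplex method: tilting a functional [g] that exposes [v]
towards [h] until it touches the configuration again, that is, maximizing
[h / g], produces a face through [v] on which [h] increases away from [v]. *)
Lemma ratio_face A v x h : convex_position A -> v \in A -> x \in A ->
  ev h v = 0 -> 0 < ev h x ->
  exists C, [/\ is_face A C, v \in C, exists2 y, y \in C & y != v &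
                forall y, y \in C -> y != v -> 0 < ev h y].
Proof.
move=> cA vA xA hv hx; have [g [gv gP]] := exposing cA vA.
have xv : x != v by apply: contraTneq hx => ->; rewrite hv ltxx.
have xAv : x \in A :\ v by rewrite !inE xv.
pose r y := ev h y / ev g y.
have [y yAv ymax] := @arg_maxP _ _ _ x (mem (A :\ v)) r xAv.
have /setD1P[yv yA] : y \in A :\ v := yAv.
have r0 : 0 < r y.
  by apply: lt_le_trans (ymax x xAv); rewrite divr_gt0 ?gP.
exists [set z in A | ev (r y *: g - h) z == 0]; split.
- exists (r y *: g - h) => // z zA; rewrite evB evZ subr_ge0.
  have [->|zv] := eqVneq z v; first by rewrite hv gv mulr0.
  by rewrite -ler_pdivrMr ?gP //; apply: (ymax z); apply/setD1P.
- by rewrite inE vA evB evZ gv hv mulr0 subr0 eqxx.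
- by exists y => //; rewrite inE yA evB evZ /r divfK ?subrr ?eqxx // gt_eqF // gP.
- move=> z; rewrite inE evB evZ subr_eq0 => /andP[zA /eqP <-] zv.
  by rewrite mulr_gt0 ?gP.
Qed.

Lemma nbrsP A v u : reflect [/\ u \in A, u != v & is_face A [set v; u]] (u \in nbrs A v).
Proof.
rewrite inE; apply: (iffP and3P) => -[uA uv]; first by move/asboolP.
by move=> fu; split=> //; apply/asboolP.
Qed.

Lemma nbrsC A u v : v \in A -> u \in nbrs A v -> v \in nbrs A u.
Proof.
by move=> vA /nbrsP[uA uv fu]; apply/nbrsP; rewrite eq_sym setUC.
Qed.

Lemma nbrs_face A F v : is_face A F -> v \in F -> nbrs F v = nbrs A v :&: F.
Proof.
move=> fF vF; have FA := face_sub fF; apply/setP => u; rewrite in_setI.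
apply/nbrsP/andP => [[uF uv fu]|[/nbrsP[uA uv fu] uF]].
  split=> //; apply/nbrsP; split=> //; first exact: (subsetP FA).
  exact: face_trans fF fu.
split=> //; apply: face_restrict fu _ FA.
exact: set2_sub.
Qed.

(** While there are three vertices left, [ratio_face] finds a smaller face through
[v] with another vertex on it; [noncollinear] supplies the functional which
makes that face omit one of the vertices. *)
Lemma edge_exists A v : convex_position A -> v \in A -> A != [set v] ->
  exists u, u \in nbrs A v.
Proof.
have [n] := ubnP #|A|; elim: n A => // n IH A; rewrite ltnS => An cA vA Av.
have [x xA xv] : exists2 x, x \in A & x != v.
  move: Av; rewrite eqEsubset sub1set vA andbT => /subsetPn[x xA].
  by rewrite inE; exists x.
have [EA|] := eqVneq A [set v; x].
  by exists x; apply/nbrsP; split=> //; rewrite -EA; exact: face_refl.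
rewrite eqEsubset andbC; have -> /= : [set v; x] \subset A.
  exact: set2_sub.
case/subsetPn => y yA; rewrite !inE negb_or => /andP[yv yx].
have [|||h [hv hx hy]] := noncollinear cA vA xA yA; rewrite 1?eq_sym //.
have [C [fC vC [z zC zv] hC]] := ratio_face cA vA yA hv hy.
have xC : x \notin C by apply/negP => /hC/(_ xv); rewrite hx ltxx.
have CA := face_sub fC.
have [|||u uC] := IH C _ _ vC.
- apply: leq_trans An; apply: proper_card; rewrite properE CA.
  by apply/subsetPn; exists x.
- exact: convpos_face fC.
- by apply: contraTneq zC => ->; rewrite inE.
by exists u; move: uC; rewrite (nbrs_face fC vC) in_setI => /andP[].
Qed.

(** The face of [ratio_face] has an edge at [v], and [h] increases along every edge
of that face. *)
Lemma improving_nbr A v x h : convex_position A -> v \in A -> x \in A ->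
  ev h v = 0 -> 0 < ev h x -> exists2 u, u \in nbrs A v & 0 < ev h u.
Proof.
move=> cA vA xA hv hx; have [C [fC vC [z zC zv] hC]] := ratio_face cA vA xA hv hx.
have [|u] := edge_exists (convpos_face cA fC) vC.
  by apply: contraTneq zC => ->; rewrite inE.
rewrite (nbrs_face fC vC) in_setI => /andP[uA uC]; exists u => //; apply: hC => //.
by case/nbrsP: uA.
Qed.

Lemma local_max A v h : convex_position A -> v \in A -> ev h v = 0 ->
  (forall u, u \in nbrs A v -> ev h u <= 0) -> forall x, x \in A -> ev h x <= 0.
Proof.
move=> cA vA hv hu x xA; rewrite leNgt; apply/negP => hx.
have [u /hu] := improving_nbr cA vA xA hv hx.
by rewrite leNgt => /negP.
Qed.

Lemma nbrs_ev0 A v h : convex_position A -> v \in A -> ev h v = 0 ->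
  (forall u, u \in nbrs A v -> ev h u = 0) -> forall x, x \in A -> ev h x = 0.
Proof.
move=> cA vA hv hu x xA; apply: le_anti; apply/andP; split.
  by apply: (local_max cA vA hv) => // u /hu->.
rewrite -oppr_le0 -evN; apply: (local_max cA vA) => //; first by rewrite evN hv oppr0.
by move=> u /hu; rewrite evN => ->; rewrite oppr0.
Qed.

(** A functional that vanishes on [v] and on its neighbours can neither increase
nor decrease from [v], hence vanishes on [A]. *)
Lemma hspan_nbrs A v : convex_position A -> v \in A ->
  hspan (v |: nbrs A v) = hspan A.
Proof.
move=> cA vA; apply/eqP; rewrite eqEsubv hspanS ?subUset ?sub1set ?vA //=; last first.
  by apply/subsetP => u /nbrsP[].
apply/span_subvP => _ /mapP[x xA ->]; rewrite mem_enum in xA.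
apply: contraT => /sep_hspan[c c0 c1].
have := @nbrs_ev0 A v c cA vA; rewrite c0 ?inE ?eqxx // => /(_ erefl)/(_ _ x xA) c0x.
suff : ev c x = 0 by rewrite [ev c x]c1 => /eqP; rewrite oner_eq0.
by apply: c0x => u uA; apply: c0; rewrite inE uA orbT.
Qed.

Lemma nbrs_notin A v : v \notin nbrs A v.
Proof. by rewrite inE eqxx andbF. Qed.

Lemma nbrs_sub A v : nbrs A v \subset A.
Proof. by apply/subsetP => u /nbrsP[]. Qed.

Lemma rk_nbrs A v : convex_position A -> v \in A -> (rk A <= #|nbrs A v|.+1)%N.
Proof.
move=> cA vA; rewrite /rk -(hspan_nbrs cA vA) (leq_trans (rk_card _)) //.
by rewrite cardsU1 nbrs_notin.
Qed.

(** * Simple vertices *)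

Lemma simple_in A v : simple A v -> v \in A.
Proof. by case/andP. Qed.

Lemma simple_free A v : convex_position A -> simple A v ->
  rk (v |: nbrs A v) = #|v |: nbrs A v|.
Proof.
move=> cA /andP[vA /eqP sv]; rewrite /rk (hspan_nbrs cA vA) -/(rk A) -sv.
by rewrite cardsU1 nbrs_notin.
Qed.

(** At a simple vertex, [v] and its neighbours form a basis of the span of [A]. The
coordinate of [u] in it is nonnegative on [A] because [v] is a local minimum. *)
Lemma simple_coord A v u : convex_position A -> simple A v -> u \in nbrs A v ->
  exists c, [/\ ev c v = 0, ev c u = 1,
    forall w, w \in nbrs A v -> w != u -> ev c w = 0 &
    forall x, x \in A -> 0 <= ev c x].
Proof.
move=> cA sv uv; have vA := simple_in sv.
have [|c c0 c1] := @dual_functional _ u (simple_free cA sv).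
  by rewrite inE uv orbT.
have cv : ev c v = 0.
  by rewrite c0 ?inE ?eqxx //; apply: contraTneq uv => <-; rewrite nbrs_notin.
have cn w : w \in nbrs A v -> w != u -> ev c w = 0.
  by move=> wv wu; rewrite c0 // inE wv orbT.
exists c; split=> // x xA; rewrite -oppr_le0 -evN.
apply: (local_max cA vA) => //; first by rewrite evN cv oppr0.
move=> w wv; rewrite evN oppr_le0; have [->|wu] := eqVneq w u; first by rewrite c1.
by rewrite cn.
Qed.

Lemma face_le A B C v : convex_position A -> is_face A B -> is_face A C ->
  v \in B -> v \in C -> nbrs A v :&: B \subset C -> B \subset C.
Proof.
move=> cA fB fC vB vC /subsetP BC; have BA := subsetP (face_sub fB).
case: (fC) => c c0 EC; apply/subsetP => x xB; rewrite EC inE BA //=; apply/eqP.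
have cC y : y \in C -> ev c y = 0 by rewrite EC inE => /andP[_ /eqP].
apply: (nbrs_ev0 (convpos_face cA fB) vB (cC _ vC)) => // u.
by rewrite (nbrs_face fB vB) => uB; apply/cC/BC.
Qed.

Lemma face_eq A B C v : convex_position A -> is_face A B -> is_face A C ->
  v \in B -> v \in C -> nbrs A v :&: B = nbrs A v :&: C -> B = C.
Proof.
move=> cA fB fC vB vC E; apply/eqP; rewrite eqEsubset.
by rewrite (face_le cA fB fC vB vC) ?(face_le cA fC fB vC vB) // -?E ?subsetIr // E subsetIr.
Qed.

(** Together with [face_eq]: the faces through a simple vertex correspond to the
subsets of its neighbours. The face for [U] is the zero set of the sum of the
coordinates that belong to the other neighbours. *)
Lemma face_at A v (U : {set T}) : convex_position A -> simple A v -> U \subset nbrs A v ->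
  exists F, [/\ is_face A F, v \in F & nbrs A v :&: F = U].
Proof.
move=> cA sv UN; have vA := simple_in sv.
have /choice[c cP] u : exists c, u \in nbrs A v -> [/\ ev c v = 0, ev c u = 1,
    forall w, w \in nbrs A v -> w != u -> ev c w = 0 &
    forall x, x \in A -> 0 <= ev c x].
  have [uN|] := boolP (u \in nbrs A v); last by exists 0.
  by have [c cP] := simple_coord cA sv uN; exists c.
pose s := \sum_(u in nbrs A v :\: U) c u.
have s0 x : x \in A -> 0 <= ev s x.
  move=> xA; rewrite ev_sum sumr_ge0 // => u; rewrite inE => /andP[_ /cP[_ _ _]].
  exact.
exists [set x in A | ev s x == 0]; split; first by exists s.
  rewrite inE vA ev_sum big1 ?eqxx // => u; rewrite inE => /andP[_ /cP[]//].
apply/setP => u; rewrite !inE; case: (boolP (u \in U)) => uU.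
  have uN := subsetP UN _ uU; move: (uN); rewrite inE => -> /=.
  rewrite (subsetP (nbrs_sub _ v)) //= ev_sum big1 ?eqxx // => w.
  rewrite inE => /andP[wU /cP[_ _ cw _]]; apply: cw => //.
  by apply: contraNneq wU => <-.
apply/negbTE; rewrite negb_and; case: (boolP (u \in A)) => //= uA.
rewrite -negb_and; apply/negP => /andP[/andP[uv fu]].
have uN : u \in nbrs A v by rewrite inE uA uv.
rewrite ev_sum (bigD1 u) ?inE ?uN ?uU //=; last by rewrite uA uv.
have [_ -> _ _] := cP u uN; rewrite gt_eqF //.
rewrite ltr_wpDr // sumr_ge0 // => w /andP[]; rewrite inE => /andP[_ /cP[_ _ _ cw]] _.
exact: cw.
Qed.

Lemma rk_face A F v : convex_position A -> simple A v -> is_face A F -> v \in F ->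
  rk F = #|nbrs A v :&: F|.+1.
Proof.
move=> cA sv fF vF; have cF := convpos_face cA fF.
apply/eqP; rewrite eqn_leq -{1}(nbrs_face fF vF) rk_nbrs //=.
have -> : (#|nbrs A v :&: F|.+1 = #|v |: (nbrs A v :&: F)|)%N.
  by rewrite cardsU1 inE (negbTE (nbrs_notin _ _)).
have -> : #|v |: nbrs A v :&: F| = rk (v |: nbrs A v :&: F).
  apply/esym/(rk_subfree _ (simple_free cA sv)).
  by rewrite setUS // subsetIl.
by apply: rkS; rewrite subUset sub1set vF subsetIr.
Qed.

Lemma simple_face A F v : convex_position A -> simple A v -> is_face A F -> v \in F ->
  simple F v.
Proof.
by move=> cA sv fF vF; rewrite /simple vF (nbrs_face fF vF) -(rk_face cA sv fF vF) eqxx.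
Qed.

(** * Rank and independence *)

Lemma rk_insert B y c : (forall x, x \in B -> ev c x = 0) -> ev c y != 0 ->
  rk (y |: B) = (rk B).+1.
Proof.
move=> cB cy; apply/eqP; rewrite eqn_leq; apply/andP; split.
  apply: leq_trans (rkU _ _) _; rewrite -add1n leq_add2r.
  by apply: leq_trans (rk_card _) _; rewrite cards1.
rewrite /rk ltn_neqAle dimvS ?hspanS ?subsetUr // andbT.
apply: contra cy => /eqP E; apply/eqP.
apply: (hspan_ev0 cB); have -> : hspan B = hspan (y |: B).
  by apply/eqP; rewrite eqEdim hspanS ?subsetUr //= E.
by apply: mem_hspan; rewrite !inE eqxx.
Qed.

Lemma rk_set0 : rk set0 = 0%N.
Proof. by apply/eqP; have := rk_card set0; rewrite cards0 leqn0. Qed.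

Lemma rk_pair A x y : convex_position A -> x \in A -> y \in A -> x != y ->
  rk [set x; y] = 2%N.
Proof.
move=> cA xA yA xy; have [c [cx cP]] := exposing cA xA.
have [c' [cy cP']] := exposing cA yA.
rewrite (@rk_insert _ _ c').
- rewrite -(setU0 [set y]) (@rk_insert _ _ c) ?rk_set0 //.
    by move=> z; rewrite inE.
  by rewrite gt_eqF // cP // eq_sym.
- by move=> z; rewrite inE => /eqP->.
- by rewrite gt_eqF // cP'.
Qed.

(** Two vertices already span a face of rank [2], so a third one would be collinear. *)
Lemma rk2_face A B x : convex_position A -> is_face A B -> x \in B -> rk B = 2%N ->
  exists2 u, u \in nbrs A x & B = [set x; u].
Proof.
move=> cA fB xB rB; have cB := convpos_face cA fB.
have [|u uB] := edge_exists cB xB.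
  by apply: contra_eq_neq rB => ->; have := rk_card [set x]; rewrite cards1; lia.
have [uB' ux _] := nbrsP _ _ _ uB.
exists u; first by move: uB; rewrite (nbrs_face fB xB) inE => /andP[].
have sB : [set x; u] \subset B.
  exact: set2_sub.
apply/eqP; rewrite eq_sym eqEsubset sB /=; apply/subsetP => w wB.
rewrite !inE; apply: contraT; rewrite negb_or => /andP[wx wu].
have [|||c [cx cu cw]] := noncollinear cB xB uB' wB; rewrite 1?eq_sym //.
have rxu : rk [set x; u] = rk B.
  by rewrite rB; apply: (rk_pair cB xB uB'); rewrite eq_sym.
move: cw; rewrite (rk_eq_ev0 sB rxu _ wB) ?ltxx // => z.
by rewrite !inE => /orP[]/eqP->.
Qed.

Lemma rk_indep K : (forall x, x \in K -> exists2 c, forall y, y \in K -> y != x -> ev c y = 0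
   & ev c x != 0) -> rk K = #|K|.
Proof.
have [m] := ubnP #|K|; elim: m K => // m IH K; rewrite ltnS => Km HK.
have [->|[x xK]] := set_0Vmem K; first by rewrite rk_set0 cards0.
have [c c0 cx] := HK x xK; rewrite -(setD1K xK) (@rk_insert _ _ c) //; last first.
  by move=> y; rewrite !inE => /andP[yx yK]; exact: c0.
rewrite cardsU1 !inE eqxx /= IH //.
  by move: Km; rewrite (cardsD1 x) xK; lia.
move=> y; rewrite !inE => /andP[yx yK]; have [c' c'0 c'y] := HK y yK.
exists c' => // z; rewrite !inE => /andP[zx zK]; exact: c'0.
Qed.

(** * Smallest faces, pyramids and simplices *)

Lemma hull_face A S : is_face A (hull A S).
Proof.
rewrite /hull; elim/big_ind: _ => [|B C fB fC|B /andP[/asboolP fB _]].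
- by rewrite setIT; exact: face_refl.
- by rewrite setIA -[A in A :&: B]setIid -setIA setIACA; exact: faceI.
- by rewrite (setIidPr (face_sub fB)).
Qed.

Lemma sub_hull A S : S \subset A -> S \subset hull A S.
Proof.
by move=> SA; rewrite subsetI SA /=; apply/bigcapsP => B /andP[].
Qed.

Lemma hull_min A S B : is_face A B -> S \subset B -> hull A S \subset B.
Proof.
by move=> fB SB; apply: subset_trans (subsetIr _ _) _; apply: bigcap_inf; rewrite SB andbT; apply/asboolP.
Qed.

(** Faces through [v] that omit the neighbours other than [u] one by one cut out
the edge from [v] to [u]. *)
Lemma mem_edge A v u x : convex_position A -> u \in nbrs A v -> v \in A -> x \in A ->
  (forall w, w \in nbrs A v -> w != u ->
     exists F, [/\ is_face A F, v \in F, x \in F & w \notin F]) ->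
  x = v \/ x = u.
Proof.
move=> cA uv vA xA H; have SA : [set v; x] \subset A.
  exact: set2_sub.
have /subsetP SH := sub_hull SA; have fH := hull_face A [set v; x].
have /nbrsP[uA unv fu] := uv.
have /subsetP/(_ x) : hull A [set v; x] \subset [set v; u].
  apply: (@face_le A _ _ v cA fH fu); rewrite ?SH ?inE ?eqxx ?orbT //.
  apply/subsetP => w; rewrite in_setI => /andP[wv wH].
  have [->|wu] := eqVneq w u; first by rewrite !inE eqxx orbT.
  have [F [fF vF xF /negP[]]] := H w wv wu.
  apply: (subsetP (hull_min fF _)) wH.
  exact: set2_sub.
by rewrite SH ?inE ?eqxx ?orbT // => /(_ isT) /orP[]/eqP->; [left|right].
Qed.

(** By [rk_face] the facet has [d - 1] of the [d] neighbours of [v]. This unique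
neighbour outside a facet drives all the arguments below. *)
Lemma one_outside A d v F : convex_position A -> rk A = d.+1 -> simple A v ->
  is_face A F -> v \in F -> rk F = d -> exists u, nbrs A v :\: F = [set u].
Proof.
move=> cA rA sv fF vF; rewrite (rk_face cA sv fF vF) => rF.
apply/cards1P; move: sv => /andP[_]; rewrite rA eqSS => /eqP sv.
by have := cardsID F (nbrs A v); lia.
Qed.

Lemma nbr_in A d v F u w : convex_position A -> rk A = d.+1 -> simple A v ->
  is_face A F -> v \in F -> rk F = d -> u \in nbrs A v -> u \notin F ->
  w \in nbrs A v -> w != u -> w \in F.
Proof.
move=> cA rA sv fF vF rF uv uF wv wu.
have [t Et] := one_outside cA rA sv fF vF rF.
have /eqP ut : u == t by rewrite -in_set1 -Et inE uF.
apply: contraNT wu => wF; rewrite ut -in_set1 -Et inE wF //.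
Qed.

Lemma facet_omit A d v u : convex_position A -> rk A = d.+1 -> simple A v ->
  u \in nbrs A v ->
  exists F, [/\ is_face A F, v \in F, nbrs A v :&: F = nbrs A v :\ u & rk F = d].
Proof.
move=> cA rA sv uv; have [F [fF vF nF]] := face_at cA sv (subD1set (nbrs A v) u).
exists F; split=> //; rewrite (rk_face cA sv fF vF) nF.
move: sv => /andP[_]; rewrite rA eqSS => /eqP <-.
by rewrite [RHS](cardsD1 u) uv.
Qed.

(** An exposing functional of [x] may be corrected at the apex by a multiple of
the functional that defines the base, without changing it on the base. *)
Lemma pyr_adj A u x : u \in A -> convex_position A -> is_face A (A :\ u) ->
  x \in A -> x != u -> is_face A [set x; u].
Proof.
move=> uA cA [g g0 Eg] xA xu.
have gE y : y \in A -> y != u -> ev g y = 0.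
  move=> yA yu; have : y \in A :\ u by rewrite !inE yu.
  by rewrite Eg inE => /andP[_ /eqP].
have gu : 0 < ev g u.
  rewrite lt_def g0 // andbT; apply: contraFN (setD11 u A) => gu.
  by rewrite Eg inE uA gu.
have [f [fx fP]] := exposing cA xA.
have hE y : y \in A -> ev (f - (ev f u / ev g u) *: g) y = if y == u then 0 else ev f y.
  move=> yA; rewrite evB evZ; case: (eqVneq y u) => [->|yu].
    by rewrite divfK ?subrr // gt_eqF.
  by rewrite (gE y) // mulr0 subr0.
exists (f - (ev f u / ev g u) *: g) => [y yA|].
  rewrite hE //; case: eqP => // _; have [->|/fP/ltW->//] := eqVneq y x.
  by rewrite fx.
apply/setP => y; rewrite !inE; case yA : (y \in A); last first.
  by apply/negbTE; apply: contraFN yA => /orP[]/eqP->.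
rewrite hE //; have [->|yu] := eqVneq y u; first by rewrite orbT eqxx.
have [->|yx] := eqVneq y x; first by rewrite fx eqxx.
by rewrite /= gt_eqF // fP.
Qed.

Lemma simplex_face K S : rk K = #|K| -> S \subset K -> is_face K S.
Proof.
move=> rK SK.
have /choice[c cP] u : exists c, u \in K ->
    (forall y, y \in K -> y != u -> ev c y = 0) /\ ev c u = 1.
  have [uK|] := boolP (u \in K); last by exists 0.
  by have [c c0 c1] := dual_functional rK uK; exists c.
have E x : x \in K -> ev (\sum_(u in K :\: S) c u) x = (x \notin S)%:R.
  move=> xK; rewrite ev_sum; have [xS|xS] /= := boolP (x \in S).
    rewrite big1 // => u; rewrite inE => /andP[uS /cP[cu _]].
    by apply: cu => //; apply: contraNneq uS => <-.
  rewrite (bigD1 x) ?inE ?xS //= big1 ?addr0; first by have [_ ->] := cP x xK.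
  move=> u /andP[]; rewrite inE => /andP[_ /cP[cu _]] ux.
  by apply: cu => //; rewrite eq_sym.
exists (\sum_(u in K :\: S) c u) => [x xK|]; first by rewrite E // ler0n.
apply/setP => x; rewrite inE; case xK : (x \in K) => /=.
  by rewrite E // pnatr_eq0 eqb0 negbK.
by apply: contraFF xK => /(subsetP SK).
Qed.

Lemma simplex_nbr A K x y : is_face A K -> rk K = #|K| -> x \in K -> y \in K ->
  y != x -> y \in nbrs A x.
Proof.
move=> fK rK xK yK yx; apply/nbrsP; split=> //; first exact: (subsetP (face_sub fK)).
apply: face_trans fK (simplex_face rK _).
exact: set2_sub.
Qed.

(** Suppose that all neighbours of [v] but [u] are neighbours of [u]. Then the
coordinate [c] of [v] at [u] vanishes on the neighbours of [v]. Expressing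
functionals by [c] and by the coordinates at [v] shows that [v] is adjacent to
all other vertices, so [c] vanishes exactly outside [v], and [A] is a pyramid
with apex [v]. *)
Lemma nonnbr_exists A v u : convex_position A -> simple A v -> simple A u ->
  u \in nbrs A v -> ~ pyr A ->
  exists m, [/\ m \in nbrs A v, m != u & m \notin nbrs A u].
Proof.
move=> cA sv su uv npA; apply: contrapT => noex.
have vA := simple_in sv; have uA := simple_in su.
have sub m : m \in nbrs A v -> m != u -> m \in nbrs A u.
  by move=> mv mu; apply: contrapT => /negP mu'; apply: noex; exists m.
have [|c [cu cv cn c0]] := simple_coord cA su (u := v); first exact: nbrsC.
have cz m : m \in nbrs A v -> ev c m = 0.
  move=> mv; have [->//|mu] := eqVneq m u; apply: cn; first exact: sub.
  by apply: contraTneq mv => ->; exact: nbrs_notin.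
have /choice[k kP] m : exists k, m \in nbrs A v -> [/\ ev k v = 0, ev k m = 1,
    forall w, w \in nbrs A v -> w != m -> ev k w = 0 &
    forall x, x \in A -> 0 <= ev k x].
  have [mN|] := boolP (m \in nbrs A v); last by exists 0.
  by have [k kP] := simple_coord cA sv mN; exists k.
(* The difference of the two sides vanishes on [v] and its neighbours. *)
have expand e x : x \in A -> ev e x = ev e v * ev c x + \sum_(m in nbrs A v) ev e m * ev (k m) x.
  move=> xA; apply/eqP; rewrite -subr_eq0 opprD addrA; apply/eqP.
  pose d := e - ev e v *: c - \sum_(m in nbrs A v) ev e m *: k m.
  have dE y : ev d y = ev e y - ev e v * ev c y - \sum_(m in nbrs A v) ev e m * ev (k m) y.
    by rewrite /d !evB evZ ev_sum; congr (_ - _); apply: eq_bigr => m _; rewrite evZ.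
  rewrite -dE; apply: (nbrs_ev0 cA vA) => // [|w wv].
    by rewrite dE cv mulr1 subrr sub0r big1 ?oppr0 // => m /kP[-> _ _ _]; rewrite mulr0.
  rewrite dE (cz _ wv) mulr0 subr0 (bigD1 w) //= big1 ?addr0; last first.
    by move=> m /andP[/kP[_ _ km _] mw]; rewrite km ?mulr0 // eq_sym.
  by have [_ -> _ _] := kP w wv; rewrite mulr1 subrr.
(* If not, an exposing functional of [w], then one of [v], would vanish too often. *)
have Aall w : w \in A -> w != v -> w \in nbrs A v.
  move=> wA wv; apply: contrapT => /negP wN.
  have [e [ew eP]] := exposing cA wA.
  have := expand e w wA; rewrite ew => /esym/eqP.
  have pos1 : 0 <= ev e v * ev c w by rewrite mulr_ge0 ?c0 //; apply/ltW/eP; rewrite // eq_sym.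
  have pos2 m : m \in nbrs A v -> 0 <= ev e m * ev (k m) w.
    move=> mv; have [_ _ _ km] := kP m mv; rewrite mulr_ge0 ?km //; apply/ltW/eP.
      exact: (subsetP (nbrs_sub A v)).
    by apply: contraNneq wN => <-.
  rewrite paddr_eq0 ?sumr_ge0 // psumr_eq0 // => /andP[_ /allP km0].
  have [e' [e'v e'P]] := exposing cA vA.
  have := e'P w wA wv; rewrite expand // e'v mul0r add0r big1 ?ltxx // => m mv.
  have /implyP/(_ mv) := km0 m (mem_index_enum m).
  rewrite mulf_eq0 => /orP[|/eqP->]; last by rewrite mulr0.
  rewrite gt_eqF // eP //; first exact: (subsetP (nbrs_sub A v)).
  by apply: contraNneq wN => <-.
apply: npA; exists v => //; exists c => //.
apply/setP => x; rewrite !inE; case xA : (x \in A); rewrite ?andbF // andbT /=.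
have [->|xv] := eqVneq x v; first by rewrite cv oner_eq0.
by rewrite cz ?eqxx // Aall.
Qed.

(** * Connectivity of the graph *)

(** Let [E] have its neighbours in [E] and [X], where [f] vanishes on [X]. A maximum
[r1] of [f] over [E] is a local, hence global maximum. The maximizers of [f]
form a face that avoids [X]; walking in it from [r1] towards a maximizer [y]
outside [E] one would have to leave [E] without passing through [X]. *)
Lemma argmax_not_outside (one : 'cV[R]_N) A X E f y r0 : (forall x, ev one x = 1) ->
  convex_position A -> E \subset A -> r0 \in E -> y \in A -> y \notin E ->
  (forall r, r \in E -> nbrs A r \subset E :|: X) ->
  (forall x, x \in X -> ev f x = 0) -> ev f r0 = 0 -> 0 < ev f y ->
  (forall x, x \in A -> ev f x <= ev f y) -> False.
Proof.
move=> one1 cA /subsetP EA r0E yA yE nE fX fr0 fy ymax.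
have [r1 r1E0 r1max] := @arg_maxP _ _ _ r0 (mem E) (ev f) r0E.
have r1E : r1 \in E := r1E0.
have r1A := EA _ r1E; have fr1 : 0 <= ev f r1 by rewrite -fr0; exact: r1max.
have fr1y : ev f r1 = ev f y.
  apply: le_anti; rewrite ymax //= -subr_le0.
  have := @local_max A r1 (f - ev f r1 *: one) cA r1A.
  rewrite evB evZ one1 mulr1 subrr => /(_ erefl) /(_ _ y yA).
  rewrite evB evZ one1 mulr1; apply => u /(subsetP (nE _ r1E)).
  rewrite inE evB evZ one1 mulr1 subr_le0 => /orP[uE|/fX->//]; exact: r1max.
have fPhi : is_face A [set x in A | ev (ev f y *: one - f) x == 0].
  by exists (ev f y *: one - f) => // x xA; rewrite evB evZ one1 mulr1 subr_ge0 ymax.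
set Phi := [set x in A | _] in fPhi.
have PhiE x : (x \in Phi) = (x \in A) && (ev f x == ev f y).
  by rewrite inE evB evZ one1 mulr1 subr_eq0 eq_sym.
(* In the face of maximizers, descend along a functional that exposes [y]. *)
have [e [ey eP]] := exposing cA yA.
have r1Phi : r1 \in E :&: Phi by rewrite inE r1E PhiE r1A fr1y eqxx.
have [r2 r2E r2min] := @arg_minP _ _ _ r1 (mem (E :&: Phi)) (ev e) r1Phi.
have /setIP[r2E' r2P] : r2 \in E :&: Phi := r2E.
have := @local_max Phi r2 (ev e r2 *: one - e) (convpos_face cA fPhi) r2P.
rewrite evB evZ one1 mulr1 subrr => /(_ erefl) /(_ _ y).
rewrite PhiE yA eqxx evB evZ one1 mulr1 ey subr0 leNgt eP ?(EA r2) //; last first.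
  by apply: contraNneq yE => <-.
move=> H; suff : ~~ true by []; apply: H => // u.
rewrite (nbrs_face fPhi r2P) in_setI => /andP[/(subsetP (nE _ r2E')) uEX uP].
rewrite evB evZ one1 mulr1 subr_le0; apply: r2min; apply/setIP; split=> //.
move: uEX uP; rewrite inE => /orP[//|/fX fu]; rewrite PhiE => /andP[_].
by rewrite fu eq_sym gt_eqF.
Qed.

(** A form of Balinski's theorem: fewer than [d - 1] vertices do not separate the
graph of a [d]-polytope. As [X] is small, some nonzero functional vanishes on
[X], [y0] and [r0]; a maximum of it lies on one of the two sides, which
contradicts [argmax_not_outside] for the other side. *)
Lemma not_separated (one : 'cV[R]_N) A X D E d y0 r0 : (forall x, ev one x = 1) ->
  convex_position A -> rk A = d.+1 -> (#|X| + 2 <= d)%N ->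
  A = X :|: D :|: E -> [disjoint D & E] -> y0 \in D -> r0 \in E ->
  (forall y, y \in D -> nbrs A y \subset D :|: X) ->
  (forall r, r \in E -> nbrs A r \subset E :|: X) -> False.
Proof.
move=> one1 cA rA Xd EA DE y0D r0E nD nE.
have [|c [c0 [x xA cx]]] := @rk_ltn_sep A (y0 |: (r0 |: X)).
  rewrite rA ltnS (leq_trans (rk_card _)) // !cardsU1; do 2!case: (_ \notin _); lia.
wlog cx0 : c c0 cx / 0 < ev c x.
  move=> H; have [|] := ltP 0 (ev c x); first exact: H c0 cx.
  move=> cx'; apply: (H (- c)); rewrite ?evN ?oppr_eq0 //.
    by move=> z /c0 cz; rewrite evN cz oppr0.
  by rewrite oppr_gt0 lt_def cx' eq_sym cx.
have [y yA ymax] := @arg_maxP _ _ _ x (mem A) (ev c) xA.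
have yA' : y \in A := yA.
have cy : 0 < ev c y by apply: lt_le_trans cx0 (ymax x xA).
have cX z : z \in X -> ev c z = 0 by move=> zX; apply: c0; rewrite !inE zX !orbT.
have DA : D \subset A by rewrite EA; apply/subsetP => z zD; rewrite !inE zD orbT.
have EA' : E \subset A by rewrite EA; apply/subsetP => z zE; rewrite !inE zE orbT.
have yX : y \notin X by apply: contraTN cy => /cX->; rewrite ltxx.
move: (yA'); rewrite {1}EA !inE (negbTE yX) /= => /orP[yD|yE].
  apply: (argmax_not_outside one1 cA EA' r0E yA' _ nE cX _ cy ymax).
    by apply/negP => yE; move: DE; rewrite disjoint_subset => /subsetP/(_ y yD); rewrite inE yE.
  by apply: c0; rewrite !inE eqxx orbT.
apply: (argmax_not_outside one1 cA DA y0D yA' _ nD cX _ cy ymax).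
  by apply/negP => yD; move: DE; rewrite disjoint_subset => /subsetP/(_ y yD); rewrite inE yE.
by apply: c0; rewrite !inE eqxx.
Qed.

(** * Simplex facets and the combinatorics of prisms *)

(** Each vertex [x] of the simplex facet [K] has a unique neighbour [s x] outside
[K]. By [nonnbr_exists] the map [s] is injective, so [K] and its image exhaust
the at most [2 d] vertices. A facet through a vertex of [K] that omits [x] has
to contain [s z] for the other vertices [z] of [K]; it omits [s x], since
otherwise [A] would be a pyramid with apex [x]. *)
Lemma simplex_all_simple A d K : convex_position A -> rk A = d.+1 -> (1 < d)%N ->
  (#|A| <= 2 * d)%N -> ~ pyr A -> is_face A K -> #|K| = d -> rk K = d ->
  (forall x, x \in K -> simple A x) -> prismlike d A.
Proof.
move=> cA rA d1 Ad npA fK cK rK sK; have KA := subsetP (face_sub fK).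
have KK x y : x \in K -> y \in K -> y != x -> y \in nbrs A x.
  by apply: simplex_nbr fK _; rewrite rK cK.
have /choice[s sP] x : exists m, x \in K -> nbrs A x :\: K = [set m].
  have [xK|] := boolP (x \in K); last by exists x.
  by have [m Em] := one_outside cA rA (sK x xK) fK xK rK; exists m.
have sN x : x \in K -> s x \in nbrs A x.
  by move=> /sP E; have := set11 (s x); rewrite -E inE => /andP[].
have sNK x : x \in K -> s x \notin K.
  by move=> /sP E; have := set11 (s x); rewrite -E inE => /andP[].
have nE x m : x \in K -> m \in nbrs A x -> m \in K \/ m = s x.
  move=> xK mx; have [mK|mK] := boolP (m \in K); [by left|right].
  by apply/eqP; rewrite -in_set1 -(sP x xK) inE mK.
(* If [s x = s y], then all neighbours of [x] except [y] are adjacent to [y]. *)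
have s_inj : {in K &, injective s}.
  move=> x y xK yK sxy; apply/eqP/negPn/negP => xy.
  have [|m [mx my mNy]] := @nonnbr_exists A x y cA (sK x xK) (sK y yK) _ npA.
    by apply: KK => //; rewrite eq_sym.
  have [mK|Em] := nE x m xK mx; first by rewrite KK in mNy.
  by rewrite Em sxy sN in mNy.
have AE : A = K :|: s @: K.
  apply/esym/eqP; rewrite eqEcard subUset (face_sub fK) /=; apply/andP; split.
    by apply/subsetP => _ /imsetP[x xK ->]; have := subsetP (nbrs_sub A x) _ (sN x xK).
  rewrite cardsU (_ : K :&: _ = set0) ?cards0 ?card_in_imset ?cK; first by lia.
    by [].
  apply/setP => z; rewrite !inE; apply/negbTE/negP => /andP[zK /imsetP[x xK Ez]].
  by have := sNK x xK; rewrite -Ez zK.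
have fG x : x \in K -> is_face A (A :\: [set x; s x]).
  move=> xK; have [y yK yx] : exists2 y, y \in K & y != x.
    have : (0 < #|K :\ x|)%N by move: cK; rewrite (cardsD1 x) xK; lia.
    by case/card_gt0P => y; rewrite !inE => /andP[]; exists y.
  have [|G [fG yG nG rG]] := @facet_omit A d y x cA rA (sK y yK).
    by apply: KK => //; rewrite eq_sym.
  have xG : x \notin G.
    have := setD11 x (nbrs A y); rewrite -nG inE => /negbT.
    by rewrite KK // eq_sym.
  have KG z : z \in K -> z != x -> z \in G.
    move=> zK zx; have [->//|zy] := eqVneq z y.
    have : z \in nbrs A y :\ x by rewrite in_setD1 zx KK.
    by rewrite -nG in_setI => /andP[].
  have sG z : z \in K -> z != x -> s z \in G.
    move=> zK zx; apply: (nbr_in cA rA (sK z zK) fG (KG z zK zx) rG (u := x)) => //.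
    - by apply: KK => //; rewrite eq_sym.
    - exact: sN.
    - by apply: contraNneq (sNK z zK) => ->.
  have sxG : s x \notin G.
    apply/negP => sxG; apply: npA; exists x; first exact: KA.
    suff -> : A :\ x = G by [].
    apply/eqP; rewrite eqEsubset; apply/andP; split; apply/subsetP => z.
      rewrite !inE {1}AE => /andP[zx]; rewrite inE => /orP[zK|/imsetP[w wK ->]].
        exact: KG.
      by have [->//|wx] := eqVneq w x; exact: sG.
    move=> zG; rewrite !inE (subsetP (face_sub fG)) // andbT.
    by apply: contraTneq zG => ->.
  suff -> : A :\: [set x; s x] = G by [].
  apply/eqP; rewrite eqEsubset; apply/andP; split; apply/subsetP => z.
    rewrite !inE negb_or {1}AE => /andP[/andP[zx zsx]].
    rewrite inE => /orP[zK|/imsetP[w wK Ez]]; first exact: KG.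
    by rewrite Ez; apply: sG => //; apply: contraNneq zsx => <-; rewrite Ez.
  move=> zG; rewrite !inE (subsetP (face_sub fG)) // andbT negb_or.
  by apply/andP; split; apply: contraTneq zG => ->.
pose t z := if z \in K then s z else odflt z [pick x in K | s x == z].
have tK x : x \in K -> t x = s x by rewrite /t => ->.
have tsK x : x \in K -> t (s x) = x.
  move=> xK; rewrite /t (negbTE (sNK x xK)); case: pickP => [y /andP[yK /eqP E]|].
    exact: s_inj.
  by move/(_ x); rewrite xK eqxx.
exists K, t; split=> //; split=> // [|x|x]; first exact: face_sub fK.
  rewrite {1}AE inE => /orP[xK|/imsetP[y yK ->]].
    rewrite tK // tsK // (negbTE (sNK _ _)) // xK; split=> //.
    exact: subsetP (nbrs_sub A x) _ (sN x xK).
  by rewrite tsK // tK // yK (sNK y yK); split=> //; exact: KA.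
rewrite {1}AE inE => /orP[xK|/imsetP[y yK ->]]; first by rewrite tK //; exact: fG.
by rewrite tsK // setUC; exact: fG.
Qed.

(** Functionals with prescribed zeros: [f x] defines the side that omits the edge
from [x] to [s x], and [g] defines the base [K]. *)
Lemma prism_functionals A K s : prism_data A K s ->
  exists (f : T -> 'cV[R]_N) g, [/\ forall x y, x \in A -> y \in A ->
       if (y == x) || (y == s x) then is_true (0 < ev (f x) y) else ev (f x) y = 0 &
     forall y, y \in A -> if y \in K then ev g y = 0 else is_true (0 < ev g y)].
Proof.
move=> [KA sP [g g0 Eg] fP].
have /choice[f fE] x : exists c, x \in A -> forall y, y \in A ->
    if (y == x) || (y == s x) then is_true (0 < ev c y) else ev c y = 0.
  have [xA|] := boolP (x \in A); last by exists 0.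
  have [c c0 Ec] := fP x xA; exists c => _ y yA.
  have /setP/(_ y) := Ec; rewrite !inE yA /= andbT.
  case: ifP => _ /= E; last by apply/eqP; rewrite -E.
  by rewrite lt_def -E c0.
exists f, g; split=> [x y xA|y yA]; first exact: fE.
have /setP/(_ y) := Eg; rewrite !inE yA /= => ->.
by case: ifPn => [/eqP|gy] //; rewrite lt_def gy g0.
Qed.

(** The second base is a face too: a suitable positive combination of the side
functionals agrees with [g] on [A :\: K], and exceeds it on [K]. *)
Lemma prism_sym A K s : prism_data A K s -> prism_data A (A :\: K) s.
Proof.
move=> pA; have [f [g [fE gE]]] := prism_functionals pA.
have [KA sP fK fP] := pA; split=> //; first exact: subsetDl.
  move=> x xA; have [sxA ssx sxK] := sP x xA; split=> //.
  by rewrite !inE sxA xA !andbT sxK.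
pose h := \sum_(x in A :\: K) (ev g x / ev (f x) x) *: f x - g.
have hE y : y \in A -> if y \in K then is_true (0 < ev h y) else ev h y = 0.
  move=> yA; have := gE y yA; rewrite /h evB ev_sum; case: ifPn => yK gy.
    rewrite gy subr0; have [syA ssy syK] := sP y yA.
    have sygt : 0 < ev (f (s y)) (s y).
      by have := fE _ _ syA syA; rewrite eqxx.
    rewrite (bigD1 (s y)) ?inE ?syA ?syK ?yK //= ltr_wpDr //.
      apply: sumr_ge0 => z /andP[/setDP[zA zK] zsy]; rewrite evZ.
      have := fE z y zA yA; rewrite ifF => [->|]; first by rewrite mulr0.
      apply/negP => /orP[/eqP Ey|/eqP Ey]; first by rewrite -Ey yK in zK.
      by have [_ ssz _] := sP z zA; rewrite -ssz -Ey eqxx in zsy.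
    rewrite evZ; have := fE _ y syA yA; rewrite ssy eqxx orbT => fy.
    rewrite mulr_gt0 // divr_gt0 //; have := gE _ syA.
    by rewrite syK yK.
  rewrite (bigD1 y) ?inE ?yA ?yK //= big1 ?addr0 ?evZ.
    by rewrite divfK ?subrr //; have := fE y y yA yA; rewrite eqxx => /gt_eqF->.
  move=> z /andP[/setDP[zA zK] zy]; rewrite evZ.
  have := fE z y zA yA; rewrite ifF => [->|]; first by rewrite mulr0.
  apply/negP => /orP[/eqP Ey|/eqP Ey]; first by rewrite Ey eqxx in zy.
  by have [_ _ szK] := sP z zA; rewrite Ey szK zK in yK.
exists h => [x xA|]; first by have := hE x xA; case: ifP => _ => [/ltW|->].
apply/setP => y; rewrite !inE; have [yA|yA] := boolP (y \in A); rewrite ?andbF //.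
by have := hE y yA; case: ifPn => [_ /gt_eqF->|_ ->]; rewrite ?eqxx.
Qed.

Lemma prism_card A K s : prism_data A K s -> #|A| = (2 * #|K|)%N.
Proof.
move=> [KA sP _ _]; rewrite -(cardsID K A) (setIidPr KA) mul2n -addnn; congr addn.
rewrite -(@card_in_imset _ _ s (mem K)); last first.
  move=> x y xK yK E; have [_ <- _] := sP x (subsetP KA _ xK).
  by have [_ <- _] := sP y (subsetP KA _ yK); rewrite E.
congr #|pred_of_set _|; apply/setP => z; rewrite inE; apply/andP/imsetP.
  move=> [zK zA]; have [szA ssz szK] := sP z zA.
  by exists (s z); rewrite // szK.
move=> [x xK ->]; have [sxA _ sxK] := sP x (subsetP KA _ xK).
by rewrite sxK negbK.
Qed.

Lemma prism_rk_base A K s : prism_data A K s -> rk K = #|K|.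
Proof.
move=> pA; have [f [g [fE gE]]] := prism_functionals pA; have [KA sP _ _] := pA.
apply: rk_indep => x xK; have xA := subsetP KA _ xK; exists (f x).
  move=> y yK yx; have := fE x y xA (subsetP KA _ yK); rewrite (negbTE yx) /=.
  case: eqP => // E; have [_ _] := sP x xA; by rewrite -E yK xK.
by have := fE x x xA xA; rewrite eqxx /= => /gt_eqF->.
Qed.

(** The sum of the functionals of the sides that omit an edge outside [B] defines [B]. *)
Lemma prism_closed_face A K s B : prism_data A K s -> B \subset A ->
  (forall x, x \in B -> s x \in B) -> is_face A B.
Proof.
move=> pA BA H; have [f [g [fE gE]]] := prism_functionals pA; have [_ sP _ _] := pA.
exists (\sum_(z in A :\: B) f z) => [x xA|].
  rewrite ev_sum sumr_ge0 // => z /setDP[zA _].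
  by have := fE z x zA xA; case: ifP => _ => [/ltW|->].
apply/setP => x; rewrite inE; have [xA|xA] := boolP (x \in A); last first.
  by apply: contraNF xA => /(subsetP BA).
rewrite ev_sum /=; have [xB|xB] := boolP (x \in B).
  rewrite big1 ?eqxx // => z /setDP[zA zB]; have := fE z x zA xA; rewrite ifF //.
  apply/negP => /orP[/eqP E|/eqP E]; first by rewrite -E xB in zB.
  by have [_ ssz _] := sP z zA; rewrite -ssz -E H in zB.
rewrite (bigD1 x) ?inE ?xA ?xB //= gt_eqF // ltr_wpDr //.
  apply: sumr_ge0 => z /andP[/setDP[zA _] _].
  by have := fE z x zA xA; case: ifP => _ => [/ltW|->].
by have := fE x x xA xA; rewrite eqxx.
Qed.

Lemma prism_nbr_row A K s x y : prism_data A K s -> x \in K -> y \in K -> y != x ->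
  y \in nbrs A x.
Proof. by move=> pA; have [_ _ fK _] := pA; exact: simplex_nbr fK (prism_rk_base pA). Qed.

Lemma prism_nbr_col A K s x : prism_data A K s -> x \in A -> s x \in nbrs A x.
Proof.
move=> pA xA; have [_ sP _ _] := pA; have [sxA ssx sxK] := sP x xA.
apply/nbrsP; split=> //.
  by apply/negP => /eqP E; move: sxK; rewrite E; case: (_ \in _).
apply: (prism_closed_face pA); first exact: set2_sub.
by move=> z; rewrite !inE => /orP[]/eqP->; rewrite ?ssx eqxx ?orbT.
Qed.

(** * Existence of a facet that is a prism *)

Lemma nonsimple_face A F : convex_position A -> is_face A F ->
  nonsimple F \subset nonsimple A :&: F.
Proof.
move=> cA fF; apply/subsetP => x; rewrite !inE => /andP[xF sx].
rewrite xF (subsetP (face_sub fF)) // andbT /=.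
by apply: contra sx => sx; exact: simple_face cA sx fF xF.
Qed.

(** A facet whose complement is a single vertex is the base of a pyramid. *)
Lemma facet_card A d F : convex_position A -> rk A = d.+1 -> ~ pyr A ->
  is_face A F -> rk F = d -> (#|F|.+2 <= #|A|)%N.
Proof.
move=> cA rA npA fF rF; have FA := face_sub fF.
have : (0 < #|A :\: F|)%N.
  rewrite card_gt0; apply/negP; rewrite setD_eq0 => AF.
  have E : A = F by apply/eqP; rewrite eqEsubset AF.
  by move: rA; rewrite E rF; lia.
case/card_gt0P => x /setDP[xA xF].
suff : (1 < #|A :\: F|)%N by rewrite cardsDS //; lia.
rewrite ltnNge; apply/negP => c1; apply: npA; exists x => //.
suff -> : A :\ x = F by [].
have E : A :\: F = [set x].
  by apply/esym/eqP; rewrite eqEcard sub1set inE xF xA cards1.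
by rewrite -E setDDr setDv set0U (setIidPr FA).
Qed.

(** The apex of a pyramid is adjacent to every vertex of the base, and a simple
vertex has only [rk F - 1] neighbours in [F]. *)
Lemma apex_simple A F v : convex_position A -> is_face A F ->
  simple A v -> v \in F -> is_face F (F :\ v) -> (#|F| <= rk F)%N.
Proof.
move=> cA fF sv vF fv; rewrite (rk_face cA sv fF vF) (cardsD1 v) vF ltnS.
apply/subset_leq_card/subsetP => x; rewrite !inE => /andP[xv xF].
have := pyr_adj vF (convpos_face cA fF) fv xF xv; rewrite setUC => fx.
rewrite xF xv (subsetP (face_sub fF)) //= andbT.
by apply/asboolP; exact: face_trans fF fx.
Qed.

Section InductionStep.
Variables (one : 'cV[R]_N) (A : {set T}) (e : nat).
Hypothesis one1 : forall x, ev one x = 1.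
Hypothesis cA : convex_position A.
Hypothesis rA : rk A = e.+2.
Hypothesis Ae : (#|A| <= 2 * e.+1)%N.
Hypothesis NA : (#|nonsimple A| + 1 <= e)%N.
Hypothesis npA : ~ pyr A.

Section PyramidalFacets.
Hypothesis IH : forall F, is_face A F -> rk F = e.+1 -> (#|F| <= 2 * e)%N ->
  (#|nonsimple F| + 2 <= e)%N -> pyr F \/ prismlike e F.
Hypothesis noprism : forall F, is_face A F -> rk F = e.+1 ->
  (#|nonsimple A :&: F| + 2 <= e)%N -> ~ prismlike e F.

Variables (v : T) (f : T -> {set T}).
Hypothesis sv : simple A v.
Hypothesis fP : forall u, u \in nbrs A v ->
  [/\ is_face A (f u), v \in f u, nbrs A v :&: f u = nbrs A v :\ u & rk (f u) = e.+1].

(** The facet [f i] through [v] opposite to [i] is not a simplex and contains few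
nonsimple vertices, so that the induction hypothesis applies to it. *)
Definition good_nbr i := [&& i \in nbrs A v, (e.+1 < #|f i|)%N &
  (#|nonsimple A :&: f i| + 2 <= e)%N].

Lemma notin_f u : u \in nbrs A v -> u \notin f u.
Proof.
move=> uv; have [_ _ nf _] := fP uv; have := setD11 u (nbrs A v).
by rewrite -nf in_setI uv /= => ->.
Qed.

(** Under the assumption that no such facet is a prism, [f i] is a pyramid. Its
apex [k] is nonsimple by [apex_simple], and its base lies on the facet opposite
to [k]. *)
Lemma nonsimple_apex i : good_nbr i -> exists k,
  [/\ k \in nbrs A v, k \in f i, k \in nonsimple A, is_face (f i) (f i :\ k) &
      f i :\ k \subset f k].
Proof.
move=> /and3P[iv fi_big fiN]; have [fF vF nF rF] := fP iv.
have cF := convpos_face cA fF.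
have [||[k kF fk]|] := IH fF rF.
- by move: (facet_card cA rA npA fF rF) Ae => /leq_trans/[apply]; rewrite mulnS addnC addn2 !ltnS.
- apply: leq_trans fiN; rewrite leq_add2r subset_leq_card //.
  exact: nonsimple_face.
- have nsk x : simple A x -> x \in f i -> ~ is_face (f i) (f i :\ x).
    by move=> sx xF /(apex_simple cA fF sx xF); rewrite rF leqNgt fi_big.
  have vk : v != k by apply/eqP => E; move: fk; rewrite -E; exact: nsk.
  have kv : k \in nbrs A v.
    have := pyr_adj kF cF fk vF vk => fvk; apply/nbrsP; split.
    - exact: (subsetP (face_sub fF)).
    - by rewrite eq_sym.
    - exact: face_trans fF fvk.
  exists k; split=> //.
    rewrite inE (subsetP (face_sub fF)) //=; apply/negP => sk; exact: nsk fk.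
  have [fK vK nK rK] := fP kv.
  apply: (@face_le A _ _ v cA (face_trans fF fk) fK) => //.
    by rewrite !inE vk.
  apply/subsetP => x; rewrite in_setI in_setD1 => /and3P[xv xk _].
  have : x \in nbrs A v :\ k by rewrite in_setD1 xk.
  by rewrite -nK in_setI => /andP[].
by move=> pr; case: (noprism fF rF fiN pr).
Qed.

(** The facet [f k] contains [i] and the base of [f i], so by maximality it has no
further vertices. *)
Lemma apex_exchange i : good_nbr i -> (forall j, good_nbr j -> (#|f j| <= #|f i|)%N) ->
  exists k, [/\ good_nbr k, k \in nonsimple A, k \in f i, is_face (f i) (f i :\ k) &
             f k = i |: (f i :\ k)].
Proof.
move=> gi imax; have [k [kv kfi kN fk sk]] := nonsimple_apex gi.
have /and3P[iv fi_big fiN] := gi.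
have [fF vF nF rF] := fP iv; have [fK vK nK rK] := fP kv.
have ifi := notin_f iv; have kfk := notin_f kv.
have ik : i != k by apply/eqP => E; move: ifi; rewrite {1}E kfi.
have ifk : i \in f k.
  have : i \in nbrs A v :\ k by rewrite in_setD1 ik.
  by rewrite -nK in_setI => /andP[].
have sub : i |: (f i :\ k) \subset f k by rewrite subUset sub1set ifk.
have c1 : #|i |: (f i :\ k)| = #|f i|.
  rewrite cardsU1 in_setD1 (negbTE ifi) andbF /= add1n.
  by rewrite [RHS](cardsD1 k) kfi.
have gk : good_nbr k.
  apply/and3P; split=> //; first by rewrite (leq_trans fi_big) // -c1 subset_leq_card.
  apply: leq_trans (_ : #|nonsimple A :\ k| + 2 <= _)%N.
    rewrite leq_add2r subset_leq_card //; apply/subsetP => x.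
    rewrite in_setI in_setD1 => /andP[-> xfk]; rewrite andbT.
    by apply/eqP => E; move: kfk; rewrite -{1}E xfk.
  by move: NA; rewrite (cardsD1 k) kN add1n addn1 addn2.
exists k; split=> //; apply/esym/eqP; rewrite eqEcard sub c1; exact: imax gk.
Qed.

(** Take [f i] of maximal size. Exchanging apexes twice yields facets [f k] with
apex [m] and [f m] with apex [k] over the same base [Q]. Every vertex of [Q] is
adjacent to [k], so [k] is the only neighbour outside [f k] of a simple vertex
of [Q]. Thus the nonsimple vertices [k], [m] and those of [Q] separate the
simple vertices of [Q] from the vertices outside [f k], which contradicts
[not_separated]. *)
Lemma no_good_nbr i0 : ~ good_nbr i0.
Proof.
move=> gi0.
have [i gi imax] := @arg_maxnP _ i0 good_nbr (fun i => #|f i|) gi0.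
have [k [gk kN kfi fk Efk]] := apex_exchange gi imax.
have ckmax j : good_nbr j -> (#|f j| <= #|f k|)%N.
  move=> /imax fj; apply: leq_trans fj _; rewrite Efk cardsU1 in_setD1.
  have /and3P[iv _ _] := gi; rewrite (negbTE (notin_f iv)) andbF add1n.
  by rewrite [X in (X <= _)%N](cardsD1 k) kfi.
have [m [gm mN mfk fm Efm]] := apex_exchange gk ckmax.
have /and3P[kv _ _] := gk; have /and3P[mv _ _] := gm.
have [fK vK nK rK] := fP kv; have [fM vM nM rM] := fP mv.
have kfk := notin_f kv.
have km : k != m by apply/eqP => E; move: kfk; rewrite {1}E mfk.
set Q := f k :\ m in Efm fm.
(* The intersection of [f k] and [f m], which is their common base. *)
have fQ : is_face (f m) (f m :\ k).
  have -> : f m :\ k = f k :&: f m.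
    rewrite Efm; apply/setP => z; rewrite !inE.
    by have [->|zk] := eqVneq z k; rewrite /= ?(negbTE kfk) //= andbC; case: (z \in f k); rewrite ?andbF.
  apply: (face_restrict (B := f m) (faceI fK fM)); first exact: subsetIr.
  exact: face_sub fM.
have kfm : k \in f m by rewrite Efm !inE eqxx.
have QE : Q = f m :\ k.
  rewrite Efm; apply/setP => z; rewrite !inE.
  by have [->|zk] := eqVneq z k; rewrite /= ?(negbTE kfk) ?andbF.
have adjk r : r \in Q -> r \in nbrs A k.
  rewrite QE => /setD1P[rk' rfm]; apply/nbrsP; split=> //.
    exact: (subsetP (face_sub fM)).
  have := pyr_adj kfm (convpos_face cA fM) fQ rfm rk'; rewrite setUC.
  exact: face_trans.
have vm : v != m by apply: contraTneq mv => <-; exact: nbrs_notin.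
have vN : v \notin nonsimple A by rewrite inE sv andbF.
have mQ : m \notin Q by rewrite !inE eqxx.
have kQ : k \notin Q by rewrite inE (negbTE kfk) andbF.
pose X := k |: (m |: (nonsimple A :&: Q)).
pose D := A :\: (k |: f k).
pose E := Q :\: nonsimple A.
have XN : X \subset nonsimple A.
  by rewrite !subUset !sub1set kN mN subsetIl.
have fkQ : f k = m |: Q by rewrite setD1K.
have kA : k \in A by have /nbrsP[] := kv.
have fkA := subsetP (face_sub fK).
have [y0 y0D] : exists y, y \in D.
  apply/card_gt0P; rewrite cardsDS ?subUset ?sub1set ?kA ?(face_sub fK) //.
  by rewrite subn_gt0 cardsU1 kfk add1n; exact: facet_card cA rA npA fK rK.
have DE : [disjoint D & E].
  rewrite disjoint_subset; apply/subsetP => z; rewrite !inE negb_or => /andP[/andP[zk zfk] zA].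
  by rewrite (negbTE zfk) !andbF.
have nE r : r \in E -> nbrs A r \subset E :|: X.
  move=> /setDP[rQ rN]; have rfk : r \in f k by rewrite fkQ inE rQ orbT.
  have rA' := fkA _ rfk; have sr : simple A r by move: rN; rewrite inE rA' /= negbK.
  apply/subsetP => u ur; have [->|uk] := eqVneq u k; first by rewrite !inE eqxx !orbT.
  have kr : k \in nbrs A r by apply: nbrsC => //; exact: adjk.
  have := nbr_in cA rA sr fK rfk rK kr kfk ur uk.
  rewrite fkQ inE in_set1 => /orP[/eqP->|uQ]; first by rewrite !inE eqxx !orbT.
  by rewrite /E /X in_setU in_setD uQ andbT !in_setU in_setI uQ; case: (u \in nonsimple A); rewrite ?orbT.
have AE : A = X :|: D :|: E.
  apply/setP => z; apply/idP/idP => [zA|].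
    have [->|zk] := eqVneq z k; first by rewrite !inE eqxx.
    have [zfk|zfk] := boolP (z \in f k); last by rewrite !in_setU in_setD in_setU1 negb_or zk zfk zA /= !orbT.
    move: zfk; rewrite fkQ => /setU1P[->|zQ]; first by rewrite !inE eqxx !orbT.
    rewrite /E /X !in_setU in_setD zQ in_setI zQ andbT.
    by case: (z \in nonsimple A); rewrite ?orbT.
  rewrite in_setU in_setU => /orP[/orP[zX|/setDP[]//]|/setDP[zQ _]].
    by have := subsetP XN z zX; rewrite inE => /andP[].
  by apply: fkA; rewrite fkQ inE zQ orbT.
apply: (@not_separated one A X D E e.+1 y0 v one1 cA rA) => //.
- by rewrite addn2 ltnS; apply: leq_ltn_trans (subset_leq_card XN) _; rewrite -addn1.
- by rewrite inE vN; rewrite !inE vm vK.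
move=> y yD; have yA : y \in A by case/setDP: yD.
apply/subsetP => u uy; have uA : u \in A := subsetP (nbrs_sub A y) u uy.
move: (uA); rewrite {1}AE !in_setU => /orP[/orP[->|->]|uE]; rewrite ?orbT //.
have := subsetP (nE u uE) y (nbrsC yA uy); rewrite in_setU => /orP[yE|yX].
  by rewrite (disjointFr DE yD) in yE.
case/setDP: yD => _; rewrite in_setU1 negb_or => /andP[yk yfk].
case/setU1P: yX => [Ey|]; first by rewrite Ey eqxx in yk.
rewrite fkQ in_setU1 in yfk; case/norP: yfk => ym yQ.
by case/setU1P => [Ey|/setIP[_ yQ']]; [rewrite Ey eqxx in ym|rewrite yQ' in yQ].
Qed.

End PyramidalFacets.

Lemma prism_facet_exists v F :
  (forall F, is_face A F -> rk F = e.+1 -> (#|F| <= 2 * e)%N ->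
     (#|nonsimple F| + 2 <= e)%N -> pyr F \/ prismlike e F) ->
  simple A v -> is_face A F -> v \in F -> rk F = e.+1 -> (e.+1 < #|F|)%N ->
  (#|nonsimple A :&: F| + 2 <= e)%N ->
  exists F', [/\ is_face A F', rk F' = e.+1, (#|nonsimple A :&: F'| + 2 <= e)%N &
             prismlike e F'].
Proof.
move=> IH sv fF vF rF Fbig FN; apply: contrapT => noex.
have noprism F' : is_face A F' -> rk F' = e.+1 ->
    (#|nonsimple A :&: F'| + 2 <= e)%N -> ~ prismlike e F'.
  by move=> fF' rF' FN' pF'; apply: noex; exists F'.
have /choice[f fP] u : exists G, u \in nbrs A v ->
    [/\ is_face A G, v \in G, nbrs A v :&: G = nbrs A v :\ u & rk G = e.+1].
  have [uv|] := boolP (u \in nbrs A v); last by exists A.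
  by have [G] := facet_omit cA rA sv uv; exists G.
have [u Eu] := one_outside cA rA sv fF vF rF.
have /setDP[uv uF] : u \in nbrs A v :\: F by rewrite Eu inE.
have [fG vG nG rG] := fP u uv.
have EF : F = f u.
  apply: (face_eq cA fF fG vF vG); rewrite nG -Eu setDDr setDv set0U.
  by [].
apply: (no_good_nbr IH noprism sv fP (i0 := u)); apply/and3P.
by rewrite -EF.
Qed.

End InductionStep.

(** * Polytopes with a facet that is a prism *)

(** For a ridge [Q] of the facet [F], the second facet through [Q] is the one at a
simple vertex [r] of [Q] that omits the neighbour [t] of [r] in [F]. *)
Lemma ridge_facet A d F Q r t : convex_position A -> rk A = d.+1 -> is_face A F ->
  is_face A Q -> Q \subset F -> r \in Q -> simple A r -> t \in nbrs A r ->
  nbrs A r :&: Q = (nbrs A r :&: F) :\ t ->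
  exists Y, [/\ is_face A Y, rk Y = d, Y :&: F = Q & t \notin Y].
Proof.
move=> cA rA fF fQ QF rQ sr tr E; have [Y [fY rY nY kY]] := facet_omit cA rA sr tr.
exists Y; split=> //.
  apply: (face_eq (v := r) cA (faceI fY fF) fQ); rewrite // ?inE ?rY ?(subsetP QF) //.
  by rewrite E setIA nY setIDAC.
by have := setD11 t (nbrs A r); rewrite -nY in_setI tr /= => ->.
Qed.

Section PrismFacet.
Variables (A F K : {set T}) (s : T -> T) (e : nat) (a b : T).
Hypothesis cA : convex_position A.
Hypothesis rA : rk A = e.+2.
Hypothesis fF : is_face A F.
Hypothesis rF : rk F = e.+1.
Hypothesis FN : (#|nonsimple A :&: F| + 2 <= e)%N.
Hypothesis AF : A :\: F = [set a; b].
Hypothesis ab : a != b.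

Let FA : {subset F <= A} := subsetP (face_sub fF).

Lemma notin_facet x : x \in A -> (x \notin F) = (x == a) || (x == b).
Proof. by move=> xA; have /setP/(_ x) := AF; rewrite !inE xA andbT. Qed.

Lemma out1_in : a \in A.
Proof. by have /setP/(_ a) := AF; rewrite !inE eqxx => /andP[]. Qed.
Lemma out2_in : b \in A.
Proof. by have /setP/(_ b) := AF; rewrite !inE eqxx orbT => /andP[]. Qed.
Lemma out1_notin : a \notin F. Proof. by rewrite notin_facet ?out1_in ?eqxx. Qed.
Lemma out2_notin : b \notin F. Proof. by rewrite notin_facet ?out2_in ?eqxx ?orbT. Qed.

Lemma simple_in_F x : x \in F -> x \notin nonsimple A :&: F -> simple A x.
Proof. by move=> xF; rewrite !inE xF FA // andbT negbK. Qed.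

Lemma simple_exists S : S \subset F -> (e <= #|S|.+1)%N ->
  exists2 x, x \in S & simple A x.
Proof.
move=> SF eS; have : (0 < #|S :\: (nonsimple A :&: F)|)%N.
  rewrite cardsD subn_gt0; apply: leq_ltn_trans (subset_leq_card (subsetIr _ _)) _.
  by move: (leq_trans FN eS); rewrite addn2 !ltnS.
case/card_gt0P => x /setDP[xS xN]; exists x => //.
exact: simple_in_F (subsetP SF x xS) xN.
Qed.

(** A facet [Y] other than [F] that omits [b] must contain [a], and is then a
pyramid over its intersection with [F]. *)
Lemma apex_nbrs Y x : is_face A Y -> rk Y = e.+1 -> b \notin Y -> x \in F ->
  x \notin Y -> a \in Y /\ forall r, r \in Y :&: F -> a \in nbrs A r.
Proof.
move=> fY rY bY xF xY; have YA := subsetP (face_sub fY).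
have EY z : z \in Y -> z \in F \/ z = a.
  move=> zY; have [|zF] := boolP (z \in F); first by left.
  move: zF; rewrite notin_facet ?YA // => /orP[]/eqP E; first by right.
  by move: bY; rewrite -E zY.
have aY : a \in Y.
  apply: contraT => aY; have YF : Y \subset F.
    apply/subsetP => z zY; have [//|E] := EY z zY.
    by move: aY; rewrite -E zY.
  case: fY => c c0 Ec; have cY z : z \in Y -> ev c z = 0 by rewrite Ec inE => /andP[_ /eqP].
  have := rk_eq_ev0 YF _ cY; rewrite rY rF => /(_ erefl x xF) cx.
  by move: xY; rewrite Ec inE FA // cx eqxx.
split=> // r /setIP[rY' rF']; have ra : r != a by apply: contraNneq out1_notin => <-.
have fYF : is_face Y (Y :\ a).
  have -> : Y :\ a = Y :&: F.
    apply/setP => z; rewrite !inE; have [->|za] := eqVneq z a.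
      by rewrite (negbTE out1_notin) andbF.
    case zY : (z \in Y) => //=; have [->//|E] := EY z zY.
    by rewrite E eqxx in za.
  by apply: face_restrict (faceI fY fF) _ (face_sub fY); exact: subsetIl.
apply/nbrsP; split; [exact: out1_in|by rewrite eq_sym|].
exact: face_trans fY (pyr_adj aY (convpos_face cA fY) fYF rY' ra).
Qed.

Hypothesis pK : prism_data F K s.
Hypothesis cK : #|K| = e.

Let KF : {subset K <= F}. Proof. by case: pK => /subsetP. Qed.
Let sP x : x \in F -> [/\ s x \in F, s (s x) = x & (s x \in K) = (x \notin K)].
Proof. by case: pK => _ H _ _; exact: H. Qed.

Lemma cardF : #|F| = (2 * e)%N.
Proof. by rewrite (prism_card pK) cK. Qed.

Lemma card_cols x : x \in F -> #|F :\: [set x; s x]| = (2 * e - 2)%N.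
Proof.
move=> xF; have [sxF _ sxK] := sP xF; rewrite cardsDS ?subUset ?sub1set ?xF ?sxF //.
rewrite cardF cards2 (_ : x != s x) //; apply/eqP => E.
by move: sxK; rewrite -E; case: (_ \in _).
Qed.

Lemma prism_nbrs x : x \in K -> simple A x -> nbrs A x :&: F = s x |: (K :\ x).
Proof.
move=> xK sx; have xF := KF xK; apply/esym/eqP; rewrite eqEcard; apply/andP; split.
  rewrite -(nbrs_face fF xF) subUset sub1set (prism_nbr_col pK xF) /=.
  by apply/subsetP => y /setD1P[yx yK]; apply: prism_nbr_row pK _ _ _.
have := rk_face cA sx fF xF; rewrite rF => -[<-].
have [_ _ sxK] := sP xF; rewrite cardsU1 !inE sxK xK andbF /=.
by rewrite add1n; move: cK; rewrite (cardsD1 x) xK add1n => ->.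
Qed.

(** The facet other than [F] through the base [K] of the prism [F]. *)
Lemma row_facet x : x \in K -> simple A x ->
  exists Y, [/\ is_face A Y, rk Y = e.+1, Y :&: F = K & s x \notin Y].
Proof.
move=> xK sx; have [KF' sP' fK _] := pK; have xF := KF xK.
have [_ _ sxK] := sP xF.
apply: (ridge_facet cA rA fF (face_trans fF fK) KF' xK sx).
  by have := prism_nbr_col pK xF; rewrite (nbrs_face fF xF) inE => /andP[].
rewrite prism_nbrs // -(setIidPr KF') setIA prism_nbrs //.
apply/setP => z; rewrite !inE; have [->|zsx] := eqVneq z (s x).
  by rewrite sxK xK /= ?andbF.
by case zK : (z \in K); rewrite ?andbF //= (KF zK) !andbT.
Qed.

(** The facet other than [F] through a side of the prism [F], found at a simple
vertex [r] of that side. *)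
Lemma col_facet_aux r x : r \in K -> simple A r -> x \in K -> x != r ->
  exists Y, [/\ is_face A Y, rk Y = e.+1 & Y :&: F = F :\: [set x; s x]].
Proof.
move=> rK sr xK xr; have [KF' sP' _ fc] := pK; have xF := KF xK; have rF' := KF rK.
have [sxF ssx sxK] := sP xF; have [srF ssr srK] := sP rF'.
have rsx : r != s x by apply/eqP => E; move: sxK; rewrite -E rK xK.
have nE : nbrs A r :&: F = s r |: (K :\ r) by exact: prism_nbrs.
have [||||||Y [fY rY EY _]] := @ridge_facet A e.+1 F (F :\: [set x; s x]) r x cA rA fF.
- exact: face_trans fF (fc x xF).
- exact: subsetDl.
- by rewrite !inE negb_or rF' eq_sym xr rsx.
- exact: sr.
- have : x \in nbrs A r :&: F by rewrite nE !inE xr xK orbT.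
  by rewrite inE => /andP[].
- rewrite setIDA nE; apply/setP => z; rewrite !inE negb_or.
  have [->|zx] := eqVneq z x; first by rewrite /= ?andbF.
  have [->|zsx] := eqVneq z (s x); last by rewrite /= ?andbT.
  rewrite sxK xK /= ?andbF ?orbF; apply/esym/negbTE/eqP => E.
  by move: xr; rewrite -ssx E ssr eqxx.
by exists Y.
Qed.

End PrismFacet.

Lemma prism_flip F K s e : prism_data F K s -> #|K| = e ->
  prism_data F (F :\: K) s /\ #|F :\: K| = e.
Proof.
move=> pK cK; split; first exact: prism_sym.
by have [KF _ _ _] := pK; rewrite cardsDS // (prism_card pK) cK mul2n -addnn addnK.
Qed.

Section PrismFacetExtension.
Variables (one : 'cV[R]_N) (A F : {set T}) (e : nat).
Hypothesis one1 : forall x, ev one x = 1.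
Hypothesis cA : convex_position A.
Hypothesis rA : rk A = e.+2.
Hypothesis Ae : (#|A| <= 2 * e.+1)%N.
Hypothesis npA : ~ pyr A.
Hypothesis fF : is_face A F.
Hypothesis rF : rk F = e.+1.
Hypothesis FN : (#|nonsimple A :&: F| + 2 <= e)%N.

(** Some vertex outside the edge from [x] to [s x] is simple; exchanging the bases
and the two ends of the edge reduces to [col_facet_aux]. *)
Lemma col_facet K s a b x : A :\: F = [set a; b] -> prism_data F K s -> #|K| = e -> x \in F ->
  exists Y, [/\ is_face A Y, rk Y = e.+1 & Y :&: F = F :\: [set x; s x]].
Proof.
move=> AF pK cK xF; have e2 : (2 <= e)%N by apply: leq_trans FN; rewrite leq_addl.
have [||r] := @simple_exists A F e fF FN (F :\: [set x; s x]).
- exact: subsetDl.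
- by rewrite (card_cols pK cK xF); move: e2; clear; lia.
rewrite !inE negb_or => /andP[/andP[rx rsx] rF'] sr.
wlog rK : K pK cK / r \in K.
  move=> H; have [|rK] := boolP (r \in K); first exact: H.
  have [pK' cK'] := prism_flip pK cK; apply: (H _ pK' cK'); by rewrite inE rK.
have [_ sP _ _] := pK; have [sxF ssx sxK] := sP x xF.
have [xK|xK] := boolP (x \in K).
  by apply: (col_facet_aux cA rA fF rF pK cK rK sr xK); rewrite eq_sym.
have sxK' : s x \in K by rewrite sxK.
have [|Y [fY rY EY]] := col_facet_aux cA rA fF rF pK cK rK sr sxK'.
  by rewrite eq_sym.
by exists Y; rewrite EY ssx setUC.
Qed.

Lemma one_nbr_outside a b r : A :\: F = [set a; b] -> a != b -> r \in F -> simple A r ->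
  a \in nbrs A r -> b \notin nbrs A r.
Proof.
move=> AF ab rF' sr ar; apply/negP => br.
have := nbr_in cA rA sr fF rF' rF ar (out1_notin AF) br; rewrite eq_sym => /(_ ab).
by rewrite (negbTE (out2_notin AF)).
Qed.

(** Let [Y] be the second facet through the side of [F] that omits [x] and [s x],
and suppose that it omits [b]. Then [a] is adjacent to all vertices of that
side, and a simple vertex of [F] has only one neighbour outside [F]. So the
neighbours of [b] are among [a], [x], [s x] and the nonsimple vertices of [F];
since [b] has at least [e + 1] neighbours, [x] and [s x] are simple and adjacent
to [b]. For [e = 2] all vertices of the triangle [Y] are simple. For larger [e],
counting shows that the facets through the other sides at [x], and the one
through the base at [x], contain [a]; but they cut out the edge from [x] to [b],
which does not contain [a]. *)
Lemma prism_facet_short K s a b x Y : A :\: F = [set a; b] -> a != b ->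
  prism_data F K s -> #|K| = e -> x \in F ->
  is_face A Y -> rk Y = e.+1 -> Y :&: F = F :\: [set x; s x] -> b \notin Y ->
  prismlike e.+1 A.
Proof.
move=> AF ab pK cK xF fY rY EY bY.
have e2 : (2 <= e)%N by apply: leq_trans FN; rewrite leq_addl.
wlog xK : x xF EY / x \in K.
  move=> H; have [_ sP _ _] := pK; have [sxF ssx sxK] := sP x xF.
  have [|xK] := boolP (x \in K); first exact: H.
  by apply: (H (s x)) => //; rewrite ?ssx ?sxK // EY setUC.
have [KF sP fK fc] := pK; have [sxF ssx sxK] := sP x xF.
have FA := subsetP (face_sub fF).
have xsx : x != s x by apply/eqP => E; move: sxK; rewrite -E xK.
have Rin r : r \in F -> r != x -> r != s x -> r \in Y :&: F.
  by move=> rF' rx rsx; rewrite EY !inE negb_or rx rsx.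
have xY : x \notin Y.
  by apply/negP => xY; have /setP/(_ x) := EY; rewrite !inE xY xF eqxx.
have [aY adja] := apex_nbrs cA fF rF AF fY rY bY xF xY.
have bA' := out2_in AF; have aA' := out1_in AF.
have nb u : u \in nbrs A b -> [|| u == a, u == x, u == s x | u \in nonsimple A :&: F].
  move=> ub; have /nbrsP[uA unb _] := ub.
  have [uF|] := boolP (u \in F); last by rewrite (notin_facet AF uA) (negbTE unb) orbF => ->.
  have [->|ux] := eqVneq u x; first by rewrite orbT.
  have [->|usx] := eqVneq u (s x); first by rewrite !orbT.
  rewrite !inE uA uF /= andbT; apply/orP; right; apply/negP => su.
  have := one_nbr_outside AF ab uF su (adja u (Rin u uF ux usx)).
  by rewrite (nbrsC bA' ub).
(* The neighbours [a], [u] and nonsimple vertices of [F] are at most [e]. *)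
have too_few u : (forall z, z \in nbrs A b -> [|| z == a, z == u | z \in nonsimple A :&: F]) -> False.
  move=> H; have := rk_nbrs cA bA'; rewrite rA ltnS => h1.
  have h2 : (#|nbrs A b| <= #|a |: (u |: (nonsimple A :&: F))|)%N.
    by apply/subset_leq_card/subsetP => z /H; rewrite !inE.
  have h3 : (#|a |: (u |: (nonsimple A :&: F))| <= e)%N.
    apply: leq_trans FN; rewrite !cardsU1 addnA addnC leq_add2l.
    by do 2!case: (_ \notin _).
  by move: (leq_trans h1 (leq_trans h2 h3)); rewrite ltnn.
have xsimple : x \notin nonsimple A :&: F.
  apply/negP => xN; apply: (too_few (s x)) => z /nb /or4P[->|/eqP->|->|->]; by rewrite ?xN ?orbT.
have sxsimple : s x \notin nonsimple A :&: F.
  apply/negP => xN; apply: (too_few x) => z /nb /or4P[->|->|/eqP->|->]; by rewrite ?xN ?orbT.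
have sx : simple A x := simple_in_F fF xF xsimple.
have ssx' : simple A (s x) := simple_in_F fF sxF sxsimple.
have xb : x \in nbrs A b.
  apply: contrapT => /negP xb; apply: (too_few (s x)) => z zb; have := nb z zb.
  by have [Ez|//] := eqVneq z x; rewrite -Ez zb in xb.
have sxb : s x \in nbrs A b.
  apply: contrapT => /negP xb'; apply: (too_few x) => z zb; have := nb z zb.
  by have [Ez|//] := eqVneq z (s x); rewrite -Ez zb in xb'.
have bx : b \in nbrs A x by exact: nbrsC.
have bsx : b \in nbrs A (s x) by exact: nbrsC.
have AF' : A :\: F = [set b; a] by rewrite AF setUC.
have ba : b != a by rewrite eq_sym.
have ax : a \notin nbrs A x by exact: one_nbr_outside AF' ba xF sx bx.
have asx : a \notin nbrs A (s x) by exact: one_nbr_outside AF' ba sxF ssx' bsx.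
have [e2'|e3] := leqP e 2.
  have Ee : e = 2%N by apply/eqP; rewrite eqn_leq e2 e2'.
  have N0 : nonsimple A :&: F = set0.
    by apply: cards0_eq; move: FN; rewrite Ee addn2 !ltnS leqn0 => /eqP.
  have YE : Y = a |: (Y :&: F).
    apply/setP => z; rewrite in_setU1 in_setI; have [->//|za] := eqVneq z a.
    have [zY|//] := boolP (z \in Y) => /=; apply/esym; apply: contraT => zF.
    move: (zF); rewrite (notin_facet AF (subsetP (face_sub fY) z zY)) (negbTE za) /= => /eqP Ez.
    by rewrite -Ez zY in bY.
  have cYF : #|Y :&: F| = 2%N by rewrite EY (card_cols pK cK xF) Ee.
  have cY : #|Y| = 3%N.
    by rewrite YE cardsU1 inE (negbTE (out1_notin AF)) andbF cYF.
  apply: (@simplex_all_simple A e.+1 Y cA rA _ Ae npA fY) => //; rewrite ?cY ?Ee //.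
  move=> z; rewrite YE => /setU1P[->|/setIP[zY zF]]; last first.
    by apply: (simple_in_F fF zF); rewrite N0 inE.
  rewrite /simple aA' rA eqSS eqn_leq; have := rk_nbrs cA aA'; rewrite rA ltnS => ->.
  rewrite andbT; apply: leq_trans (_ : #|b |: (Y :&: F)| <= _)%N.
    apply/subset_leq_card/subsetP => u ua; have /nbrsP[uA una _] := ua.
    rewrite in_setU1; have [->//|ub] := eqVneq u b; rewrite /=.
    have uF : u \in F by apply: contraT; rewrite (notin_facet AF uA) (negbTE una) (negbTE ub).
    apply: Rin => //.
      by apply: contraNneq ax => <-; exact: nbrsC.
    by apply: contraNneq asx => <-; exact: nbrsC.
  by rewrite cardsU1 inE (negbTE bY) cYF Ee.
exfalso.
(* Otherwise [b] would be adjacent to all [2 e - 2 > e] vertices of the side. *)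
have cols y : y \in K -> y != x -> exists G, [/\ is_face A G, x \in G, a \in G & y \notin G].
  move=> yK yx; have yF := subsetP KF y yK.
  have [G [fG rG EG]] := col_facet AF pK cK yF; have [syF ssy syK] := sP y yF.
  have xG : x \in G.
    have : x \in G :&: F.
      rewrite EG !inE xF andbT negb_or eq_sym yx /=.
      by apply/eqP => E; move: syK; rewrite -E xK yK.
    by rewrite inE => /andP[].
  have yG : y \notin G.
    by apply/negP => yG; have /setP/(_ y) := EG; rewrite !inE yG yF eqxx.
  have yx' : y \in nbrs A x.
    have := prism_nbr_row pK xK yK yx; rewrite (nbrs_face fF xF) inE.
    by case/andP.
  exists G; split=> //; apply: contrapT => /negP aG.
  have [_ adjb] := apex_nbrs cA fF rF AF' fG rG aG yF yG.
  have : (#|G :&: F| <= #|x |: (s x |: (nonsimple A :&: F))|)%N.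
    apply/subset_leq_card/subsetP => z zG; have := nb z.
    have zF : z \in F by case/setIP: zG.
    have bz := adjb z zG; rewrite (nbrsC (FA z zF) bz) => /(_ isT).
    rewrite !in_setU1 => /or4P[/eqP za|->|->|->]; rewrite ?orbT //.
    by move: (out1_notin AF); rewrite -za zF.
  rewrite EG (card_cols pK cK yF) leqNgt => /negP[].
  apply: leq_ltn_trans (_ : e < _)%N; last by move: e3; clear; lia.
  apply: leq_trans FN; rewrite !cardsU1 addnA addnC leq_add2l.
  by do 2!case: (_ \notin _).
have [G [fG rG EG sxG]] := row_facet cA rA fF rF pK cK xK sx.
have KG z : z \in K -> z \in G by move=> zK; have := zK; rewrite -{1}EG inE => /andP[].
have aG : a \in G.
  apply: contrapT => /negP aG.
  have [_ adjb] := apex_nbrs cA fF rF AF' fG rG aG sxF sxG.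
  have : (#|K| <= #|x |: (nonsimple A :&: F)|)%N.
    apply/subset_leq_card/subsetP => z zK; have := nb z; have zF := subsetP KF z zK.
    have bz : b \in nbrs A z by apply: adjb; rewrite inE KG.
    rewrite (nbrsC (FA z zF) bz) => /(_ isT).
    rewrite !in_setU1 => /or4P[/eqP za|->|/eqP zsx|->]; rewrite ?orbT //.
      by move: (out1_notin AF); rewrite -za zF.
    by move: sxK; rewrite -zsx zK xK.
  rewrite cK leqNgt => /negP[]; apply: leq_trans FN.
  by rewrite cardsU1 addn2 ltnS; case: (_ \notin _); rewrite ?add0n ?add1n.
(* All facets at [x] through the edge to [b] contain [a]. *)
have [|E|E] := @mem_edge A x b a cA bx (FA x xF) aA'.
- move=> w wx wb; have /nbrsP[wA _ _] := wx.
  have wF : w \in F.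
    apply: contraT; rewrite (notin_facet AF wA) (negbTE wb) orbF => /eqP wa.
    by rewrite -wa wx in ax.
  have : w \in nbrs A x :&: F by rewrite inE wx wF.
  rewrite (prism_nbrs cA fF rF pK cK xK sx) => /setU1P[->|/setD1P[wx' wK]].
    by exists G; split=> //; exact: KG.
  by have [G' [fG' xG' aG' wG']] := cols w wK wx'; exists G'.
- by have := out1_notin AF; rewrite E xF.
- by rewrite E eqxx in ab.
Qed.

(** The facet [F] has [2 e] vertices, which leaves two vertices [a] and [b]. By
[prism_facet_short] all the facets through the sides of [F] may be assumed to
contain both, so they are the sides of a prism in which [a] and [b] span an
additional edge. The second facet through [K] contains exactly one of [a] and
[b], and is one base of this prism. *)
Lemma prism_facet_extend : prismlike e F -> prismlike e.+1 A.
Proof.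
move=> [K [s [cK pK]]].
have e2 : (2 <= e)%N by apply: leq_trans FN; rewrite leq_addl.
have [a [b [ab AF]]] : exists a b, a != b /\ A :\: F = [set a; b].
  have : #|A :\: F| = 2%N.
    have := facet_card cA rA npA fF rF; have := cardF pK cK => cF.
    rewrite cardsDS ?(face_sub fF) // cF; move: Ae; clear; lia.
  by move/eqP/cards2P => [a [b [ab E]]]; exists a, b.
have [KF sP fK fc] := pK; have FA := subsetP (face_sub fF).
have [[x [Y [xF [fY rY EY] bY]]]|both] := pselect (exists x Y, [/\ x \in F,
   [/\ is_face A Y, rk Y = e.+1 & Y :&: F = F :\: [set x; s x]] & a \notin Y \/ b \notin Y]).
  case: bY => [aY|bY].
    apply: (prism_facet_short (a := b) (b := a) _ _ pK cK xF fY rY EY aY).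
      by rewrite AF setUC.
    by rewrite eq_sym.
  exact: (prism_facet_short AF ab pK cK xF fY rY EY bY).
have colface x : x \in F -> is_face A (A :\: [set x; s x]) /\
   exists G, [/\ is_face A G, rk G = e.+1, G :&: F = F :\: [set x; s x], a \in G & b \in G].
  move=> xF; have [G [fG rG EG]] := col_facet AF pK cK xF.
  have aG : a \in G by apply: contrapT => /negP aG; apply: both; exists x, G; split=> //; left.
  have bG : b \in G by apply: contrapT => /negP bG; apply: both; exists x, G; split=> //; right.
  split; last by exists G.
  suff -> : A :\: [set x; s x] = G by [].
  have [sxF _ _] := sP x xF.
  apply/setP => z; rewrite in_setD; have [zF|zF] := boolP (z \in F).
    have /setP/(_ z) := EG; rewrite in_setI in_setD zF !andbT => ->.
    by rewrite (FA z zF) andbT.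
  have [zA|zA] := boolP (z \in A); last first.
    by rewrite andbF; apply/esym/negbTE; apply: contra zA => /(subsetP (face_sub fG)).
  rewrite andbT; move: (zF); rewrite (notin_facet AF zA) => zab.
  have -> : z \in G by case/orP: zab => /eqP->.
  by rewrite !inE negb_or; apply/andP; split; apply: contraNneq zF => ->.
have [|x xK sx] := @simple_exists A F e fF FN K KF; first by rewrite cK.
have xF := subsetP KF x xK.
have [t Et] := one_outside cA rA sx fF xF rF.
have /setDP[tx tF] : t \in nbrs A x :\: F by rewrite Et inE.
have tA := subsetP (nbrs_sub A x) t tx.
wlog Eta : a b ab AF both colface / t = a.
  move=> H; move: (tF); rewrite (notin_facet AF tA) => /orP[]/eqP E; first exact: (H a b).
  apply: (H b a) => //; first by rewrite eq_sym.
  - by rewrite AF setUC.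
  - by move=> [x' [Y [xF' HY HH]]]; apply: both; exists x', Y; split=> //; tauto.
  - move=> x' /colface[fx [G [fG rG EG aG bG]]]; split=> //; by exists G.
subst t; have [G [fG rG EG sxG]] := row_facet cA rA fF rF pK cK xK sx.
have KG z : z \in K -> z \in G by move=> zK; have := zK; rewrite -{1}EG inE => /andP[].
have sxx : s x \in nbrs A x.
  by have := prism_nbr_col pK xF; rewrite (nbrs_face fF xF) inE => /andP[].
have aG : a \in G.
  apply: (nbr_in cA rA sx fG (KG x xK) rG sxx sxG tx).
  by apply: contraNneq tF => ->; have [] := sP x xF.
have bA' := out2_in AF.
(* If it were, [b] would lie on the edge from [x] to [a]. *)
have bG : b \notin G.
  apply/negP => bG; have [|E|E] := @mem_edge A x a b cA tx (FA x xF) bA'.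
  - move=> w wx wa; have wF : w \in F by exact: (nbr_in cA rA sx fF xF rF tx tF wx wa).
    have : w \in nbrs A x :&: F by rewrite inE wx wF.
    rewrite (prism_nbrs cA fF rF pK cK xK sx) => /setU1P[->|/setD1P[wx' wK]].
      by exists G; split=> //; exact: KG.
    have [_ [G' [fG' rG' EG' aG' bG']]] := colface w wF.
    have [_ _ swK] := sP w wF.
    have xwsw : x \notin [set w; s w].
      rewrite !inE negb_or eq_sym wx' /=; apply/eqP => E.
      by move: swK; rewrite -E xK wK.
    exists G'; split=> //.
      have : x \in G' :&: F by rewrite EG' in_setD xwsw xF.
      by rewrite inE => /andP[].
    by apply/negP => wG'; have /setP/(_ w) := EG'; rewrite !inE wG' wF eqxx.
  - by have := out2_notin AF; rewrite E xF.
  - by rewrite E eqxx in ab.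
have EGK : G = a |: K.
  apply/setP => z; rewrite in_setU1 -EG in_setI; have [->//|za] := eqVneq z a.
  have [zG|//] := boolP (z \in G) => /=; apply/esym; apply: contraT => zF.
  move: (zF); rewrite (notin_facet AF (subsetP (face_sub fG) z zG)) (negbTE za) /= => /eqP Ez.
  by rewrite -Ez zG in bG.
have aF' := out1_notin AF; have bF' := out2_notin AF; have aA' := out1_in AF.
have aK : a \notin K by apply: contra aF' => /(subsetP KF).
have bK : b \notin K by apply: contra bF' => /(subsetP KF).
exists G, (fun z => if z == a then b else if z == b then a else s z).
have za z : z \in F -> z == a = false by move=> zF; apply: contraNF aF' => /eqP <-.
have zb z : z \in F -> z == b = false by move=> zF; apply: contraNF bF' => /eqP <-.
have ba : b == a = false by rewrite eq_sym (negbTE ab).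
have Aab : A :\: [set a; b] = F by rewrite -AF setDDr setDv set0U (setIidPr (face_sub fF)).
split; first by rewrite EGK cardsU1 aK cK.
split=> //; first exact: face_sub fG.
- move=> z zA; have [zF|] := boolP (z \in F).
    have [szF ssz szK] := sP z zF; rewrite za // zb // za // zb //; split=> //.
      exact: FA.
    by rewrite EGK !in_setU1 !za.
  rewrite (notin_facet AF zA) => /orP[]/eqP->; rewrite ?eqxx ?ba ?eqxx ?EGK ?in_setU1 ?ba ?eqxx ?bK ?aK.
    by split=> //=; exact: negbTE.
  by split.
- move=> z zA; have [zF|] := boolP (z \in F).
    by rewrite za // zb //; have [] := colface z zF.
  rewrite (notin_facet AF zA) => /orP[]/eqP->; rewrite ?eqxx ?ba ?eqxx.
    by rewrite Aab.
  by rewrite setUC Aab.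
Qed.

End PrismFacetExtension.

(** * The combinatorial dichotomy *)

(** Assume that [A] is no pyramid. At a simple vertex [v] choose a facet [F] that
omits some nonsimple vertex, if there is one. If [F] is not a simplex, then
[prism_facet_exists] and [prism_facet_extend] apply. If it is a simplex with
simple vertices only, [simplex_all_simple] applies. In the remaining case [F] is
a simplex with a nonsimple vertex [j], and the facet [G] at [v] opposite to [j]
may be assumed to be a simplex as well; then a neighbour of [v] that is not
adjacent to a second simple vertex [u] of [F] can only be the vertex omitted
by [F], and can only be [j], which lies in [F]. *)
Theorem pyr_or_prismlike (one : 'cV[R]_N) d A : (forall x, ev one x = 1) ->
  convex_position A -> rk A = d.+1 -> (2 <= d)%N -> (#|A| <= 2 * d)%N ->
  (#|nonsimple A| + 2 <= d)%N -> pyr A \/ prismlike d A.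
Proof.
move=> one1; elim: d A => [//|e IHe] A cA rA e1 Ae NA.
have [|npA] := pselect (pyr A); [by left|right].
have NA' : (#|nonsimple A| + 1 <= e)%N by rewrite -ltnS -addnS.
have IH F : is_face A F -> rk F = e.+1 -> (#|F| <= 2 * e)%N ->
    (#|nonsimple F| + 2 <= e)%N -> pyr F \/ prismlike e F.
  move=> fF rF cF NF; apply: IHe => //; first exact: convpos_face cA fF.
  by apply: leq_trans NF; rewrite leq_addl.
have big v F : simple A v -> is_face A F -> v \in F -> rk F = e.+1 ->
    (e.+1 < #|F|)%N -> (#|nonsimple A :&: F| + 2 <= e)%N -> prismlike e.+1 A.
  move=> sv fF vF rF cF NF.
  have [F' [fF' rF' NF' pF']] := prism_facet_exists one1 cA rA Ae NA' npA IH sv fF vF rF cF NF.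
  exact: (prism_facet_extend cA rA Ae npA fF' rF' NF' pF').
have rkA := rk_card A; rewrite rA in rkA.
have simA x : x \in A -> x \notin nonsimple A -> simple A x.
  by move=> xA; rewrite inE xA /= negbK.
have [v vA vN] : exists2 v, v \in A & v \notin nonsimple A.
  have : (0 < #|A :\: nonsimple A|)%N.
    rewrite cardsD subn_gt0; apply: leq_ltn_trans (subset_leq_card (subsetIr _ _)) _.
    by apply: leq_trans rkA; rewrite ltnS; apply: leq_trans (leq_addr 1 _) (leqW NA').
  by case/card_gt0P => v /setDP[]; exists v.
have sv := simA v vA vN.
(* Omitting one nonsimple vertex is enough for the induction hypothesis. *)
have drop_one z F : z \in nonsimple A -> z \notin F -> (#|nonsimple A :&: F| + 2 <= e)%N.
  move=> zN zF; apply: leq_trans NA'; rewrite (cardsD1 z (nonsimple A)) zN addn2 addn1 add1n ltnS.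
  rewrite ltnS subset_leq_card //; apply/subsetP => w /setIP[wN wF].
  by rewrite in_setD1 wN andbT; apply: contraNneq zF => <-.
have [i [iv [F [fF vF nF rF]] NF]] : exists i, [/\ i \in nbrs A v,
    exists F, [/\ is_face A F, v \in F, nbrs A v :&: F = nbrs A v :\ i & rk F = e.+1 /\
   ((2 <= e)%N -> (#|nonsimple A :&: F| + 2 <= e)%N)] & True].
  have [N0|[z zN]] := set_0Vmem (nonsimple A).
    have : (0 < #|nbrs A v|)%N.
      by have := rk_nbrs cA vA; rewrite rA ltnS; apply: leq_trans.
    case/card_gt0P => i iv; exists i; split=> //.
    have [F [fF vF nF rF]] := facet_omit cA rA sv iv.
    by exists F; split=> //; split=> // e2; rewrite N0 set0I cards0.
  have zA : z \in A by move: zN; rewrite inE => /andP[].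
  have zv : z != v by apply: contraNneq vN => <-.
  (* A neighbour [i] of [v] on the smallest face through [v] and [z] will do. *)
  have SA : [set v; z] \subset A.
    exact: set2_sub.
  have /subsetP SH := sub_hull SA; have fH := hull_face A [set v; z].
  have vH : v \in hull A [set v; z] by apply: SH; rewrite !inE eqxx.
  have [E0|[i /setIP[iv iH]]] := set_0Vmem (nbrs A v :&: hull A [set v; z]).
    have := face_le cA fH (cA v vA) vH (set11 v); rewrite E0 sub0set => /(_ isT)/subsetP/(_ z).
    by rewrite SH ?inE ?eqxx ?orbT // (negbTE zv) => /(_ isT).
  exists i; split=> //; have [F [fF vF nF rF]] := facet_omit cA rA sv iv.
  exists F; split=> //; split=> // _; apply: (drop_one z) => //.
  apply/negP => zF; have : i \in F.
    apply: (subsetP (hull_min fF _)) iH.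
    exact: set2_sub.
  by have := setD11 i (nbrs A v); rewrite -nF in_setI iv /= => ->.
case: rF => rF {}NF.
have [cF|cF] := ltnP e.+1 #|F|.
  apply: (big v F) => //; apply: NF; rewrite ltnNge; apply/negP => e1'.
  have Ee : e = 1%N by apply/eqP; rewrite eqn_leq e1' -ltnS.
  rewrite Ee in rF cF; have [u _ EF] := rk2_face cA fF vF rF.
  by move: cF; rewrite EF cards2; case: (_ != _).
have cF' : #|F| = e.+1 by apply/eqP; rewrite eqn_leq cF -rF rk_card.
have [FN|[j /setIP[jF jN]]] := set_0Vmem (F :&: nonsimple A).
  apply: (@simplex_all_simple A e.+1 F cA rA) => //.
  move=> x xF; apply: simA; first exact: (subsetP (face_sub fF)).
  by apply/negP => xN; have := in_set0 x; rewrite -FN inE xF xN.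
have e2 : (2 <= e)%N by apply: leq_trans NA'; rewrite (cardsD1 j) jN add1n addn1.
have jv : j != v by apply: contraNneq vN => <-.
have rcF : rk F = #|F| by rewrite rF cF'.
have jnv : j \in nbrs A v := simplex_nbr fF rcF vF jF jv.
have [G [fG vG nG rG]] := facet_omit cA rA sv jnv.
have jG : j \notin G by have := setD11 j (nbrs A v); rewrite -nG in_setI jnv /= => ->.
have [cG|cG] := ltnP e.+1 #|G|; first by apply: (big v G) => //; apply: (drop_one j).
have cG' : #|G| = rk G by apply/eqP; rewrite eqn_leq {1}rG cG rk_card.
exfalso.
have [u uF [uv uN]] : exists2 u, u \in F & u != v /\ u \notin nonsimple A.
  have : (0 < #|(F :\ v) :\: nonsimple A|)%N.
    rewrite cardsD subn_gt0; apply: leq_ltn_trans (subset_leq_card (subsetIr _ _)) _.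
    have := cF'; rewrite (cardsD1 v F) vF add1n => -[->].
    by rewrite -addn1.
  by case/card_gt0P => u /setDP[/setD1P[uv uF] uN]; exists u.
have su : simple A u by apply: simA => //; exact: (subsetP (face_sub fF)).
have unv : u \in nbrs A v := simplex_nbr fF rcF vF uF uv.
have [m [mv mu mNu]] := nonnbr_exists cA sv su unv npA.
have iF : i \notin F by have := setD11 i (nbrs A v); rewrite -nF in_setI iv /= => ->.
have mi : m = i.
  apply/eqP; apply: contraNT mNu => mi.
  have : m \in nbrs A v :\ i by rewrite in_setD1 mi.
  by rewrite -nF => /setIP[_ mF]; exact: simplex_nbr fF rcF uF mF mu.
have mj : m = j.
  apply/eqP; apply: contraNT mNu => mj.
  have : m \in nbrs A v :\ j by rewrite in_setD1 mj.
  rewrite -nG => /setIP[_ mG]; apply: (simplex_nbr fG (esym cG')) => //.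
  have : u \in nbrs A v :\ j by rewrite in_setD1 unv andbT; apply: contraNneq uN => ->.
  by rewrite -nG => /setIP[].
by rewrite -mi mj jF in iF.
Qed.

(** * The face lattice of a prism *)

(** This determines the face lattice of anything with the combinatorics of a
prism. The functionals of the sides, together with that of [K], span all
functionals; positivity of the coefficients of one that vanishes at [u] in [K]
and at [w] in the other base, with [w] different from [s u], forces it to
vanish at [s u] and [s w]. *)
Lemma prism_faces A K s B : prism_data A K s -> rk A = #|K|.+1 ->
  is_face A B <->
  B \subset A /\ [\/ B \subset K, B \subset A :\: K | forall x, x \in B -> s x \in B].
Proof.
move=> pA rA; have [f [g [fE gE]]] := prism_functionals pA; have [KA sP fK fP] := pA.
have rK := prism_rk_base pA.
split=> [fB|[BA []] H].
- have BA := face_sub fB; split=> //; case: fB => c c0 EB.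
  have cB x : x \in A -> (x \in B) = (ev c x == 0) by move=> xA; rewrite EB inE xA.
  have [|/subsetPn[y yB yK]] := boolP (B \subset K); first by constructor 1.
  have [|/subsetPn[x xB]] := boolP (B \subset A :\: K); first by constructor 2.
  rewrite inE (subsetP BA) // andbT negbK => xK; constructor 3.
  have cross u w : u \in B -> u \in K -> w \in B -> w \notin K -> w != s u ->
      s u \in B /\ s w \in B.
    move=> uB uK wB wK wsu.
    have uA := subsetP BA _ uB; have wA := subsetP BA _ wB.
    have [suA ssu suK] := sP u uA; have [swA ssw swK] := sP w wA.
    rewrite uK /= in suK; rewrite wK in swK.
    have gsu : 0 < ev g (s u) by have := gE _ suA; rewrite suK.
    have gw : 0 < ev g w by have := gE _ wA; rewrite (negbTE wK).
    pose h0 := \sum_(z in K) (ev c z / ev (f z) z) *: f z.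
    pose k := ev (c - h0) (s u) / ev g (s u).
    have fzz z : z \in K -> 0 < ev (f z) z.
      by move=> zK; have zA := subsetP KA _ zK; have := fE z z zA zA; rewrite eqxx.
    have fz0 z y' : z \in K -> y' \in A -> y' != z -> y' != s z -> ev (f z) y' = 0.
      move=> zK yA' h1 h2; have := fE z y' (subsetP KA _ zK) yA'.
      by rewrite (negbTE h1) (negbTE h2).
    have h0K z : z \in K -> ev h0 z = ev c z.
      move=> zK; rewrite /h0 ev_sum (bigD1 z) //= evZ divfK ?gt_eqF ?fzz //.
      rewrite big1 ?addr0 // => z' /andP[zK' zz']; rewrite evZ (fz0 z' z) ?mulr0 //.
      - exact: (subsetP KA).
      - by rewrite eq_sym.
      - apply/eqP => E; have [_ _] := sP z' (subsetP KA _ zK').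
        by rewrite -E zK zK'.
    have h0N z : z \in A -> z \notin K -> ev h0 z = ev c (s z) / ev (f (s z)) (s z) * ev (f (s z)) z.
      move=> zA zK; have [szA ssz szK] := sP z zA; rewrite zK in szK.
      rewrite /h0 ev_sum (bigD1 (s z)) ?szK //= evZ big1 ?addr0 // => z' /andP[zK' zz'].
      rewrite evZ (fz0 z' z) ?mulr0 //; first by apply: contraNneq zK => ->.
      by apply: contraNneq zz' => ->; have [_ ->] := sP z' (subsetP KA _ zK').
    have zero : forall z, z \in A -> ev (c - h0 - k *: g) z = 0.
      apply: (rk_eq_ev0 (B := s u |: K)).
      - by rewrite subUset sub1set suA.
      - rewrite rA -rK; apply: (rk_insert (c := g)); last by rewrite gt_eqF.
        by move=> z zK; have := gE z (subsetP KA _ zK); rewrite zK.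
      - move=> z /setU1P[->|zK]; rewrite evB evZ.
          by rewrite /k divfK ?subrr // gt_eqF.
        have := gE z (subsetP KA _ zK); rewrite zK => ->.
        by rewrite evB h0K // subrr mulr0 subrr.
    have cu : ev c u = 0 by apply/eqP; rewrite -cB.
    have cw : ev c w = 0 by apply/eqP; rewrite -cB.
    have csu : ev c (s u) = k * ev g (s u).
      have := zero _ suA; rewrite !evB evZ h0N ?suK // ssu cu mul0r mul0r subr0 => /eqP.
      by rewrite subr_eq0 => /eqP.
    have k0 : 0 <= k by rewrite -(pmulr_lge0 _ gsu) -csu c0.
    have := zero _ wA; rewrite !evB evZ h0N // cw sub0r => /eqP.
    rewrite -opprD oppr_eq0.
    have t1 : 0 <= ev c (s w) / ev (f (s w)) (s w) * ev (f (s w)) w.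
      have fsw : 0 < ev (f (s w)) w.
        by have := fE _ _ swA wA; rewrite ssw eqxx orbT.
      by apply: mulr_ge0; [apply: divr_ge0; [exact: c0|exact/ltW/fzz]|exact: ltW].
    rewrite paddr_eq0 //; last by rewrite mulr_ge0 // ltW.
    move=> /andP[z1 z2]; rewrite !cB //; split.
      by move: z2; rewrite csu mulf_eq0 (gt_eqF gw) orbF => /eqP->; rewrite mul0r.
    move: z1; rewrite mulf_eq0 mulf_eq0 invr_eq0 (gt_eqF (fzz _ swK)) orbF => /orP[//|].
    have := fE _ _ swA wA; rewrite ssw eqxx orbT => /gt_eqF->.
    by [].
  move=> z zB; have zA := subsetP BA _ zB.
  have [zK|zK] := boolP (z \in K).
    have [Ey|ysz] := eqVneq y (s z); first by rewrite -Ey.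
    by have [] := cross z y zB zK yB yK ysz.
  have [Ez|zsx] := eqVneq z (s x).
    by rewrite Ez; have [_ -> _] := sP x (subsetP BA _ xB).
  by have [] := cross x z xB xK zB zK zsx.
- by apply: face_trans fK _; exact: simplex_face rK H.
- have pA' := prism_sym pA; have [_ _ fK' _] := pA'.
  exact: face_trans fK' (simplex_face (prism_rk_base pA') H).
- exact: prism_closed_face pA BA H.
Qed.

(** * Facets as maximal faces *)

(** The functional [f] of [B] can be tilted around [B], keeping it positive at
[x0], until it meets another vertex. *)
Lemma bigger_face A B : is_face A B -> ((rk B).+1 < rk A)%N ->
  exists C, [/\ is_face A C, B \subset C, C != B & C != A].
Proof.
move=> fB rB; have BA := face_sub fB; case: (fB) => f f0 EB.
have fpos x : x \in A -> x \notin B -> 0 < ev f x.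
  by move=> xA xB; rewrite lt_def f0 // andbT; apply: contra xB; rewrite EB inE xA.
have [x0 x0A x0B] : exists2 x, x \in A & x \notin B.
  apply/subsetPn; apply: contraTN rB => AB.
  by rewrite -leqNgt; apply/leqW/rkS.
have [|h [h0 [y yA hy]]] := @rk_ltn_sep A (x0 |: B).
  apply: leq_ltn_trans rB; apply: leq_trans (rkU _ _) _; rewrite -add1n leq_add2r.
  by apply: leq_trans (rk_card _) _; rewrite cards1.
wlog hpos : h h0 hy / 0 < ev h y.
  move=> H; have [|] := ltP 0 (ev h y); first exact: H h0 hy.
  move=> hy'; apply: (H (- h)); rewrite ?evN ?oppr_eq0 //.
    by move=> z /h0 hz; rewrite evN hz oppr0.
  by rewrite oppr_gt0 lt_def hy' eq_sym hy.
have yB : y \notin B.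
  by apply: contraTN hpos => yB; rewrite h0 ?ltxx // !inE yB orbT.
pose r z := ev h z / ev f z.
have yAB : y \in A :\: B by rewrite inE yB.
have [w wAB wmax] := @arg_maxP _ _ _ y (mem (A :\: B)) r yAB.
have /setDP[wA wB] : w \in A :\: B := wAB.
have r0 : 0 < r w by apply: lt_le_trans (wmax y yAB); rewrite divr_gt0 ?fpos.
have hB z : z \in B -> ev h z = 0 by move=> zB; apply: h0; rewrite !inE zB orbT.
have fBz z : z \in B -> ev f z = 0 by rewrite EB inE => /andP[_ /eqP].
exists [set z in A | ev (r w *: f - h) z == 0]; split.
- exists (r w *: f - h) => // z zA; rewrite evB evZ subr_ge0.
  have [zB|zB] := boolP (z \in B); first by rewrite hB // fBz // mulr0.
  by rewrite -ler_pdivrMr ?fpos //; apply: (wmax z); apply/setDP.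
- apply/subsetP => z zB; rewrite inE (subsetP BA) //= evB evZ.
  by rewrite hB // fBz // mulr0 subr0.
- apply/eqP => E; have := wB; rewrite -{1}E inE wA evB evZ /r divfK ?subrr ?eqxx //.
  by rewrite gt_eqF // fpos.
- apply/eqP => /setP/(_ x0); rewrite inE x0A /= evB evZ.
  rewrite (h0 x0) ?inE ?eqxx // subr0 mulf_eq0 !gt_eqF //; exact: fpos.
Qed.

Lemma rk_proper_face A B : is_face A B -> B != A -> (rk B < rk A)%N.
Proof.
move=> fB BA; rewrite ltn_neqAle rkS ?(face_sub fB) // andbT; apply: contra BA => /eqP rB.
rewrite eqEsubset (face_sub fB) /=; case: (fB) => f f0 EB.
have fz x : x \in A -> ev f x = 0.
  by apply: (rk_eq_ev0 (face_sub fB) rB) => y; rewrite EB inE => /andP[_ /eqP].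
by apply/subsetP => x xA; rewrite EB inE xA fz ?eqxx.
Qed.

Lemma facet_maximal A B C : is_face A B -> (rk B).+1 = rk A -> is_face A C ->
  B \subset C -> C = B \/ C = A.
Proof.
move=> fB rB fC BC; have [->|CA] := eqVneq C A; [by right|left].
have rC : rk B = rk C.
  apply/eqP; rewrite eqn_leq rkS //=; have := rk_proper_face fC CA; rewrite -rB ltnS.
  by [].
apply/eqP; rewrite eqEsubset BC andbT; case: (fB) => f f0 EB.
have fz x : x \in C -> ev f x = 0.
  by apply: (rk_eq_ev0 BC rC) => y; rewrite EB inE => /andP[_ /eqP].
apply/subsetP => x xC.
by rewrite EB inE (subsetP (face_sub fC)) // fz ?eqxx.
Qed.

End Configurations.

Local Open Scope classical_set_scope.
Local Open Scope ring_scope.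

(** * Convex hulls of finite sets of points *)

Lemma convex_setE (R : realType) n (C : set 'rV[R]_n) : convex_set C <->
  forall x y (t : R), 0 <= t -> t <= 1 -> C x -> C y -> C (t *: x + (1 - t) *: y).
Proof.
split=> [cC x y t t0 t1 Cx Cy|H x y l].
  by have /(_ (Itv01 t0 t1)) := cC x y _ (mem_set Cx) (mem_set Cy) => /set_mem.
by move=> /set_mem Cx /set_mem Cy; apply/mem_set/H.
Qed.

Lemma conv_convex (R : realType) n (S : set 'rV[R]_n) : convex_set (Defs.conv S).
Proof.
move=> x y t /set_mem Px /set_mem Py; apply/mem_set => C [cC SC].
by apply/set_mem/cC; apply/mem_set; [apply: (Px C)|apply: (Py C)].
Qed.

(** Induction on the number of generators: if the functional [c] found for [s]
fails at [a] only, project along [a] to the kernel of [c]. Coefficients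
obtained after the projection lift with a nonnegative coefficient of [a],
because [c] is negative on both [a] and [b]. *)
Lemma farkas (R : realFieldType) N (s : seq 'rV[R]_N) (b : 'rV[R]_N) :
  (exists2 l : nat -> R, forall i, 0 <= l i & b = \sum_(i < size s) l i *: s`_i) \/
  (exists2 c : 'cV[R]_N, forall a, a \in s -> 0 <= (a *m c) 0 0 & (b *m c) 0 0 < 0).
Proof.
have [m] := ubnP (size s); elim: m s b => // m IH [|a s] b.
  move=> _; have [->|b0] := eqVneq b 0.
    by left; exists (fun=> 0); rewrite ?big_ord0.
  right; exists (- b^T) => //; rewrite mulmxN mxE oppr_lt0.
  rewrite mxE lt_def sumr_ge0 => [|i _]; last by rewrite mxE -expr2 sqr_ge0.
  rewrite andbT; apply: contra b0; rewrite psumr_eq0 => [/allP h|i _]; last first.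
    by rewrite mxE -expr2 sqr_ge0.
  apply/eqP/rowP => i; rewrite [RHS]mxE; have := h i (mem_index_enum i).
  by rewrite mxE mulf_eq0 orbb => /eqP.
rewrite /= ltnS => sm; have [[l l0 ->]|[c cs cb]] := IH s b sm.
  left; exists (fun i => if i is j.+1 then l j else 0) => [[]//|].
  by rewrite big_ord_recl /= scale0r add0r.
have [ca|ca] := leP 0 ((a *m c) 0 0).
  by right; exists c => // x; rewrite inE => /predU1P[->|/cs].
pose k (x : 'rV[R]_N) := (x *m c) 0 0 / (a *m c) 0 0.
pose pr (x : 'rV[R]_N) := x - k x *: a.
have prE (c' : 'cV[R]_N) x : (pr x *m c') 0 0 = (x *m c') 0 0 - k x * (a *m c') 0 0.
  by rewrite /pr mulmxBl -scalemxAl !mxE.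
have [|[l l0 Eb]|[c' c's c'b]] := IH (map pr s) (pr b); first by rewrite size_map.
  left; pose t := k b - \sum_(i < size s) l i * k s`_i.
  exists (fun i => if i is j.+1 then l j else t) => [[|i]//|].
    rewrite /t subr_ge0; have -> : \sum_(i < size s) l i * k s`_i =
        (\sum_(i < size s) l i * (s`_i *m c) 0 0) / (a *m c) 0 0.
      by rewrite mulr_suml; apply: eq_bigr => i _; rewrite mulrA.
    rewrite ler_nM2r ?invr_lt0 // (le_trans (ltW cb)) // sumr_ge0 // => i _.
    by rewrite mulr_ge0 // cs // mem_nth.
  have : pr b = \sum_(i < size s) (l i *: s`_i - (l i * k s`_i) *: a).
    rewrite Eb size_map; apply: eq_bigr => i _.
    by rewrite (nth_map (0 : 'rV[R]_N)) // /pr scalerBr scalerA.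
  rewrite big_ord_recl /= sumrB -scaler_suml => /eqP; rewrite subr_eq => /eqP ->.
  by rewrite -[X in _ = _ + X]/(\sum_(i < size s) l i *: s`_i) /t scalerBl [RHS]addrC addrA addrAC.
(* The functional that vanishes at [a] and agrees with [c'] after projection. *)
pose c2 := c' - ((a *m c') 0 0 / (a *m c) 0 0) *: c.
have E y : (y *m c2) 0 0 = (pr y *m c') 0 0.
  rewrite prE mulmxBr -scalemxAr mxE [X in _ + X]mxE [X in _ - X]mxE /k.
  by congr (_ - _); rewrite mulrAC [X in X / _]mulrC mulrAC.
right; exists c2 => [x|]; last by rewrite E.
  rewrite inE => /predU1P[->|xs]; rewrite E.
    by rewrite prE /k divff ?lt_eqF // mul1r subrr.
  by apply: c's; exact: map_f.
Qed.

Section Geometry.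
Variables (R : realType) (n : nat) (T : finType) (q : T -> 'rV[R]_n).
Implicit Types (A B C : {set T}) (x y : 'rV[R]_n) (i j : T).

(** Homogenization: affine functions on the points become linear functionals on
these vectors, and affine hulls become linear spans. *)
Definition hom x : 'rV[R]_(n + 1) := row_mx x 1%:M.
Definition hp i := hom (q i).
Definition one : 'cV[R]_(n + 1) := col_mx 0 1%:M.
Definition at_ (c : 'cV[R]_(n + 1)) x : R := (hom x *m c) 0 0.
Definition poly B : set 'rV[R]_n := Defs.conv (q @` [set i | i \in B]).

Lemma ev_hp c i : ev hp c i = at_ c (q i). Proof. by []. Qed.

Lemma at_one x : at_ one x = 1.
Proof. by rewrite /at_ /hom /one mul_row_col mulmx0 add0r mul1mx !mxE ?eqxx. Qed.

Lemma ev_one i : ev hp one i = 1. Proof. exact: at_one. Qed.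

Lemma at_col c1 (b : R) x : at_ (col_mx c1 b%:M) x = (x *m c1) 0 0 + b.
Proof. by rewrite /at_ /hom mul_row_col mul1mx mxE [X in _ + X]mxE ?eqxx. Qed.

Lemma at_split c x : at_ c x = (x *m usubmx c) 0 0 + dsubmx c 0 0.
Proof.
rewrite -at_col; congr (at_ _ _); rewrite -[LHS]vsubmxK; congr col_mx.
by rewrite -mx11_scalar.
Qed.

Lemma at_comb c (l : T -> R) : \sum_i l i = 1 ->
  at_ c (\sum_i l i *: q i) = \sum_i l i * at_ c (q i).
Proof.
move=> l1; rewrite at_split mulmx_suml summxE.
under [in RHS]eq_bigr => i _ do rewrite at_split mulrDr.
rewrite big_split /= -mulr_suml l1 mul1r; congr (_ + _).
by apply: eq_bigr => i _; rewrite -scalemxAl mxE.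
Qed.

Lemma polyP B y : poly B y <-> exists l : T -> R,
  [/\ forall i, 0 <= l i, forall i, i \notin B -> l i = 0, \sum_i l i = 1 &
      y = \sum_i l i *: q i].
Proof.
split=> [|[l [l0 lB l1 ->]] C [/convex_setE cC qC]].
  apply: (smallest_sub (X := [set y | exists l : T -> R,
    [/\ forall i, 0 <= l i, forall i, i \notin B -> l i = 0, \sum_i l i = 1 &
      y = \sum_i l i *: q i]])).
    apply/convex_setE => x z t t0 t1 [l [l0 lB l1 ->]] [k [k0 kB k1 ->]].
    exists (fun i => t * l i + (1 - t) * k i); split.
    - by move=> i; rewrite addr_ge0 // mulr_ge0 // subr_ge0.
    - by move=> i iB; rewrite lB // kB // !mulr0 addr0.
    - by rewrite big_split /= -!mulr_sumr l1 k1 !mulr1 addrC subrK.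
    - rewrite !scaler_sumr -big_split /=; apply: eq_bigr => i _.
      by rewrite [RHS]scalerDl !scalerA.
  move=> _ [i iB <-]; exists (fun j => (j == i)%:R); split.
  - by move=> j; rewrite ler0n.
  - by move=> j; apply: contraNeq; rewrite pnatr_eq0 eqb0 negbK => /eqP->.
  - by rewrite (bigD1 i) //= eqxx big1 ?addr0 // => j /negbTE->.
  - by rewrite (bigD1 i) //= eqxx scale1r big1 ?addr0 // => j /negbTE->; rewrite scale0r.
(* Normalized partial sums of the convex combination lie in [C]. *)
have H (s : seq T) : 0 < \sum_(i <- s) l i ->
    C ((\sum_(i <- s) l i)^-1 *: \sum_(i <- s) l i *: q i).
  elim: s => [|i s IH]; first by rewrite big_nil ltxx.
  rewrite !big_cons => pos; have [li|li] := eqVneq (l i) 0.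
    by rewrite li scale0r !add0r; apply: IH; move: pos; rewrite li add0r.
  have qi : C (q i).
    by apply: qC; exists i => //=; apply: contraNT li => /lB->.
  have [s0|s0] := eqVneq (\sum_(j <- s) l j) 0.
    have E : \sum_(j <- s) l j *: q j = 0.
      move/eqP: s0; rewrite psumr_eq0 // => /allP s0.
      by rewrite big_seq big1 // => j /s0 /eqP ->; rewrite scale0r.
    by rewrite s0 E !addr0 scalerA mulVf // scale1r.
  have spos : 0 < \sum_(j <- s) l j by rewrite lt_def s0 sumr_ge0.
  set S := \sum_(j <- s) l j in s0 spos pos IH *.
  set v := \sum_(j <- s) _ in IH *.
  have -> : (l i + S)^-1 *: (l i *: q i + v) =
     (l i / (l i + S)) *: q i + (1 - l i / (l i + S)) *: (S^-1 *: v).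
    rewrite scalerDr !scalerA [l i * _]mulrC; congr (_ + _ *: _).
    by field; rewrite s0 gt_eqF.
  apply: cC => //; last exact: IH.
    by rewrite divr_ge0 // ltW.
  by rewrite ler_pdivrMr // mul1r lerDl ltW.
by have := H (index_enum T); rewrite l1 ltr01 invr1 scale1r; apply.
Qed.

Lemma poly_vertex B i : i \in B -> poly B (q i).
Proof. by move=> iB; apply: sub_gen_smallest; exists i. Qed.

Lemma poly_sub_convex B (C : set 'rV[R]_n) : convex_set C ->
  (forall i, i \in B -> C (q i)) -> poly B `<=` C.
Proof. by move=> cC qC; apply: smallest_sub => // _ [i iB <-]; exact: qC. Qed.

Lemma poly_convex B : convex_set (poly B).
Proof. exact: conv_convex. Qed.

Lemma polyS B A : B \subset A -> poly B `<=` poly A.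
Proof.
move=> /fintype.subsetP BA; apply: poly_sub_convex; first exact: poly_convex.
move=> i iB; apply: poly_vertex; exact: BA.
Qed.

Lemma poly_at_ge0 c A : (forall i, i \in A -> 0 <= at_ c (q i)) ->
  forall x, poly A x -> 0 <= at_ c x.
Proof.
move=> c0 x /polyP[l [l0 lA l1 ->]]; rewrite at_comb // sumr_ge0 // => i _.
have [iA|/lA->] := boolP (i \in A); last by rewrite mul0r.
by rewrite mulr_ge0 // c0.
Qed.

Lemma poly_zero_set c A B : (forall i, i \in A -> 0 <= at_ c (q i)) ->
  B = [set i in A | at_ c (q i) == 0]%SET ->
  poly B = [set x | poly A x /\ at_ c x = 0].
Proof.
move=> c0 EB; apply/seteqP; split=> x.
  move=> /polyP[l [l0 lB l1 ->]]; split.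
    apply/polyP; exists l; split=> // i iA; apply: lB.
    by rewrite EB inE negb_and iA.
  rewrite at_comb // big1 // => i _; have [|/lB->] := boolP (i \in B); last by rewrite mul0r.
  by rewrite EB inE => /andP[_ /eqP->]; rewrite mulr0.
move=> [/polyP[l [l0 lA l1 ->]] /eqP]; rewrite at_comb // psumr_eq0; last first.
  move=> i _; have [iA|/lA->] := boolP (i \in A); last by rewrite mul0r.
  by rewrite mulr_ge0 // c0.
move=> /allP z; apply/polyP; exists l; split=> // i.
rewrite EB inE negb_and => /orP[/lA//|ci].
by have := z i (mem_index_enum i); rewrite mulf_eq0 (negbTE ci) orbF => /eqP.
Qed.

(** An inequality [x *m c <= b] and the functional [b - x *m c] on homogenized
points carry the same information. *)
Lemma facesP A F : faces (poly A) F <-> exists2 B, is_face hp A B & F = poly B.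
Proof.
split=> [[c [b [cb ->]]]|[B [c c0 EB] ->]].
  pose c' := col_mx (- c) b%:M : 'cV[R]_(n + 1).
  have c'E x : at_ c' x = b - (x *m c) 0 0.
    by rewrite at_col mulmxN mxE addrC.
  have c'0 i : i \in A -> 0 <= at_ c' (q i).
    by move=> /poly_vertex/cb; rewrite c'E subr_ge0.
  exists [set i in A | at_ c' (q i) == 0]%SET; first by exists c'.
  rewrite (poly_zero_set c'0 erefl); apply/seteqP.
  split=> x [Px E]; split=> //; first by rewrite c'E E subrr.
  by move/eqP: E; rewrite c'E subr_eq0 => /eqP.
exists (- usubmx c), (dsubmx c 0 0); rewrite (poly_zero_set c0 EB); split.
  move=> x /(poly_at_ge0 c0); rewrite at_split => h.
  by rewrite mulmxN mxE lerNl -subr_ge0 opprK.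
apply/seteqP; split=> x [Px E]; split=> //.
  by rewrite mulmxN mxE; move/eqP: E; rewrite at_split addrC addr_eq0 => /eqP->.
by rewrite at_split -E mulmxN [X in _ + X]mxE subrr.
Qed.

Lemma poly_mem A B i : convex_position hp A -> i \in A -> B \subset A ->
  poly B (q i) <-> i \in B.
Proof.
move=> cA iA BA; split=> [|/poly_vertex//].
have [c [ci cP]] := exposing cA iA.
move=> /polyP[l [l0 lB l1 Ei]]; apply: contraT => iB.
have: at_ c (q i) = 0 by [].
rewrite Ei at_comb // => /eqP; rewrite psumr_eq0; last first.
  move=> j _; have [jB|/lB->] := boolP (j \in B); last by rewrite mul0r.
  rewrite mulr_ge0 //; have [->|ji] := eqVneq j i; first by rewrite -ev_hp ci.
  by apply/ltW/cP => //; exact: (fintype.subsetP BA).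
move=> /allP z; have : \sum_j l j = 0.
  apply: big1 => j _; have [jB|/lB//] := boolP (j \in B).
  have := z j (mem_index_enum j); rewrite mulf_eq0 => /orP[/eqP//|].
  rewrite gt_eqF // cP //; first exact: (fintype.subsetP BA).
  by apply: contraNneq iB => <-.
by rewrite l1 => /eqP; rewrite oner_eq0.
Qed.

Lemma poly_le A B C : convex_position hp A -> B \subset A -> C \subset A ->
  poly B `<=` poly C <-> B \subset C.
Proof.
move=> cA BA CA; split=> [BC|]; last exact: polyS.
apply/fintype.subsetP => i iB; have iA := fintype.subsetP BA i iB.
by apply/(poly_mem cA iA CA); apply: BC; exact: poly_vertex.
Qed.

Lemma poly_inj A B C : convex_position hp A -> B \subset A -> C \subset A ->
  poly B = poly C -> B = C.
Proof.
move=> cA BA CA E; apply/eqP; rewrite finset.eqEsubset.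
by apply/andP; split; apply/(poly_le cA) => //; rewrite E.
Qed.

Lemma q_inj A : convex_position hp A -> {in A &, injective q}.
Proof.
move=> cA i j iA jA E; have := @poly_mem A [set j]%SET i cA iA.
rewrite finset.sub1set E => /(_ jA)[+ _]; rewrite inE => H; apply/eqP/H.
by apply: poly_vertex; rewrite inE.
Qed.

Lemma poly0 : poly finset.set0 = set0.
Proof.
apply/seteqP; split=> // x /polyP[l [_ l0 l1 _]]; have := l1.
by rewrite big1 => [/eqP|i _]; rewrite ?l0 ?inE // eq_sym oner_eq0.
Qed.

Lemma poly1 i : poly [set i]%SET = [set q i].
Proof.
apply/seteqP; split=> [|x ->]; last by apply: poly_vertex; rewrite inE.
apply: poly_sub_convex => [|j]; last by rewrite inE => /eqP->.
by apply/convex_setE => x y t _ _ -> ->; rewrite -scalerDl addrC subrK scale1r.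
Qed.

Lemma verticesE A : convex_position hp A -> vertices (poly A) = q @` [set i | i \in A].
Proof.
move=> cA; apply/seteqP; split=> [x /facesP[B fB Ex]|_ [i iA <-]].
  have [B0|[i iB]] := set_0Vmem B.
    by have : [set x] x by []; rewrite Ex B0 poly0.
  exists i; first exact: fintype.subsetP (face_sub fB) i iB.
  by have := poly_vertex iB; rewrite -Ex.
by apply/facesP; exists [set i]%SET; rewrite ?poly1 //; exact: cA.
Qed.

End Geometry.

(** * Affine hulls and dimension *)

Section Dimension.
Variables (R : realType) (n : nat) (T : finType) (q : T -> 'rV[R]_n).
Implicit Types (A B C : {set T}) (x y : 'rV[R]_n) (i j : T).
Local Notation hp := (hp q).
Local Notation poly := (poly q).

Lemma hspan_comb B (w : 'rV[R]_(n + 1)) : w \in hspan hp B ->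
  exists2 l : T -> R, forall i, i \notin B -> l i = 0 & w = \sum_i l i *: hp i.
Proof.
rewrite /hspan span_def big_map big_enum => /memv_sumP[vs vsB ->].
have /choice[k kP] i : exists k, i \in B -> vs i = k *: hp i.
  have [iB|] := boolP (i \in B); last by exists 0.
  by have /vlineP[k ->] := vsB i iB; exists k.
exists (fun i => if i \in B then k i else 0) => [i /negbTE->//|].
rewrite [RHS](bigID (mem B)) /= [X in _ + X]big1 ?addr0 => [|i /negbTE->]; last first.
  by rewrite scale0r.
by apply: eq_bigr => i iB; rewrite iB kP.
Qed.

Lemma comb_hspan B (l : T -> R) : (forall i, i \notin B -> l i = 0) ->
  \sum_i l i *: hp i \in hspan hp B.
Proof.
move=> lB; apply: memv_suml => i _; have [iB|/lB->] := boolP (i \in B).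
  by apply/memvZ/mem_hspan.
by rewrite scale0r mem0v.
Qed.

Lemma hom_sum (l : T -> R) : \sum_i l i *: hp i =
  row_mx (\sum_i l i *: q i) (\sum_i l i)%:M.
Proof.
have E i : l i *: hp i = row_mx (l i *: q i) (l i)%:M.
  by rewrite /hp /hom scale_row_mx scale_scalar_mx mulr1.
under eq_bigr => i _ do rewrite E.
apply/rowP => j; rewrite summxE; case: (split_ordP j) => k ->.
  rewrite row_mxEl summxE; apply: eq_bigr => i _; rewrite row_mxEl //.
rewrite (ord1 k) row_mxEr mxE eqxx mulr1n; apply: eq_bigr => i _.
by rewrite row_mxEr mxE eqxx mulr1n.
Qed.

(** The vectors spanned by the homogenized points correspond to the affine
combinations of the points. In the converse direction, [D] collects the
directions in an affine set at a base point and is a linear subspace, which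
uses that [2] is invertible. *)
Lemma affP B y : B != finset.set0 -> aff (poly B) y <-> hom y \in hspan hp B.
Proof.
move=> /finset.set0Pn[i0 i0B]; split=> [|/hspan_comb[l lB]].
  apply: (smallest_sub (X := [set y | hom y \in hspan hp B])).
    move=> x z t /= xB zB.
    have -> : hom ((1 - t) *: x + t *: z) = (1 - t) *: hom x + t *: hom z.
      rewrite /hom !scale_row_mx !scale_scalar_mx add_row_mx; congr row_mx.
      by rewrite -raddfD /= !mulr1 subrK.
    by rewrite memvD // memvZ.
  move=> x /polyP[l [_ lB l1 ->]] /=.
  by have := comb_hspan lB; rewrite hom_sum l1.
rewrite hom_sum => /eq_row_mx[-> /matrixP/(_ 0 0)].
rewrite !mxE eqxx !mulr1n => l1 C [/= aC PC].
have qC i : i \in B -> C (q i) by move=> iB; apply: PC; exact: poly_vertex.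
have C0 : C (q i0) by exact: qC.
pose D w := C (q i0 + w).
have DZ k w : D w -> D (k *: w).
  move=> Dw; have := aC _ _ k C0 Dw; rewrite /D; congr C.
  by rewrite scalerDr addrA -scalerDl subrK scale1r.
have DD v w : D v -> D w -> D (v + w).
  move=> Dv Dw; have := aC _ _ (1/2) (DZ 2 _ Dv) (DZ 2 _ Dw); rewrite /D; congr C.
  have h : (1 - 1 / 2 : R) = 1/2 by lra.
  rewrite h !scalerDr addrACA -scalerDl !scalerA.
  have -> : (1 / 2 + 1 / 2 : R) = 1 by lra.
  have -> : (1 / 2 * 2 : R) = 1 by lra.
  by rewrite !scale1r.
have D0 : D 0 by rewrite /D addr0.
have -> : \sum_i l i *: q i = q i0 + \sum_i l i *: (q i - q i0).
  under [in RHS]eq_bigr => i _ do rewrite scalerBr.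
  by rewrite sumrB -scaler_suml -l1 scale1r addrC subrK.
rewrite -/(D _); elim/big_ind: _ => // i _; have [iB|/lB->] := boolP (i \in B).
  by apply: DZ; rewrite /D addrC subrK; exact: qC.
by rewrite scale0r.
Qed.

(** The span [H] of the homogenized points is the direct sum of the line through
one of them and of the direction space [H0] of the affine hull. *)
Lemma has_dimP B k : has_dim (poly B) k <-> rk hp B = k.+1.
Proof.
have [->|B0] := eqVneq B finset.set0.
  split=> [[x [V [_ E]]]|].
    have Ex : aff (poly finset.set0) x by rewrite E /= subrr mem0v.
    have : (set0 : set 'rV[R]_n) x; last by [].
    by apply: (Ex set0); split; [move=> ? ? ? []|rewrite poly0].
  have := rk_card hp finset.set0; rewrite cards0 => + E.
  by rewrite E.
have [i0 i0B] := finset.set0Pn _ B0.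
pose J : 'M[R]_(n, n + 1) := row_mx 1%:M 0.
pose f : 'Hom('rV[R]_n, 'rV[R]_(n + 1)) := linfun (mulmxr J).
have fE w : f w = row_mx w 0 by rewrite lfunE /= mul_mx_row mulmx1 mulmx0.
have finj : lker f == 0%VS.
  apply/lker0P => v w; rewrite !fE => /eq_row_mx[]//.
pose H := hspan hp B; pose H0 := (f @^-1: H)%VS.
have H0E w : (w \in H0) = (row_mx w 0 \in H) by rewrite -memv_preim fE.
have x0H : hom (q i0) \in H by exact: mem_hspan.
have dimE : \dim H = (\dim H0).+1.
  have EH : H = (f @: H0 + <[hom (q i0)]>)%VS.
    apply/eqP; rewrite eqEsubv; apply/andP; split; apply/subvP => w.
      rewrite -[w]hsubmxK => wH; set t := rsubmx w 0 0.
      have Ew : row_mx (lsubmx w) (rsubmx w) =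
          row_mx (lsubmx w - t *: q i0) 0 + t *: hom (q i0).
        rewrite /hom scale_row_mx add_row_mx subrK add0r; congr row_mx.
        by rewrite [LHS]mx11_scalar scale_scalar_mx mulr1.
      rewrite Ew memv_add ?memvZ ?memv_line // -fE memv_img // H0E.
      have -> : row_mx (lsubmx w - t *: q i0) 0 = row_mx (lsubmx w) (rsubmx w) - t *: hom (q i0).
        by rewrite Ew addrK.
      by rewrite memvB // memvZ.
    move=> /memv_addP[u /memv_imgP[z zH0 ->] [v /vlineP[c ->] ->]].
    by rewrite memvD ?memvZ // fE -H0E.
  rewrite EH dimv_disjoint_sum.
    rewrite limg_dim_eq ?dim_vline; last by rewrite (eqP finj) capv0.
    suff -> : hom (q i0) != 0 by rewrite addn1.
    apply/eqP => /matrixP/(_ 0 (rshift n 0)); rewrite /hom row_mxEr !mxE eqxx => /eqP.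
    by rewrite oner_eq0.
  apply/eqP; rewrite -subv0; apply/subvP => w /memv_capP[/memv_imgP[z _ ->] /vlineP[c]].
  rewrite fE /hom scale_row_mx => /eq_row_mx[-> /matrixP/(_ 0 0)].
  by rewrite !mxE eqxx mulr1 => <-; rewrite scale0r row_mx0 mem0v.
have diffE x y : hom x \in H -> (hom y \in H) = (y - x \in H0).
  move=> xH; rewrite H0E.
  have -> : row_mx (y - x) 0 = hom y - hom x :> 'rV[R]_(n + 1).
    by rewrite /hom opp_row_mx add_row_mx subrr.
  by apply/idP/idP => [yH|h]; [rewrite memvB|rewrite -(subrK (hom x) (hom y)) memvD].
rewrite /rk -/H dimE; split=> [[x [V [<- E]]]|[<-]].
  congr (\dim _).+1; apply/vspaceP => w.
  have xH : hom x \in H.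
    by apply/(affP _ B0); rewrite E /= subrr mem0v.
  have : aff (poly B) (x + w) <-> w \in V by rewrite E /= addrC addKr.
  rewrite affP // (diffE _ _ xH) addrAC subrr add0r => -[h1 h2].
  by apply/idP/idP => [/h1|/h2].
exists (q i0), H0; split=> //; apply/seteqP; split=> y /=.
  by move=> /(affP _ B0); rewrite (diffE _ _ x0H).
by move=> h; apply/(affP _ B0); rewrite (diffE _ _ x0H).
Qed.

End Dimension.

(** * Vertices, edges and facets of polytopes *)

Section Bridge.
Variables (R : realType) (n : nat) (T : finType) (q : T -> 'rV[R]_n).
Implicit Types (A B C : {set T}) (x y : 'rV[R]_n) (i j : T).
Local Notation hp := (hp q).
Local Notation poly := (poly q).

Lemma card_finset (U : finType) (B : {set U}) : ([set i | i \in B] #= `I_#|B|)%card.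
Proof.
have -> : [set i | i \in B] = (@enum_val U (mem B)) @` [set: 'I_#|B|].
  apply/seteqP; split=> [i /= iB|_ [k _ <-]]; last exact: enum_valP.
  by exists (enum_rank_in iB i); rewrite ?enum_rankK_in.
apply: card_eq_trans (card_esym card_II); apply: inj_card_eq.
by move=> x y _ _; exact: enum_val_inj.
Qed.

Lemma card_image_finset (U : finType) (V : Type) (B : {set U}) (f : U -> V) k :
  {in B &, injective f} -> (f @` [set i | i \in B] #= `I_k)%card <-> #|B| = k.
Proof.
move=> fi; have fi' : {in [set i | i \in B] &, injective f}.
  by move=> i j; rewrite !inE; exact: fi.
have E := inj_card_eq fi'.
split=> [H|<-]; last exact: card_eq_trans E (card_finset B).
apply/esym/card_eq_II; apply: card_eq_trans (card_finset B).
exact: card_eq_trans (card_esym H) E.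
Qed.

Lemma polytope_poly A : polytope (poly A).
Proof.
exists (q @` [set i | i \in A]); split=> //.
exact/finite_image/finite_finset.
Qed.

(** Identifies the degree of a vertex with its number of neighbours. *)
Lemma edges_at A i : convex_position hp A -> i \in A ->
  [set E | edges (poly A) E /\ E (q i)] =
  (fun u => poly [set i; u]%SET) @` [set u | u \in nbrs hp A i].
Proof.
move=> cA iA; apply/seteqP; split=> [E [[/facesP[B fB ->] /has_dimP rB]]|_ [u ui <-]].
  move=> /(poly_mem cA iA (face_sub fB)) iB.
  by have [u ui ->] := rk2_face cA fB iB rB; exists u.
have [uA ui' fu] := nbrsP _ _ _ _ ui; split; last by apply: poly_vertex; rewrite !inE eqxx.
split; first by apply/facesP; exists [set i; u]%SET.
by apply/has_dimP; apply: (rk_pair cA iA uA); rewrite eq_sym.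
Qed.

Lemma pair_poly_inj A i : convex_position hp A -> i \in A ->
  {in nbrs hp A i &, injective (fun u => poly [set i; u]%SET)}.
Proof.
move=> cA iA u w /nbrsP[uA ui _] /nbrsP[wA wi _] /(poly_inj cA) E.
have sub z : z \in A -> [set i; z]%SET \subset A.
  by move=> zA; exact: set2_sub.
have /setP/(_ u) := E (sub u uA) (sub w wA).
by rewrite !inE eqxx orbT (negbTE ui) /= => /esym/eqP.
Qed.

Lemma simple_vertexP A i : convex_position hp A -> i \in A ->
  simple_vertex (poly A) (q i) <-> simple hp A i.
Proof.
move=> cA iA; rewrite /simple iA /=; split.
  move=> [_ [d [/has_dimP rA]]]; rewrite edges_at // card_image_finset.
    by move=> ->; rewrite rA.
  exact: pair_poly_inj.
move=> /eqP rA; split; first by rewrite verticesE //; exists i.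
exists #|nbrs hp A i|; split; first by apply/has_dimP; rewrite rA.
rewrite edges_at // card_image_finset //; exact: pair_poly_inj.
Qed.

Lemma nonsimple_verticesE A : convex_position hp A ->
  nonsimple_vertices (poly A) = q @` [set i | i \in nonsimple hp A].
Proof.
move=> cA; apply/seteqP; split=> x; rewrite /nonsimple_vertices /= verticesE //.
  move=> [[i iA <-] H]; exists i => //; rewrite /= inE iA /=.
  by apply/negP => /(simple_vertexP cA iA).
move=> [i]; rewrite inE => /andP[iA si] <-; split; first by exists i.
by move/(simple_vertexP cA iA); apply/negP.
Qed.

Lemma card_vertices A k : convex_position hp A ->
  (vertices (poly A) #= `I_k)%card <-> #|A| = k.
Proof. by move=> cA; rewrite verticesE // card_image_finset //; exact: q_inj. Qed.

Lemma card_nonsimple A k : convex_position hp A ->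
  (nonsimple_vertices (poly A) #= `I_k)%card <-> #|nonsimple hp A| = k.
Proof.
move=> cA; rewrite nonsimple_verticesE // card_image_finset //.
by move=> i j; rewrite !inE => /andP[iA _] /andP[jA _]; exact: (q_inj cA).
Qed.

Lemma facetsP A F : facets (poly A) F <->
  exists B, [/\ is_face hp A B, B != finset.set0, (rk hp B).+1 = rk hp A & F = poly B].
Proof.
split.
  move=> [/facesP[B fB ->] [k [/has_dimP rB /has_dimP rA]]]; exists B; split=> //.
    by apply: contra_eq_neq rB => ->; rewrite rk_set0.
  by rewrite rB rA.
move=> [B [fB B0 rB ->]]; split; first by apply/facesP; exists B.
exists (rk hp B).-1; suff : (0 < rk hp B)%N.
  by move=> r0; split; apply/has_dimP; rewrite prednK.
have [i iB] := finset.set0Pn _ B0.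
have := @rk_insert _ _ _ hp finset.set0 i (one R n); rewrite rk_set0 finset.setU0 => H.
have ri : rk hp [set i]%SET = 1%N.
  by apply: H => [x|]; rewrite ?inE // ev_one oner_eq0.
apply: (@leq_trans (rk hp [set i]%SET)); first by rewrite ri.
by apply: rkS; rewrite finset.sub1set.
Qed.

Lemma pyr_pyramid A : convex_position hp A -> (1 < rk hp A)%N -> pyr hp A -> pyramid (poly A).
Proof.
move=> cA r1 [i iA fi]; exists (poly (A :\ i)), (q i).
have [c c0 Ec] := fi.
have cz j : j \in (A :\ i)%SET -> ev hp c j = 0 by rewrite Ec inE => /andP[_ /eqP].
have ci : ev hp c i != 0.
  by have := setD11 i A; rewrite Ec inE iA /= => /negbT.
have rA : (rk hp (A :\ i)).+1 = rk hp A by rewrite -[in RHS](finset.setD1K iA) (rk_insert cz ci).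
split.
- apply/facetsP; exists (A :\ i)%SET; split=> //.
  by apply: contraTneq r1 => E; rewrite -rA E rk_set0.
- by rewrite verticesE //; exists i.
- by move=> /(poly_mem cA iA (finset.subsetDl _ _)); rewrite !inE eqxx.
- apply/seteqP; split.
    apply: poly_sub_convex; first exact: conv_convex.
    move=> j jA; apply: sub_gen_smallest; have [->|ji] := eqVneq j i; first by right.
    by left; apply: poly_vertex; rewrite !inE ji.
  apply: smallest_sub; first exact: poly_convex.
  move=> x [|->]; last exact: poly_vertex.
  by apply: (@polyS _ _ _ q (A :\ i)%SET A); exact: finset.subsetDl.
Qed.

Lemma pyramid_pyr A : convex_position hp A -> pyramid (poly A) -> pyr hp A.
Proof.
move=> cA [F [v [/facetsP[B [fB B0 rB ->]]]]]; rewrite verticesE // => -[i iA <-] iB PE.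
exists i => //; have BA := face_sub fB.
suff -> : (A :\ i)%SET = B by [].
apply/eqP; rewrite finset.eqEsubset; apply/andP; split; apply/fintype.subsetP => j; last first.
  move=> jB; rewrite !inE (fintype.subsetP BA) // andbT.
  by apply/eqP => E; apply: iB; rewrite -E; exact: poly_vertex.
rewrite !inE => /andP[ji jA]; apply/(poly_mem cA jA BA).
have : poly (i |: B) (q j).
  have : poly A (q j) by exact: poly_vertex.
  rewrite PE; apply: smallest_sub; first exact: poly_convex.
  move=> x [|->]; last by apply: poly_vertex; rewrite !inE eqxx.
  by apply: polyS; exact: finset.subsetUr.
move/(poly_mem cA jA); rewrite finset.subUset finset.sub1set iA BA => /(_ isT).
by rewrite !inE (negbTE ji) /=; exact: poly_vertex.
Qed.

End Bridge.

(** Choose a minimal set of points with convex hull [P]. None of them is a convex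
combination of the others, so Farkas' lemma yields exposing functionals. *)
Lemma polytope_config (R : realType) n (P : set 'rV[R]_n) : polytope P ->
  exists m (q : 'I_m -> 'rV[R]_n) (A : {set 'I_m}),
    convex_position (hp q) A /\ P = poly q A.
Proof.
move=> [S [/finite_seqP[s ->] ->]].
pose q (i : 'I_(size s)) := s`_i.
have ET : Defs.conv [set` s] = poly q [set: 'I_(size s)]%SET.
  congr Defs.conv; apply/seteqP; split=> [x /= xs|_ [i _ <-]]; last exact: mem_nth.
  have xs' : (index x s < size s)%N by rewrite index_mem.
  by exists (Ordinal xs') => //; rewrite ?inE // /q /= nth_index.
have [A /asboolP AE Amin] := @arg_minnP _ [set: 'I_(size s)]%SET
   (fun A => `[< poly q A = Defs.conv [set` s] >]) (fun A => #|A|) (introT (asboolP _) (esym ET)).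
exists (size s), q, A; split=> // i iA.
have iout : ~ poly q (A :\ i) (q i).
  move=> Hi; have : poly q (A :\ i) = Defs.conv [set` s].
    rewrite -AE; apply/seteqP; split; first by apply: polyS; exact: finset.subsetDl.
    apply: poly_sub_convex; first exact: poly_convex.
    move=> j jA; have [->//|ji] := eqVneq j i.
    by apply: poly_vertex; rewrite !inE ji.
  move=> /asboolP/Amin; rewrite [X in (X <= _)%N](cardsD1 i) iA.
  by rewrite ltnn.
have [[l l0 El]|[c cP ci]] := farkas [seq hp q j | j <- enum (A :\ i)] (hp q i).
  case: iout; apply/polyP.
  pose k j := if j \in (A :\ i)%SET then l (index j (enum (A :\ i))) else 0.
  have Ek : hp q i = \sum_j k j *: hp q j.
    rewrite El size_map (bigID (mem (A :\ i)%SET)) /= [X in _ + X]big1 ?addr0; last first.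
      by move=> j; rewrite /k => /negbTE->; rewrite scale0r.
    rewrite -[RHS]big_enum /= [RHS](big_nth i) [RHS]big_mkord; apply: eq_bigr => -[j jlt] _ /=.
    rewrite (nth_map i) // /k -mem_enum mem_nth // index_uniq ?enum_uniq //.
  move: Ek; rewrite hom_sum => /eq_row_mx[Eq /matrixP/(_ 0 0)].
  rewrite !mxE eqxx mulr1n => E1; exists k; split=> //.
  - by move=> j; rewrite /k; case: ifP.
  - by move=> j; rewrite /k => /negbTE->.
exists (c - ev (hp q) c i *: one R n) => [j jA|].
  rewrite evB evZ ev_one mulr1; have [->|ji] := eqVneq j i; first by rewrite subrr.
  rewrite subr_ge0 (le_trans (ltW ci)) //; apply: cP; apply: map_f.
  by rewrite mem_enum !inE ji.
apply/setP => j; rewrite !inE evB evZ ev_one mulr1 subr_eq0.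
have [->|ji] := eqVneq j i; first by rewrite iA eqxx.
have [jA|//] := boolP (j \in A); apply/esym/negbTE; rewrite gt_eqF //.
apply: lt_le_trans ci _; apply: cP; apply: map_f.
by rewrite mem_enum !inE ji.
Qed.

(** * Facets of polytopes *)

Section Combinatorial.
Variables (R : realType) (n : nat).

Definition facet_sets (T : finType) (q : T -> 'rV[R]_n) (A : {set T}) : {set {set T}} :=
  [set B | [&& `[< is_face (hp q) A B >], B != finset.set0 & (rk (hp q) B).+1 == rk (hp q) A]]%SET.

Lemma facetsE (T : finType) (q : T -> 'rV[R]_n) (A : {set T}) :
  facets (poly q A) = (poly q) @` [set B | B \in facet_sets q A].
Proof.
apply/seteqP; split=> [F /facetsP[B [fB B0 rB ->]]|_ [B + <-]].
  by exists B => //=; rewrite inE B0 rB eqxx !andbT; apply/asboolP.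
by rewrite /= inE => /and3P[/asboolP fB B0 /eqP rB]; apply/facetsP; exists B.
Qed.

Lemma card_facets (T : finType) (q : T -> 'rV[R]_n) (A : {set T}) k :
  convex_position (hp q) A ->
  (facets (poly q A) #= `I_k)%card <-> #|facet_sets q A| = k.
Proof.
move=> cA; rewrite facetsE card_image_finset // => B C.
rewrite !inE => /and3P[/asboolP/face_sub BA _ _] /and3P[/asboolP/face_sub CA _ _].
exact: poly_inj cA BA CA.
Qed.

(** Describes facets by the inclusion of faces alone, so that combinatorial
equivalences preserve them. *)
Lemma facets_maximal (T : finType) (q : T -> 'rV[R]_n) (A : {set T}) F :
  convex_position (hp q) A -> (1 < rk (hp q) A)%N ->
  facets (poly q A) F <-> [/\ faces (poly q A) F, F <> poly q A &
    forall G, faces (poly q A) G -> F `<=` G -> G = F \/ G = poly q A].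
Proof.
move=> cA r1; split.
  move=> /facetsP[B [fB B0 rB ->]]; split; first by apply/facesP; exists B.
    move=> /(poly_inj cA (face_sub fB) (fintype.subxx A)) E.
    by move: rB; rewrite E => /eqP; rewrite eqn_leq ltnn.
  move=> G /facesP[C fC ->] /(poly_le cA (face_sub fB) (face_sub fC)) BC.
  by have [->|->] := facet_maximal fB rB fC BC; [left|right].
move=> [/facesP[B fB ->] BnA Bmax].
have BA : B != A by apply/eqP => E; apply: BnA; rewrite E.
have rBA := rk_proper_face fB BA.
have rB : (rk (hp q) B).+1 = rk (hp q) A.
  apply/eqP; rewrite eqn_leq rBA /= leqNgt; apply/negP => lt.
  have [C [fC BC CB CA]] := bigger_face fB lt.
  have fC' : faces (poly q A) (poly q C) by apply/facesP; exists C.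
  have [/(poly_inj cA (face_sub fC) (face_sub fB)) E|/(poly_inj cA (face_sub fC) (fintype.subxx A)) E] :=
    Bmax _ fC' (polyS BC).
    by rewrite E eqxx in CB.
  by rewrite E eqxx in CA.
apply/facetsP; exists B; split=> //.
by apply: contraTneq r1 => E; rewrite -rB E rk_set0.
Qed.

Lemma comb_equiv_facets (T U : finType) (q : T -> 'rV[R]_n) (A : {set T})
    (r : U -> 'rV[R]_n) (B : {set U}) k :
  convex_position (hp q) A -> (1 < rk (hp q) A)%N ->
  convex_position (hp r) B -> (1 < rk (hp r) B)%N ->
  comb_equiv (poly q A) (poly r B) -> (facets (poly q A) #= `I_k)%card ->
  (facets (poly r B) #= `I_k)%card.
Proof.
move=> cA rA cB rB [phi [[phiF phi_inj phi_surj] phi_le]] cF.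
have fA : faces (poly q A) (poly q A) by apply/facesP; exists A => //; exact: face_refl.
have fB : faces (poly r B) (poly r B) by apply/facesP; exists B => //; exact: face_refl.
have subA F : faces (poly q A) F -> F `<=` poly q A.
  by move=> /facesP[C /face_sub CA ->]; exact: polyS.
have subB F : faces (poly r B) F -> F `<=` poly r B.
  by move=> /facesP[C /face_sub CB ->]; exact: polyS.
have top : phi (poly q A) = poly r B.
  have [F fF EF] := phi_surj _ fB; apply/seteqP; split.
    by apply: subB; exact: phiF.
  by rewrite -EF; apply/(phi_le _ _ fF fA); exact: subA.
have inj F G : faces (poly q A) F -> faces (poly q A) G -> phi F = phi G -> F = G.
  by move=> fF fG; apply: phi_inj; apply/mem_set.
have -> : facets (poly r B) = phi @` facets (poly q A).
  apply/seteqP; split=> [H|_ [F /(facets_maximal _ cA rA)[fF FA Fmax] <-]].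
    move=> /(facets_maximal _ cB rB)[fH HB Hmax].
    have [F fF EF] := phi_surj _ fH; exists F => //; apply/(facets_maximal _ cA rA).
    split=> //; first by move=> E; apply: HB; rewrite -EF E top.
    move=> G fG /(phi_le _ _ fF fG); rewrite EF => /(Hmax _ (phiF _ fG))[E|E].
      by left; apply: inj => //; rewrite E EF.
    by right; apply: inj => //; rewrite E top.
  apply/(facets_maximal _ cB rB); split; first exact: phiF.
    by rewrite -top => /(inj _ _ fF fA)/FA.
  move=> H fH; have [G fG <-] := phi_surj _ fH; move=> /(phi_le _ _ fF fG)/(Fmax _ fG)[->|->].
    by left.
  by right.
apply: card_eq_trans cF; apply: inj_card_eq => F G /set_mem[fF _] /set_mem[fG _].
exact: inj.
Qed.

End Combinatorial.

(** * Geometric prisms *)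

Section LinearPart.
Variables (R : realType) (n : nat).
Implicit Types (x v : 'rV[R]_n) (c : 'cV[R]_(n + 1)).

(** The linear part of the affine function [at_ c], which measures how the
function changes under translations. *)
Definition lin_part c v : R := (v *m usubmx c) 0 0.

Lemma at_translate c x v : at_ c (x + v) = at_ c x + lin_part c v.
Proof. by rewrite !at_split mulmxDl mxE addrAC. Qed.

Lemma lin_partB c c' k v : lin_part (c - k *: c') v = lin_part c v - k * lin_part c' v.
Proof.
rewrite /lin_part linearB linearZ mulmxBr -scalemxAr.
by rewrite mxE [X in _ + X]mxE [X in _ - X]mxE.
Qed.

Lemma lin_partZ c k v : lin_part (k *: c) v = k * lin_part c v.
Proof. by rewrite /lin_part linearZ -scalemxAr mxE. Qed.
End LinearPart.

(** Points in which [s] acts on [K] as the translation by [v] form a prism: [g] is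
the height over the base, and subtracting multiples of [g] from the dual
functionals of the base gives functionals that are constant in the direction
[v]. *)
Section PrismConfig.
Variables (R : realType) (n : nat) (T : finType) (q : T -> 'rV[R]_n).
Variables (A K : {set T}) (s : T -> T) (v : 'rV[R]_n) (g : 'cV[R]_(n + 1)).
Hypothesis KA : K \subset A.
Hypothesis sP : forall x, x \in A -> [/\ s x \in A, s (s x) = x & (s x \in K) = (x \notin K)].
Hypothesis qs : forall x, x \in K -> q (s x) = q x + v.
Hypothesis dual : forall x, x \in K -> exists2 c, forall y, y \in K -> y != x -> ev (hp q) c y = 0
   & ev (hp q) c x = 1.
Hypothesis gK : forall x, x \in K -> ev (hp q) g x = 0.
Hypothesis gv : lin_part g v = 1.

Lemma prism_config_data : prism_data (hp q) A K s.
Proof.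
have sK y : y \in A -> y \notin K -> [/\ s y \in K & q y = q (s y) + v].
  move=> yA yK; have [_ ssy syK] := sP yA; have sK : s y \in K by rewrite syK.
  by split=> //; rewrite -qs // ssy.
have gE y : y \in A -> ev (hp q) g y = (y \notin K)%:R.
  move=> yA; have [yK|yK] := boolP (y \in K); first by rewrite gK.
  by have [syK Ey] := sK y yA yK; rewrite ev_hp Ey at_translate gv -ev_hp gK // add0r.
have col x : x \in K -> is_face (hp q) A (A :\: [set x; s x]).
  move=> xK; have [c c0 cx] := dual xK; have xA := fintype.subsetP KA _ xK.
  pose c' := c - lin_part c v *: g.
  have c'v : lin_part c' v = 0 by rewrite lin_partB gv mulr1 subrr.
  have c'K y : y \in K -> ev (hp q) c' y = (y == x)%:R.
    move=> yK; rewrite evB evZ gK // mulr0 subr0; have [->//|yx] := eqVneq y x.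
    exact: c0.
  have c'A y : y \in A -> ev (hp q) c' y = ((y == x) || (y == s x))%:R.
    move=> yA; have [yK|yK] := boolP (y \in K).
      rewrite c'K //; have [->//|yx] /= := eqVneq y x.
      by have [E|//] := eqVneq y (s x); have [_ _] := sP xA; rewrite -E yK xK.
    have [syK Ey] := sK y yA yK; rewrite ev_hp Ey at_translate c'v addr0 -ev_hp c'K //.
    have -> : y == x = false by apply: contraNF yK => /eqP->.
    have [_ ssy _] := sP yA; have [_ ssx _] := sP xA.
    by congr (_%:R); congr nat_of_bool; apply/eqP/eqP => [<-|->].
  exists c' => [y yA|]; first by rewrite c'A // ler0n.
  apply/setP => y; rewrite !inE; have [yA|//] := boolP (y \in A); last by rewrite andbF.
  by rewrite c'A // pnatr_eq0 eqb0 andbT.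
split=> //.
  exists g => [y yA|]; first by rewrite gE // ler0n.
  apply/setP => y; rewrite inE; have [yA|yA] /= := boolP (y \in A).
    by rewrite gE // pnatr_eq0 eqb0 negbK.
  by apply: contraNF yA => /(fintype.subsetP KA).
move=> x xA; have [xK|xK] := boolP (x \in K); first exact: col.
have [sxA ssx sxK] := sP xA; have := col (s x); rewrite sxK xK ssx finset.setUC.
exact.
Qed.

Lemma prism_config_rk : K != finset.set0 -> rk (hp q) A = #|K|.+1.
Proof.
move=> /finset.set0Pn[x0 x0K]; have rK := prism_rk_base prism_config_data.
have x0A := fintype.subsetP KA _ x0K; have [sxA ssx sxK] := sP x0A.
have <- : rk (hp q) (s x0 |: K) = #|K|.+1.
  rewrite (rk_insert (c := g)) ?rK // ev_hp qs // at_translate gv -ev_hp gK //.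
apply/eqP; rewrite eqn_leq; apply/andP; split; last first.
  by apply: rkS; rewrite finset.subUset finset.sub1set sxA.
apply/dimvS/span_subvP => _ /mapP[y + ->]; rewrite mem_enum => yA.
have [yK|yK] := boolP (y \in K); first by apply: mem_hspan; rewrite !inE yK orbT.
have [_ ssy syK] := sP yA; have sK : s y \in K by rewrite syK.
have -> : hp q y = hp q (s y) + (hp q (s x0) - hp q x0).
  have Ey : q y = q (s y) + v by rewrite -qs // ssy.
  rewrite /hp /hom Ey (qs x0K).
  rewrite opp_row_mx !add_row_mx subrr addr0; congr row_mx.
  by congr (_ + _); rewrite addrAC subrr add0r.
by apply: rpredD; [|apply: rpredB]; apply: mem_hspan; rewrite !inE ?sK ?x0K ?eqxx ?orbT.
Qed.

Lemma prism_config_convpos : K != finset.set0 -> convex_position (hp q) A.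
Proof.
move=> K0 x xA; apply/(prism_faces _ prism_config_data (prism_config_rk K0)).
rewrite finset.sub1set xA; split=> //; have [xK|xK] := boolP (x \in K).
  by constructor 1; rewrite finset.sub1set.
by constructor 2; rewrite finset.sub1set inE xK.
Qed.

Lemma prism_config_conv :
  poly q A = Defs.conv (poly q K `|` [set x + v | x in poly q K]).
Proof.
apply/seteqP; split.
  apply: poly_sub_convex; first exact: conv_convex.
  move=> y yA; apply: (@sub_gen_smallest _ (@convex_set R _)).
  have [yK|yK] := boolP (y \in K); first by left; exact: poly_vertex.
  have [_ ssy syK] := sP yA; have sK : s y \in K by rewrite syK.
  right; exists (q (s y)); first exact: poly_vertex.
  by rewrite -qs // ssy.
apply: smallest_sub; first exact: poly_convex.
move=> _ [/(polyS KA)//|[x xK <-]].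
suff : poly q K `<=` [set x | poly q A (x + v)] by apply.
apply: poly_sub_convex => [|y yK].
  apply/convex_setE => a b t t0 t1 /= Pa Pb.
  have -> : t *: a + (1 - t) *: b + v = t *: (a + v) + (1 - t) *: (b + v).
    by rewrite !scalerDr addrACA -scalerDl (addrC t) subrK scale1r.
  have /convex_setE H := @poly_convex R n T q A; exact: H.
rewrite /= -qs //; apply: poly_vertex.
by have [] := sP (fintype.subsetP KA _ yK).
Qed.
End PrismConfig.

(** Both face lattices are isomorphic to the same lattice of subsets of [A]. *)
Lemma same_faces_comb_equiv (R : realType) n (T : finType) (q r : T -> 'rV[R]_n) (A : {set T}) :
  convex_position (hp q) A -> convex_position (hp r) A ->
  (forall B, is_face (hp q) A B <-> is_face (hp r) A B) ->
  comb_equiv (poly q A) (poly r A).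
Proof.
move=> cq cr E.
pose phi (F : set 'rV[R]_n) := poly r [set x in A | `[< F (q x) >]].
have phiE (B : {set T}) : B \subset A -> phi (poly q B) = poly r B.
  move=> BA; rewrite /phi; congr poly; apply/setP => x; rewrite inE.
  have [xA|xA] /= := boolP (x \in A); last first.
    by apply/esym; apply: contraNF xA => /(fintype.subsetP BA).
  by apply/asboolP/idP => /(poly_mem cq xA BA).
exists phi; split; first split.
- move=> _ /facesP[B fB ->]; rewrite /= phiE ?(face_sub fB) //; apply/facesP; exists B => //.
  exact/E.
- move=> F G /set_mem/facesP[B fB ->] /set_mem/facesP[C fC ->].
  rewrite !phiE ?(face_sub fB) ?(face_sub fC) // => /(poly_inj cr (face_sub fB) (face_sub fC)).
  by move=> ->.
- move=> _ /facesP[B fB ->]; exists (poly q B); last by rewrite phiE // (face_sub fB).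
  by apply/facesP; exists B => //; exact/E.
move=> _ _ /facesP[B fB ->] /facesP[C fC ->]; rewrite !phiE ?(face_sub fB) ?(face_sub fC) //.
split=> /poly_le H; apply/(poly_le _ (face_sub fB) (face_sub fC)).
- exact: cr.
- exact: (H A cq (face_sub fB) (face_sub fC)).
- exact: cq.
- exact: (H A cr (face_sub fB) (face_sub fC)).
Qed.

(** The functionals dual to [B] read off the coefficients of an affine relation. *)
Lemma free_simplex (R : realType) n (T : finType) (q : T -> 'rV[R]_n) (B : {set T}) k :
  rk (hp q) B = #|B| -> #|B| = k.+1 -> simplex k (poly q B).
Proof.
move=> rB cB; have [x0 x0B] : exists x, x \in B by apply/card_gt0P; rewrite cB.
pose e (i : 'I_k.+1) := enum_val (cast_ord (esym cB) i).
exists (q \o e); split; last first.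
  congr Defs.conv; apply/seteqP; split=> [_ [x xB <-]|_ [i _ <-]]; last first.
    by exists (e i); rewrite //= enum_valP.
  by exists (cast_ord cB (enum_rank_in x0B x)); rewrite //= /e cast_ordK enum_rankK_in.
move=> l l0 lq i; have [c c0 c1] := dual_functional rB (enum_valP (cast_ord (esym cB) i)).
have : \sum_j l j * at_ c (q (e j)) = 0.
  under eq_bigr => j _ do rewrite at_split mulrDr.
  rewrite big_split /= -mulr_suml l0 mul0r addr0.
  transitivity (((\sum_j l j *: q (e j)) *m usubmx c) 0 0).
    by rewrite mulmx_suml summxE; apply: eq_bigr => j _; rewrite -scalemxAl [RHS]mxE.
  by rewrite [X in X *m _]lq mul0mx mxE.
rewrite (bigD1 i) //= [at_ _ _]c1 mulr1 big1 ?addr0 // => j ji.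
rewrite [at_ _ _]c0 ?mulr0 ?enum_valP //; apply: contra ji => /eqP/enum_val_inj/cast_ord_inj->.
by [].
Qed.

(** Translate the base [K] by the vector [v] along one of the edges between the
bases. The resulting prism has the combinatorics of [A], and [prism_faces] says
that this determines all faces. *)
Lemma prismlike_simplicial_prism (R : realType) n (T : finType) (q : T -> 'rV[R]_n)
    (A : {set T}) d : convex_position (hp q) A -> (0 < d)%N -> rk (hp q) A = d.+1 ->
  prismlike (hp q) d A -> simplicial_prism d (poly q A).
Proof.
move=> cA d0 rA [K [s [cK pA]]].
have [KA sP _ _] := pA; have [f [g0 [fE gE]]] := prism_functionals pA.
have [x0 x0K] : exists x, x \in K by apply/card_gt0P; rewrite cK.
have x0A := fintype.subsetP KA _ x0K; have [sxA ssx sxK] := sP x0 x0A.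
pose v := q (s x0) - q x0.
have g0K x : x \in K -> ev (hp q) g0 x = 0.
  by move=> xK; have := gE x (fintype.subsetP KA _ xK); rewrite xK.
have g0v : 0 < lin_part g0 v.
  have := gE _ sxA; rewrite sxK x0K /=; rewrite ev_hp.
  have -> : q (s x0) = q x0 + v by rewrite /v addrC subrK.
  by rewrite at_translate -ev_hp g0K // add0r.
pose g := (lin_part g0 v)^-1 *: g0.
have gK x : x \in K -> at_ g (q x) = 0 by move=> xK; rewrite -ev_hp evZ g0K // mulr0.
have gv : lin_part g v = 1.
  by rewrite lin_partZ mulVf // gt_eqF.
(* The vertices of the prism, indexed like those of the given polytope. *)
pose r x := if x \in K then q x else q (s x) + v.
have rK x : x \in K -> r x = q x by rewrite /r => ->.
have rs x : x \in K -> r (s x) = r x + v.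
  move=> xK; have [_ ssx' sxK'] := sP x (fintype.subsetP KA _ xK).
  by rewrite /r sxK' xK /= ssx'.
have rdual x : x \in K -> exists2 c, forall y, y \in K -> y != x -> ev (hp r) c y = 0 & ev (hp r) c x = 1.
  move=> xK; have [c c0 c1] := dual_functional (prism_rk_base pA) xK.
  by exists c => [y yK yx|]; rewrite ev_hp rK //; exact: c0.
have rgK x : x \in K -> ev (hp r) g x = 0 by move=> xK; rewrite ev_hp rK // gK.
have pR := prism_config_data KA sP rs rdual rgK gv.
have K0 : K != finset.set0 by apply/finset.set0Pn; exists x0.
have rR := prism_config_rk KA sP rs rdual rgK gv K0.
have cR := prism_config_convpos KA sP rs rdual rgK gv K0.
case: d d0 rA cK => // k _ rA cK.
exists k, (poly r K), (poly r A); split=> //.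
- exact: free_simplex (prism_rk_base pR) cK.
- exists v; split; last exact: (prism_config_conv KA sP rs).
  have gB : aff (poly r K) `<=` [set x | at_ g x = 0].
    apply: smallest_sub.
      move=> x y t /= gx gy; have -> : (1 - t) *: x + t *: y = x + t *: (y - x).
        by rewrite scalerBl scale1r scalerBr -addrA [- _ + _]addrC.
      rewrite at_translate gx add0r /lin_part -scalemxAl mxE.
      have -> : ((y - x) *m usubmx g) 0 0 = 0.
        have := at_translate g x (y - x); rewrite addrC subrK gx gy add0r /lin_part.
        by move=> <-.
      by rewrite mulr0.
    move=> x /polyP[l [_ lK l1 ->]]; rewrite /= at_comb // big1 // => i _.
    have [iK|/lK->] := boolP (i \in K); last by rewrite mul0r.
    by rewrite -ev_hp rgK // mulr0.
  move=> x /gB /= gx /gB /=; rewrite at_translate gx gv add0r => /eqP.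
  by rewrite oner_eq0.
- apply: same_faces_comb_equiv => // B.
  by split=> /prism_faces H; apply/prism_faces; by [exact: pR|rewrite rR|exact: pA|rewrite rA cK|apply: H; rewrite // rA cK].
Qed.

(** * Polytopes with few nonsimple vertices *)

Theorem few_nonsimple_vertices (R : realType) (n d k : nat) (P : set 'rV[R]_n) :
     dpolytope d P ->
     (vertices P #= `I_(2 * d)%N)%card ->
     (nonsimple_vertices P #= `I_k)%card -> (k + 2 <= d)%N ->
     simplicial_prism d P \/ pyramid P.
Proof.
move=> [/polytope_config[m [q [A [cA ->]]]] /has_dimP rA].
move=> /(card_vertices _ cA) vA /(card_nonsimple _ cA) nA kd.
have d2 : (2 <= d)%N by apply: leq_trans kd; rewrite leq_addl.
have [||pA|pA] := pyr_or_prismlike (@ev_one R n _ q) cA rA d2.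
- by rewrite vA.
- by rewrite nA.
- by right; apply: pyr_pyramid => //; rewrite rA ltnS ltnW.
- by left; apply: prismlike_simplicial_prism => //; exact: ltnW.
Qed.

(** * Facets of prisms and relative interiors of simplices *)

Section Simplices.
Variables (R : realType) (n : nat).

Lemma simplex_dual k (a : 'I_k.+1 -> 'rV[R]_n) i : affinely_independent a ->
  hom (a i) \notin hspan (hp a) [set~ i].
Proof.
move=> ai; apply/negP => /hspan_comb[l lB E].
have : \sum_j (l j - (j == i)%:R) *: hp a j = 0.
  under eq_bigr => j _ do rewrite scalerBl.
  rewrite sumrB -E [X in _ - X](bigD1 i) //= eqxx scale1r big1 ?addr0 ?subrr //.
  by move=> j /negbTE->; rewrite scale0r.
rewrite hom_sum -[in X in _ = X](@row_mx0 R 1 n 1) => /eq_row_mx[E1 /matrixP/(_ 0 0)].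
rewrite !mxE eqxx mulr1n => E2.
have := ai _ E2 E1 i; rewrite eqxx lB ?inE ?eqxx // sub0r => /eqP.
by rewrite oppr_eq0 oner_eq0.
Qed.

(** A facet of the prism is a maximal face, hence by [prism_faces] one of the two
bases or a side that omits one of the [k + 1] edges between them. *)
Lemma simplicial_prism_facets k (B Q : set 'rV[R]_n) :
  simplex k B -> prism_over B Q ->
  exists (q : bool * 'I_k.+1 -> 'rV[R]_n) (m : nat),
    [/\ convex_position (hp q) [set: bool * 'I_k.+1]%SET, rk (hp q) [set: bool * 'I_k.+1]%SET = k.+2,
        Q = poly q [set: bool * 'I_k.+1]%SET, (facets Q #= `I_m)%card & (m <= k + 3)%N].
Proof.
move=> [a [ai ->]] [v [vout ->]].
pose q (x : bool * 'I_k.+1) := a x.2 + (if x.1 then v else 0).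
pose K : {set bool * 'I_k.+1} := [set x | ~~ x.1]%SET.
pose s (x : bool * 'I_k.+1) := (~~ x.1, x.2).
have KA : K \subset finset.setT by apply/fintype.subsetP => x; rewrite !inE.
have sP x : x \in finset.setT ->
    [/\ s x \in finset.setT, s (s x) = x & (s x \in K) = (x \notin K)].
  by move=> _; rewrite !inE; case: x => b i; split=> //; rewrite /s /= negbK.
have qs x : x \in K -> q (s x) = q x + v.
  by rewrite inE /q /s /=; case: x => -[] i //= _; rewrite addr0.
have polyK : poly q K = Defs.conv (range a).
  congr Defs.conv; apply/seteqP; split=> [_ [[b i] + <-]|_ [i _ <-]].
    by rewrite /= inE /= /q /= => /negbTE->; exists i; rewrite // addr0.
  by exists (false, i); rewrite /= ?inE // /q /= addr0.
have qa i : q (false, i) = a i by rewrite /q /= addr0.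
have dual x : x \in K -> exists2 c, forall y, y \in K -> y != x -> ev (hp q) c y = 0 &
    ev (hp q) c x = 1.
  case: x => b i; rewrite inE /= => /negbTE->.
  have [c c0 c1] := sep_hspan (simplex_dual i ai).
  exists c => [[b' j]|]; rewrite ?inE /=.
    move=> /negbTE-> ji; rewrite ev_hp qa -ev_hp; apply: c0; rewrite !inE.
    by apply: contraNneq ji => ->.
  by rewrite ev_hp qa.
have K0 : K != finset.set0 by apply/finset.set0Pn; exists (false, ord0); rewrite inE.
have out : hom (a ord0 + v) \notin hspan (hp q) K.
  apply/negP => /(affP _ _ K0); rewrite polyK; apply: vout.
  apply: sub_gen_smallest; apply: sub_gen_smallest; by exists ord0.
have [g gK g1] := sep_hspan out.
have gv : lin_part g v = 1.
  have := at_translate g (a ord0) v; rewrite [LHS]g1.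
  by rewrite -qa -ev_hp gK ?inE // add0r.
have pA := prism_config_data KA sP qs dual gK gv.
have rA := prism_config_rk KA sP qs dual gK gv K0.
have cA := prism_config_convpos KA sP qs dual gK gv K0.
have cK : #|K| = k.+1.
  rewrite -[RHS]card_ord -(card_imset predT (f := fun i : 'I_k.+1 => (false, i))); last by move=> i j [].
  congr #|pred_of_set _|; apply/setP => -[b i]; rewrite inE /=; apply/idP/imsetP.
    by move=> /negbTE->; exists i.
  by move=> [j _ [-> _]].
have EQ : Defs.conv (Defs.conv (range a) `|` [set x + v | x in Defs.conv (range a)]) =
    poly q finset.setT.
  by rewrite -polyK -(prism_config_conv KA sP qs).
rewrite EQ; exists q, #|facet_sets q finset.setT|; split=> //.
- by rewrite rA cK.
- exact/card_facets.
have sub : facet_sets q finset.setT \subset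
    (K |: (~: K |: [set ~: [set x; s x] | x in K])).
  apply/fintype.subsetP => C; rewrite inE => /and3P[/asboolP fC C0 /eqP rC].
  have CT : C != finset.setT.
    by apply/eqP => E; move: rC; rewrite E => /eqP; rewrite eqn_leq ltnn.
  have [_ _ fK fcol] := pA; have [_ _ fK' _] := prism_sym pA.
  have x0 : (false, ord0) \in K by rewrite inE.
  have [_ [CK|CK|Cs]] := (prism_faces C pA rA).1 fC.
  - have [<-|E] := facet_maximal fC rC fK CK; first by rewrite !inE eqxx.
    have : (true, ord0) \in K by rewrite E inE.
    by rewrite inE.
  - have [E|E] := facet_maximal fC rC fK' CK; first by rewrite -E finset.setTD !inE eqxx orbT.
    have : (false, ord0) \in finset.setT :\: K by rewrite E inE.
    by rewrite !inE.
  - have [x xC] : exists x, x \notin C.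
      by move: CT; rewrite -finset.subTset => /fintype.subsetPn[x _ xC]; exists x.
    wlog xK : x xC / x \in K.
      move=> H; have [|xK] := boolP (x \in K); first exact: H.
      apply: (H (s x)).
        apply: contra xC => /Cs; have [_ -> _] := sP x (finset.in_setT _); by [].
      by have [_ _ ->] := sP x (finset.in_setT _).
    have CS : C \subset finset.setT :\: [set x; s x].
      apply/fintype.subsetP => y yC; rewrite !inE andbT negb_or; apply/andP; split.
        by apply: contraNneq xC => <-.
      apply: contraNneq xC => E; have := Cs y yC; rewrite E.
      by have [_ -> _] := sP x (finset.in_setT _).
    have [E|E] := facet_maximal fC rC (fcol x (finset.in_setT _)) CS.
      apply/finset.setU1P; right; apply/finset.setU1P; right; apply/imsetP; exists x => //.
      by rewrite -E finset.setTD.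
    have : x \in finset.setT :\: [set x; s x] by rewrite E inE.
    by rewrite !inE eqxx.
apply: leq_trans (subset_leq_card sub) _; rewrite !cardsU1 addnC addn3.
have c1 := leq_imset_card (fun x => ~: [set x; s x]) (mem K); rewrite cK in c1.
rewrite addnC; do 2!case: (_ \notin _); rewrite /= ?add0n ?add1n ?ltnS //.
- by apply: leqW.
- by apply: leqW.
- by do 2!apply: leqW.
Qed.

Lemma at_continuous (c : 'cV[R]_(n + 1)) : continuous (@at_ R n c).
Proof.
have -> : @at_ R n c = fun y => \sum_(j <- index_enum 'I_n) y 0 j * usubmx c j 0 + dsubmx c 0 0.
  by apply/funext => y; rewrite at_split mxE.
move=> y; apply: cvgD; [exact: nbhs_filter| |by apply: cvg_cst; exact: nbhs_filter].
have H : continuous (fun y : 'rV[R]_n => \sum_j y 0 j * usubmx c j 0 : R); last exact: H.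
apply: continuous_big => [[a b]|j _ z].
  by apply: cvgD; [exact: cvg_fst|exact: cvg_snd].
apply: cvgM; [exact: nbhs_filter|exact: coord_continuous|].
by apply: cvg_cst; exact: nbhs_filter.
Qed.

(** The barycentric coordinates of [x] are positive; they are affine functions on
the space, hence stay positive near [x]. *)
Lemma simplex_relint (T : finType) (q : T -> 'rV[R]_n) (B : {set T}) (l : T -> R) x :
  rk (hp q) B = #|B| -> (forall i, i \in B -> 0 < l i) -> (forall i, i \notin B -> l i = 0) ->
  \sum_i l i = 1 -> x = \sum_i l i *: q i -> relint (poly q B) x.
Proof.
move=> rB lpos l0 l1 Ex; split.
  apply/polyP; exists l; split=> // i; have [iB|/l0->//] := boolP (i \in B).
  exact/ltW/lpos.
have B0 : B != finset.set0.
  apply: contra_eq_neq l1 => E; rewrite big1 1?eq_sym ?oner_eq0 // => i _.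
  by apply: l0; rewrite E inE.
have /choice[c cP] i : exists c : 'cV[R]_(n + 1), i \in B ->
    (forall y, y \in B -> y != i -> ev (hp q) c y = 0) /\ ev (hp q) c i = 1.
  have [iB|] := boolP (i \in B); last by exists 0.
  by have [c c0 c1] := dual_functional rB iB; exists c.
have coord (k : T -> R) i : (forall i, i \notin B -> k i = 0) -> \sum_i k i = 1 -> i \in B ->
    at_ (c i) (\sum_j k j *: q j) = k i.
  move=> k0 k1 iB; have [ci0 ci1] := cP i iB; rewrite at_comb // (bigD1 i) //= -ev_hp ci1 mulr1.
  rewrite big1 ?addr0 // => j ji; have [jB|/k0->] := boolP (j \in B); last by rewrite mul0r.
  by rewrite -ev_hp ci0 // mulr0.
have : \forall y \near x, forall i : T, i \in B -> 0 < at_ (c i) y.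
  apply: (@filter_forall _ _ (fun i y => i \in B -> 0 < at_ (c i) y) _ (nbhs_filter x)) => i.
  have [iB|iB] := boolP (i \in B); last by apply: nearW.
  have cx : 0 < at_ (c i) x by rewrite Ex coord // lpos.
  have : nbhs x (@at_ R n (c i) @^-1` [set r | 0 < r]).
    by apply: at_continuous; exact: (lt_nbhsr cx).
  by apply: filterS => y.
apply: filterS => y ypos /(affP _ _ B0)/hspan_comb[k k0].
rewrite hom_sum => /eq_row_mx[Ey /matrixP/(_ 0 0)]; rewrite !mxE eqxx mulr1n => k1.
apply/polyP; exists k; split=> // i; have [iB|/k0->//] := boolP (i \in B).
by rewrite -(coord k i) // -Ey ltW // ypos.
Qed.

End Simplices.

Lemma poly_faceI (R : realType) n (T : finType) (q : T -> 'rV[R]_n) (A B C : {set T}) :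
  is_face (hp q) A B -> is_face (hp q) A C -> poly q B `&` poly q C = poly q (B :&: C).
Proof.
move=> fB fC; have fBC := faceI fB fC; apply/seteqP; split; last first.
  move=> x Px; split; move: Px; apply: polyS; [exact: finset.subsetIl|exact: finset.subsetIr].
case: fB fC => [b b0 EB] [c c0 EC] x [].
rewrite (poly_zero_set b0 EB) (poly_zero_set c0 EC) => -[PA bx] [_ cx].
have H : B :&: C = [set i in A | at_ (b + c) (q i) == 0]%SET.
  apply/setP => i; rewrite EB EC !inE; case iA : (i \in A) => //=.
  by rewrite -ev_hp evD paddr_eq0 ?b0 ?c0.
rewrite (poly_zero_set _ H); last by move=> i iA; rewrite -ev_hp evD addr_ge0 ?b0 ?c0.
by split=> //; rewrite /at_ mulmxDr mxE -/(at_ b x) -/(at_ c x) bx cx addr0.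
Qed.

Lemma no_simplicial_prism (R : realType) n (T : finType) (q : T -> 'rV[R]_n) (A : {set T}) d m :
  convex_position (hp q) A -> rk (hp q) A = d.+1 -> (facets (poly q A) #= `I_m)%card ->
  (d + 2 < m)%N -> ~ simplicial_prism d (poly q A).
Proof.
move=> cA rA fm dm [k [B [Q [dk sB pQ eqQ]]]].
have [r [m' [cr rr EQ fQ vset]]] := simplicial_prism_facets sB pQ.
rewrite EQ in eqQ fQ.
have := comb_equiv_facets cA _ cr _ eqQ fm; rewrite rA dk rr => /(_ isT isT) fm'.
have Em : m = m'.
  apply/card_eq_II; exact: card_eq_trans (card_esym fm') fQ.
by move: dm; rewrite Em dk ltnNge addSnnS vset.
Qed.

(** * Certificates for polytopes with eight vertices *)

Lemma all8 (P : pred nat) (i : 'I_8) : all P (iota 0 8) -> P i.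
Proof. by move=> /allP; apply; rewrite mem_iota /= ltn_ord. Qed.

Definition vset (m : bitseq) : {set 'I_8} := [set i : 'I_8 | nth false m i]%SET.
Definition andm (m1 m2 : bitseq) : bitseq := mkseq (fun i => nth false m1 i && nth false m2 i) 8.
Definition subm (m1 m2 : bitseq) : bool :=
  all (fun i => nth false m1 i ==> nth false m2 i) (iota 0 8).
Definition of_list (l : seq nat) : bitseq := mkseq (fun i => i \in l) 8.

Lemma vset_andm m1 m2 : vset (andm m1 m2) = vset m1 :&: vset m2.
Proof. by apply/setP => i; rewrite !inE nth_mkseq. Qed.

Lemma vset_of_list l : vset (of_list l) = [set i : 'I_8 | (i : nat) \in l]%SET.
Proof. by apply/setP => i; rewrite !inE nth_mkseq. Qed.

Lemma sum_iota8 (V : nmodType) (F : nat -> V) :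
  \sum_(l < 8) F l = foldr +%R 0 (map F (iota 0 8)).
Proof. by rewrite foldrE big_map -(big_mkord xpredT F). Qed.

Lemma card_vset m : size m = 8%N -> #|vset m| = count id m.
Proof.
move=> sm; rewrite -sum1_card.
transitivity (\sum_(i < 8) nth false m i)%N.
  by rewrite big_mkcond; apply: eq_bigr => i _; rewrite inE; case: (nth _ _ _).
rewrite -(big_mkord xpredT (fun i => nat_of_bool (nth false m i))).
by case: m sm => [|a [|b [|c [|d [|e [|f [|g [|h []]]]]]]]] // _; rewrite !big_nat_recr //= big_geq //= !addn0 ?addnA.
Qed.

Lemma vset_inj m1 m2 : size m1 = 8%N -> size m2 = 8%N -> vset m1 = vset m2 -> m1 = m2.
Proof.
move=> s1 s2 /setP E; apply: (@eq_from_nth _ false); first by rewrite s1 s2.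
by rewrite s1 => i i8; have := E (Ordinal i8); rewrite !inE.
Qed.

Definition affval (a pt : seq int) : int :=
  a`_0 * pt`_0 + a`_1 * pt`_1 + a`_2 * pt`_2 + a`_3 * pt`_3 + a`_4.

(** Integer tables for a 4-polytope with vertices [0, ..., 7]. Sets of vertices are
bit masks of length 8, and an affine function is the list of its four linear
coefficients followed by its constant term.
- [pts]: the coordinates of the vertices;
- [fac]: for each facet, an affine function that is nonnegative on the vertices,
  and the vertices where it vanishes;
- [nm]: the neighbours of each vertex;
- [rels]: a triple [(i, j, r)] stands for the affine relation between the
  vertices with coefficients [r], which shows that [i] and [j] span no edge;
- [base], [ind]: five affinely independent vertices, and affine functions dual
  to them up to scalars. *)
Record cert := Cert {
  pts : seq (seq int);
  fac : seq (seq int * bitseq);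
  nm : seq bitseq;
  rels : seq (nat * nat * seq int);
  base : bitseq;
  ind : seq (seq int) }.

Section Check.
Variable D : cert.
Let pt i := nth [::] (pts D) i.
Let nb i := nth [::] (nm D) i.
(** The intersection of the listed facets that contain [b]; it is a face, so [b]
spans a face if the closure adds nothing to it. *)
Definition closure b : bitseq :=
  foldr (fun f acc => if subm b f.2 then andm f.2 acc else acc) (nseq 8 true) (fac D).

Definition valid_fac := all (fun f => (size f.2 == 8%N) &&
  all (fun i => (0 <= affval f.1 (pt i)) && ((affval f.1 (pt i) == 0) == nth false f.2 i)) (iota 0 8)) (fac D).
Definition valid_vertices := all (fun i => closure (of_list [:: i]) == of_list [:: i]) (iota 0 8).
Definition valid_edges := all (fun i => all (fun j => nth false (nb i) j ==> (i != j) &&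
   (closure (of_list [:: i; j]) == of_list [:: i; j])) (iota 0 8)) (iota 0 8).
(** The coefficients of the relation are nonnegative except at [i] and [j], and not
all zero there, so that a functional which vanishes at [i] and [j] and is
positive elsewhere would have a positive sum along the relation. *)
Definition valid_rel (i j : nat) (r : nat * nat * seq int) :=
  [&& ((i == r.1.1) && (j == r.1.2)) || ((j == r.1.1) && (i == r.1.2)),
   all (fun k => foldr +%R 0 (map (fun l => r.2`_l * (pt l)`_k) (iota 0 8)) == 0) (iota 0 4),
   foldr +%R 0 (map (fun l => r.2`_l) (iota 0 8)) == 0,
   all (fun l => (l \notin [:: i; j]) ==> (0 <= r.2`_l)) (iota 0 8) &
   has (fun l => (l \notin [:: i; j]) && (0 < r.2`_l)) (iota 0 8)].
Definition valid_nonedges := all (fun i => all (fun j => (i != j) ==> ~~ nth false (nb i) j ==>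
   has (valid_rel i j) (rels D)) (iota 0 8)) (iota 0 8).
Definition simp v := count id (nb v) == 4%N.
(** At every simple vertex [v], each neighbour [u] is the one omitted by some
listed facet through [v]. *)
Definition valid_opp := all (fun v => simp v ==> all (fun u => nth false (nb v) u ==>
   has (fun f => nth false f.2 v && all (fun w => (nth false (nb v) w && nth false f.2 w) ==
      (nth false (nb v) w && (w != u))) (iota 0 8)) (fac D)) (iota 0 8)) (iota 0 8).
(** Each listed facet has rank [4], as seen at one of its simple vertices. *)
Definition valid_facsimple := all (fun f => has (fun v => [&& nth false f.2 v, simp v &
   count id (andm (nb v) f.2) == 3%N]) (iota 0 8)) (fac D).
(** A pyramid over a facet would have seven of the eight vertices on that facet.
The simple vertex [0] bounds the dimension from above. *)
Definition valid_misc := [&& all (fun f => count id f.2 != 7%N) (fac D),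
  uniq (map snd (fac D)), all (fun v => size (nb v) == 8%N) (iota 0 8),
  count (fun v => ~~ simp v) (iota 0 8) == 3%N &
  simp 0 ].
Definition valid_ind := [&& size (base D) == 5.+3, count id (base D) == 5 &
  all (fun i => all (fun j => nth false (base D) i ==> nth false (base D) j ==>
    ((affval (nth [::] (ind D) i) (pt j) == 0) == (i != j))) (iota 0 8)) (iota 0 8)].
Definition valid := [&& valid_fac, valid_vertices, valid_edges & valid_nonedges] &&
  [&& valid_opp, valid_facsimple, valid_misc & valid_ind].
End Check.

Section Certified.
Variables (R : realType) (D : cert).
Hypothesis ok : valid D.

Definition cq (i : 'I_8) : 'rV[R]_4 := \row_(j < 4) ((nth [::] (pts D) i)`_j)%:~R.
Definition cv (a : seq int) : 'cV[R]_(4 + 1) := col_mx (\col_(j < 4) (a`_j)%:~R) (a`_4)%:~R%:M.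
Let Tall : {set 'I_8} := [set: 'I_8]%SET.

Let ok_fac : valid_fac D. Proof. by case/andP: ok => /and4P[]. Qed.
Let ok_vertices : valid_vertices D. Proof. by case/andP: ok => /and4P[]. Qed.
Let ok_edges : valid_edges D. Proof. by case/andP: ok => /and4P[]. Qed.
Let ok_nonedges : valid_nonedges D. Proof. by case/andP: ok => /and4P[]. Qed.
Let ok_opp : valid_opp D. Proof. by case/andP: ok => _ /and4P[]. Qed.
Let ok_facsimple : valid_facsimple D. Proof. by case/andP: ok => _ /and4P[]. Qed.
Let ok_misc : valid_misc D. Proof. by case/andP: ok => _ /and4P[]. Qed.
Let ok_ind : valid_ind D. Proof. by case/andP: ok => _ /and4P[]. Qed.

Lemma at_cv a i : at_ (cv a) (cq i) = (affval a (nth [::] (pts D) i))%:~R.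
Proof.
rewrite at_col mxE !big_ord_recl big_ord0 !mxE /affval !rmorphD !rmorphM /= addr0.
by rewrite !addrA; do !congr (_ + _); rewrite mulrC.
Qed.

Lemma fac_face f : f \in fac D -> is_face (hp cq) Tall (vset f.2).
Proof.
move=> fD; have /allP/(_ f fD)/andP[_ H] := ok_fac.
exists (cv f.1) => [i _|].
  by have /andP[h _] := all8 i H; rewrite ev_hp at_cv ler0z.
apply/setP => i; rewrite !inE ev_hp at_cv intr_eq0.
by have /andP[_ /eqP] := all8 i H.
Qed.

Lemma closure_face b : is_face (hp cq) Tall (vset (closure D b)).
Proof.
rewrite /closure.
have : {subset fac D <= fac D} by [].
elim: {1 3}(fac D) => [|f s IH] sD /=.
  have -> : vset (nseq 8 true) = Tall by apply/setP => i; rewrite !inE nth_nseq ltn_ord.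
  exact: face_refl.
have fs := IH (fun x xs => sD x (mem_behead (s := f :: s) xs)).
case: ifP => // _; rewrite vset_andm; apply: faceI fs; apply: fac_face.
by apply: sD; rewrite inE eqxx.
Qed.

Lemma cert_convpos : convex_position (hp cq) Tall.
Proof.
move=> i _; have H : valid_vertices D := ok_vertices.
have := closure_face (of_list [:: i : nat]); rewrite (eqP (all8 i H)) vset_of_list.
by congr is_face; apply/setP => j; rewrite !inE.
Qed.

Lemma cert_edge (i j : 'I_8) : nth false (nth [::] (nm D) i) j ->
  i != j /\ is_face (hp cq) Tall [set i; j].
Proof.
move=> ij; have H : valid_edges D := ok_edges.
have /implyP/(_ ij)/andP[h /eqP E] := all8 j (all8 i H); split=> //.
have := closure_face (of_list [:: i : nat; j : nat]); rewrite E vset_of_list.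
by congr is_face; apply/setP => k; rewrite !inE.
Qed.

Lemma cert_nonedge (i j : 'I_8) : i != j -> ~~ nth false (nth [::] (nm D) i) j ->
  ~ is_face (hp cq) Tall [set i; j].
Proof.
move=> ij nij [c c0 Ec]; have H : valid_nonedges D := ok_nonedges.
have /implyP/(_ ij)/implyP/(_ nij)/hasP[r0 _ /and5P[_ H1 H2 H3 H4]] := all8 j (all8 i H).
set r := r0.2 in H1 H2 H3 H4.
have cij l : (ev (hp cq) c l == 0) = (l \in [set i; j]%SET) by rewrite Ec inE finset.in_setT.
have rel0 : \sum_(l < 8) (r`_l)%:~R *: hp cq l = 0 :> 'rV[R]_(4 + 1).
  rewrite hom_sum; have -> : \sum_(l < 8) (r`_l)%:~R = 0 :> R.
    by rewrite -rmorph_sum /= sum_iota8 (eqP H2).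
  have -> : \sum_(l < 8) (r`_l)%:~R *: cq l = 0.
    apply/rowP => k; rewrite summxE [RHS]mxE.
    under eq_bigr => l _ do rewrite !mxE -rmorphM.
    have k4 : (k : nat) \in iota 0 4 by rewrite mem_iota /=.
    by rewrite -rmorph_sum /= (sum_iota8 (fun l => r`_l * (nth [::] (pts D) l)`_k)) (eqP (allP H1 k k4)).
  by rewrite raddf0 row_mx0.
have sum0 : \sum_(l < 8) (r`_l)%:~R * ev (hp cq) c l = 0.
  transitivity (((\sum_(l < 8) (r`_l)%:~R *: hp cq l) *m c) 0 0).
    by rewrite mulmx_suml summxE; apply: eq_bigr => l _; rewrite -scalemxAl [RHS]mxE.
  by rewrite rel0 mul0mx mxE.
have pos (l : 'I_8) : 0 <= (r`_l)%:~R * ev (hp cq) c l.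
  have [lij|lij] := boolP (l \in [set i; j]%SET).
    by have /eqP-> : ev (hp cq) c l == 0 by rewrite cij.
  rewrite mulr_ge0 ?c0 ?finset.in_setT // ler0z.
  by have /implyP := all8 l H3; apply; move: lij; rewrite !inE.
have /hasP[l] := H4; rewrite mem_iota => /= l8 /andP[lij rl].
move/eqP: sum0; rewrite psumr_eq0 // => /allP/(_ (Ordinal l8) (mem_index_enum _)).
rewrite /= mulf_eq0 intr_eq0 gt_eqF //= cij !inE.
by move: lij; rewrite !inE negb_or => /andP[/negbTE h1 /negbTE h2]; rewrite -!val_eqE /= h1 h2.
Qed.

Lemma cert_nbrs i : nbrs (hp cq) Tall i = vset (nth [::] (nm D) i).
Proof.
apply/setP => j; rewrite [RHS]inE; apply/nbrsP/idP => [[_ ji fj]|/cert_edge[ij fij]].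
  by apply: contraT => nij; have := cert_nonedge _ nij; rewrite eq_sym => /(_ ji) /(_ fj).
by split; rewrite ?finset.in_setT // eq_sym.
Qed.

Lemma cert_nbsize (i : 'I_8) : size (nth [::] (nm D) i) = 8%N.
Proof.
have := ok_misc.
by case/and5P => _ _ H _ _; exact/eqP/(all8 i H).
Qed.

Lemma cert_card_nbrs i : #|nbrs (hp cq) Tall i| = count id (nth [::] (nm D) i).
Proof. by rewrite cert_nbrs card_vset // cert_nbsize. Qed.

Lemma cert_rk_base : rk (hp cq) (vset (base D)) = #|vset (base D)|.
Proof.
have := ok_ind; case/and3P => _ _ H.
apply: rk_indep => i; rewrite inE => iK; exists (cv (nth [::] (ind D) i)) => [j|].
  rewrite inE ev_hp at_cv => jK ji; apply/eqP; rewrite intr_eq0.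
  by have /implyP/(_ iK)/implyP/(_ jK)/eqP-> := all8 j (all8 i H); rewrite eq_sym.
rewrite ev_hp at_cv intr_eq0.
by have /implyP/(_ iK)/implyP/(_ iK)/eqP-> := all8 i (all8 i H); rewrite eqxx.
Qed.

Lemma cert_rk : rk (hp cq) Tall = 5%N.
Proof.
have := ok_misc; case/and5P => _ _ _ _ s0; apply/eqP; rewrite eqn_leq; apply/andP; split.
  have := rk_nbrs cert_convpos (finset.in_setT (ord0 : 'I_8)); rewrite cert_card_nbrs.
  by rewrite (eqP s0).
have := ok_ind; case/and3P => /eqP s8 /eqP c5 _.
have cK : #|vset (base D)| = 5%N by rewrite card_vset.
by rewrite -{1}cK -cert_rk_base; apply: rkS; exact: finset.subsetT.
Qed.

Lemma cert_simple (i : 'I_8) : simple (hp cq) Tall i = simp D i.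
Proof. by rewrite /simple finset.in_setT cert_card_nbrs cert_rk. Qed.

Lemma cert_nonsimple : #|nonsimple (hp cq) Tall| = 3%N.
Proof.
have := ok_misc.
case/and5P => _ _ _ /eqP c3 _; apply: etrans c3.
have -> : nonsimple (hp cq) Tall = vset (mkseq (fun i => ~~ simp D i) 8).
  by apply/setP => i; rewrite !inE nth_mkseq // cert_simple.
by rewrite card_vset ?size_mkseq // /mkseq count_map; apply: eq_count.
Qed.

(** A facet has at least four vertices, hence a simple one, and is determined by
the neighbour of that vertex which it omits. So the list is complete. *)
Lemma cert_facet_sets : facet_sets cq Tall = [set B in [seq vset f.2 | f <- fac D]]%SET.
Proof.
have cO := ok_opp.
apply/setP => B; rewrite !inE; apply/and3P/mapP.
  move=> [/asboolP fB B0 /eqP rB].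
  have rB4 : rk (hp cq) B = 4%N by apply/eqP; rewrite -eqSS rB cert_rk.
  have [v vB sv] : exists2 v, v \in B & simple (hp cq) Tall v.
    have : (0 < #|B :\: nonsimple (hp cq) Tall|)%N.
      rewrite cardsD subn_gt0; apply: leq_ltn_trans (subset_leq_card (finset.subsetIr _ _)) _.
      by rewrite cert_nonsimple; apply: (@leq_trans (rk (hp cq) B)); [rewrite rB4|exact: rk_card].
    case/card_gt0P => v /setDP[vB]; rewrite inE finset.in_setT /= negbK; by exists v.
  have [u Eu] := one_outside cert_convpos cert_rk sv fB vB rB4.
  have /setDP[uv uB] : u \in nbrs (hp cq) Tall v :\: B by rewrite Eu inE.
  have sv' : simp D v by rewrite -cert_simple.
  have uv' : nth false (nth [::] (nm D) v) u by move: uv; rewrite cert_nbrs inE.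
  have /implyP/(_ sv') H := all8 v cO.
  have /implyP/(_ uv')/hasP[f fD /andP[vf Hf]] := all8 u H.
  exists f => //; apply: (face_eq cert_convpos fB (fac_face fD) vB); first by rewrite inE.
  apply/setP => w; rewrite !finset.in_setI cert_nbrs ![w \in vset _]inE (eqP (all8 w Hf)).
  have [wv|//] /= := boolP (nth false _ w).
  have wv' : w \in nbrs (hp cq) Tall v by rewrite cert_nbrs inE.
  have /setP/(_ w) := Eu; rewrite finset.in_setD wv' andbT finset.in_set1.
  by move=> E; rewrite -[w \in B]negbK E -val_eqE.
move=> [f fD ->]; have fF := fac_face fD; have := ok_facsimple.
move=> /allP/(_ f fD)/hasP[v]; rewrite mem_iota => /andP[_ v8] /and3P[vf sv c3].
have {}v8 : (v < 8)%N := v8.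
have vF : Ordinal v8 \in vset f.2 by rewrite inE.
split; first exact/asboolP.
  by apply/finset.set0Pn; exists (Ordinal v8).
rewrite (rk_face cert_convpos _ fF vF) ?cert_simple // cert_nbrs -vset_andm card_vset ?size_mkseq //.
by rewrite (eqP c3) cert_rk.
Qed.

Lemma fac_size f : f \in fac D -> size f.2 = 8%N.
Proof.
move=> fD; by have /allP/(_ f fD)/andP[/eqP] := ok_fac.
Qed.

Lemma cert_uniq : uniq [seq vset f.2 | f <- fac D].
Proof.
have := ok_misc; case/and5P => _ un _ _ _.
rewrite (map_comp vset snd) map_inj_in_uniq // => m1 m2 /mapP[f fD ->] /mapP[f' fD' ->].
by apply: vset_inj; exact: fac_size.
Qed.

Lemma cert_card_facets : #|facet_sets cq Tall| = size (fac D).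
Proof.
rewrite cert_facet_sets cardsE -[RHS](size_map (fun f => vset f.2)).
exact/card_uniqP/cert_uniq.
Qed.

Lemma cert_not_pyr : ~ pyr (hp cq) Tall.
Proof.
move=> [i iA fi]; have : (Tall :\ i)%SET \in facet_sets cq Tall.
  have [c c0 Ec] := fi.
  have cz j : j \in (Tall :\ i)%SET -> ev (hp cq) c j = 0 by rewrite Ec inE => /andP[_ /eqP].
  have ci : ev (hp cq) c i != 0.
    by have := setD11 i Tall; rewrite Ec inE iA /= => /negbT.
  have rA : (rk (hp cq) (Tall :\ i)).+1 = rk (hp cq) Tall.
    by rewrite -[in RHS](finset.setD1K iA) (rk_insert cz ci).
  rewrite inE rA eqxx andbT; apply/andP; split; first exact/asboolP.
  by apply/eqP => E; move: rA; rewrite E rk_set0 cert_rk.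
rewrite cert_facet_sets inE => /mapP[f fD E].
have := ok_misc.
case/and5P => /allP/(_ f fD) + _ _ _ _.
rewrite -card_vset ?fac_size // -E; have := cardsD1 i Tall; rewrite iA cardsT card_ord.
by rewrite add1n => -[E7]; rewrite -E7.
Qed.

Lemma cert_polytope : [/\ dpolytope 4 (poly cq Tall), (vertices (poly cq Tall) #= `I_8)%card,
  (nonsimple_vertices (poly cq Tall) #= `I_3)%card, ((size (fac D) > 6)%N -> ~ simplicial_prism 4 (poly cq Tall)) &
  ~ pyramid (poly cq Tall)].
Proof.
have cA := cert_convpos; split.
- by split; [exact: polytope_poly|apply/has_dimP; exact: cert_rk].
- by apply/(card_vertices _ cA); rewrite cardsT card_ord.
- by apply/(card_nonsimple _ cA); exact: cert_nonsimple.
- move=> f6; apply: (no_simplicial_prism cA cert_rk _ f6).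
  by apply/card_facets => //; exact: cert_card_facets.
- by move=> /(pyramid_pyr cA); exact: cert_not_pyr.
Qed.

Lemma cert_adjacent (i j : 'I_8) :
  Defs.adjacent (poly cq Tall) (cq i) (cq j) <-> nth false (nth [::] (nm D) i) j.
Proof.
have cA := cert_convpos; split=> [[_ _ qij [E [eE Ei Ej]]]|ij].
  have : [set E | edges (poly cq Tall) E /\ E (cq i)] E by [].
  rewrite edges_at // => -[u ui Eu]; move: Ej; rewrite -Eu.
  have uiT : [set i; u]%SET \subset Tall by exact: finset.subsetT.
  move=> /(poly_mem cA (finset.in_setT j) uiT); rewrite !inE => /orP[/eqP ji|/eqP ->].
    by case: qij; rewrite ji.
  by move: ui; rewrite /= cert_nbrs inE.
have [nij fij] := cert_edge ij.
have vT k : vertices (poly cq Tall) (cq k).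
  by rewrite verticesE //; exists k => //=; rewrite finset.in_setT.
split=> //.
  by move=> /(q_inj cA (finset.in_setT _) (finset.in_setT _)) E; rewrite E eqxx in nij.
have mem k : k \in [set i; j]%SET -> poly cq [set i; j]%SET (cq k) by exact: poly_vertex.
exists (poly cq [set i; j]); split.
- split; first by apply/facesP; exists [set i; j]%SET.
  by apply/has_dimP; exact: (rk_pair cA (finset.in_setT _) (finset.in_setT _)).
- by apply: mem; rewrite !inE eqxx.
- by apply: mem; rewrite !inE eqxx orbT.
Qed.

End Certified.

(** * The two examples *)

Local Notation L l := (of_list l%N).

Definition edge_masks : seq bitseq :=
  [:: L [:: 2; 3; 4; 5]; L [:: 2; 3; 4; 6]; L [:: 0; 1; 3; 4; 5; 6]; L [:: 0; 1; 2; 4; 6; 7];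
      L [:: 0; 1; 2; 3; 5; 7]; L [:: 0; 2; 4; 7]; L [:: 1; 2; 3; 7]; L [:: 3; 4; 5; 6]].

(** The polytope of [D2] after moving the vertex [1] to the midpoint of its edge to
[6], in coordinates multiplied by [2]. This lifts [1] out of the hyperplane of
the bipyramid and breaks that facet into the simplices of the vertices
[0, 2, 3, 4] and [1, 2, 3, 4]. *)
Definition D1 : cert := Cert
  [:: [:: 0; 0; 2; 0]; [:: 1; 1; -2; 2]; [:: 4; 0; 0; 0]; [:: 0; 4; 0; 0];
      [:: -2; -2; 0; 0]; [:: 0; -2; 2; 2]; [:: 2; 2; -2; 4]; [:: 0; 0; 0; 4] ]%Z
  [:: ([:: 0; 0; 0; 1; 0]%Z, L [:: 0; 2; 3; 4]);
      ([:: 0; 0; 1; 1; 0]%Z, L [:: 1; 2; 3; 4]);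
      ([:: -1; 3; -2; 3; 4]%Z, L [:: 0; 2; 4; 5]);
      ([:: -1; -1; 2; 1; 4]%Z, L [:: 1; 2; 3; 6]);
      ([:: 3; -1; -2; -1; 4]%Z, L [:: 0; 3; 4; 5; 7]);
      ([:: 3; -1; 2; -1; 4]%Z, L [:: 1; 3; 4; 6; 7]);
      ([:: -1; -1; -2; -1; 4]%Z, L [:: 0; 2; 3; 5; 6; 7]);
      ([:: -1; 3; 2; -1; 4]%Z, L [:: 1; 2; 4; 5; 6; 7])]
  edge_masks
  [:: (0, 1, [:: -4; -2; 1; 2; 1; 2; 0; 0]%Z); (0, 6, [:: -6; 0; 1; 3; 0; 4; -2; 0]%Z);
      (0, 7, [:: -2; 0; 0; 1; 0; 2; 0; -1]%Z); (1, 5, [:: 0; -6; 1; 0; 3; -2; 4; 0]%Z);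
      (1, 7, [:: 0; -2; 0; 0; 1; 0; 2; -1]%Z); (2, 7, [:: 0; 0; -1; 0; 0; 2; 2; -3]%Z);
      (3, 5, [:: 2; 0; 0; -1; 0; -2; 0; 1]%Z); (4, 6, [:: 0; 2; 0; 0; -1; 0; -2; 1]%Z);
      (5, 6, [:: 0; 0; 1; 0; 0; -2; -2; 3]%Z)]%N
  (L [:: 0; 2; 3; 4; 5])
  [:: [:: 0; 0; 1; -1; 0]; [::]; [:: 3; -1; -2; -1; 4]; [:: -1; 3; -2; 3; 4];
      [:: -1; -1; -2; -1; 4]; [:: 0; 0; 0; 1; 0] ]%Z.

(** In the hyperplane where the last coordinate vanishes lies a bipyramid, with
apexes [0] and [1] over the triangle of the vertices [2], [3] and [4]. Above it,
the vertices [5], [6] and [7] are placed so that only the vertices of the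
triangle are nonsimple. *)
Definition D2 : cert := Cert
  [:: [:: 0; 0; 1; 0]; [:: 0; 0; -1; 0]; [:: 2; 0; 0; 0]; [:: 0; 2; 0; 0];
      [:: -1; -1; 0; 0]; [:: 0; -1; 1; 1]; [:: 1; 1; -1; 2]; [:: 0; 0; 0; 2] ]%Z
  [:: ([:: 0; 0; 0; 1; 0]%Z, L [:: 0; 1; 2; 3; 4]);
      ([:: -1; 3; -2; 3; 2]%Z, L [:: 0; 2; 4; 5]);
      ([:: -1; -1; 2; 1; 2]%Z, L [:: 1; 2; 3; 6]);
      ([:: 3; -1; -2; -1; 2]%Z, L [:: 0; 3; 4; 5; 7]);
      ([:: 3; -1; 2; -1; 2]%Z, L [:: 1; 3; 4; 6; 7]);
      ([:: -1; -1; -2; -1; 2]%Z, L [:: 0; 2; 3; 5; 6; 7]);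
      ([:: -1; 3; 2; -1; 2]%Z, L [:: 1; 2; 4; 5; 6; 7])]
  edge_masks
  [:: (0, 1, [:: -2; -2; 1; 1; 2; 0; 0; 0]%Z); (0, 6, [:: -6; 0; 1; 3; 0; 4; -2; 0]%Z);
      (0, 7, [:: -2; 0; 0; 1; 0; 2; 0; -1]%Z); (1, 5, [:: 0; -3; 1; 0; 3; -2; 1; 0]%Z);
      (1, 7, [:: 0; -1; 0; 0; 1; 0; 1; -1]%Z); (2, 7, [:: 0; 0; -1; 0; 0; 2; 2; -3]%Z);
      (3, 5, [:: 2; 0; 0; -1; 0; -2; 0; 1]%Z); (4, 6, [:: 0; 1; 0; 0; -1; 0; -1; 1]%Z);
      (5, 6, [:: 0; 0; 1; 0; 0; -2; -2; 3]%Z)]%N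
  (L [:: 0; 2; 3; 4; 5])
  [:: [:: 0; 0; 1; -1; 0]; [::]; [:: 3; -1; -2; -1; 2]; [:: -1; 3; -2; 3; 2];
      [:: -1; -1; -2; -1; 2]; [:: 0; 0; 0; 1; 0] ]%Z.

Lemma ok1 : valid D1. Proof. by vm_compute. Qed.
Lemma ok2 : valid D2. Proof. by vm_compute. Qed.

Section Example.
Variable R : realType.
Let q1 : 'I_8 -> 'rV[R]_4 := cq R D1.
Let q2 : 'I_8 -> 'rV[R]_4 := cq R D2.
Let A : {set 'I_8} := [set: 'I_8]%SET.
Let Q1 := poly q1 A.
Let Q2 := poly q2 A.
Let c1 : convex_position (hp q1) A := cert_convpos R ok1.
Let c2 : convex_position (hp q2) A := cert_convpos R ok2.

Definition relabel (x : 'rV[R]_4) : 'rV[R]_4 := q2 (odflt ord0 [pick i | q1 i == x]).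

Lemma relabelE i : relabel (q1 i) = q2 i.
Proof.
rewrite /relabel; case: pickP => [j /eqP|/(_ i)]; last by rewrite eqxx.
by move=> /(q_inj c1 (finset.in_setT _) (finset.in_setT _)) ->.
Qed.

Lemma relabel_image (B : {set 'I_8}) : relabel @` (q1 @` [set i | i \in B]) = q2 @` [set i | i \in B].
Proof.
apply/seteqP; split=> [_ [_ [i iB <-] <-]|_ [i iB <-]]; rewrite ?relabelE; first by exists i.
by exists (q1 i); [exists i|exact: relabelE].
Qed.

Lemma relabel_bij : set_bij (vertices Q1) (vertices Q2) relabel.
Proof.
rewrite !verticesE //; split.
- by move=> _ [i iA <-]; rewrite /= relabelE; exists i.
- move=> _ _ /set_mem[i iA <-] /set_mem[j jA <-]; rewrite !relabelE.
  by move=> /(q_inj c2 iA jA) ->.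
- by rewrite -relabel_image.
Qed.

Lemma example_graph_iso : graph_iso Q1 Q2.
Proof.
exists relabel; split; first exact: relabel_bij.
move=> x y; rewrite !verticesE // => -[i _ <-] [j _ <-]; rewrite !relabelE.
by rewrite (cert_adjacent R ok1) (cert_adjacent R ok2).
Qed.

Lemma vertices_face (q : 'I_8 -> 'rV[R]_4) (B : {set 'I_8}) :
  convex_position (hp q) A -> is_face (hp q) A B -> vertices (poly q B) = q @` [set i | i \in B].
Proof. by move=> cA fB; apply: verticesE; exact: convpos_face cA fB. Qed.

Lemma mem_facets (D : cert) B : B \in facet_sets (cq R D) A ->
  facets (poly (cq R D) A) (poly (cq R D) B).
Proof. by move=> fB; rewrite facetsE; exists B. Qed.

Lemma facet_is_face (D : cert) B : B \in facet_sets (cq R D) A ->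
  is_face (hp (cq R D)) A B.
Proof. by rewrite inE => /and3P[/asboolP]. Qed.

Let F1 := vset (L [:: 0; 2; 3; 4]).
Let F2 := vset (L [:: 1; 2; 3; 4]).
Let Rdg := vset (L [:: 2; 3; 4]).
Let Bip := vset (L [:: 0; 1; 2; 3; 4]).

Lemma F1_cap_F2 : F1 :&: F2 = Rdg.
Proof. by rewrite -vset_andm. Qed.

Lemma F1_cup_F2 : F1 :|: F2 = Bip.
Proof.
apply/setP => i; rewrite /F1 /F2 /Bip !inE.
by case: i => [[|[|[|[|[|[|[|[]]]]]]]]] //.
Qed.

Lemma F1_facet : F1 \in facet_sets q1 A.
Proof. by rewrite (cert_facet_sets R ok1) inE; apply/mapP; exists (nth ([::], [::]) (fac D1) 0). Qed.
Lemma F2_facet : F2 \in facet_sets q1 A.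
Proof. by rewrite (cert_facet_sets R ok1) inE; apply/mapP; exists (nth ([::], [::]) (fac D1) 1). Qed.
Lemma Bip_facet : Bip \in facet_sets q2 A.
Proof. by rewrite (cert_facet_sets R ok2) inE; apply/mapP; exists (nth ([::], [::]) (fac D2) 0). Qed.

Lemma F1_neq_F2 : F1 != F2.
Proof. by apply/eqP => E; have := vset_inj (size_mkseq _ _) (size_mkseq _ _) E. Qed.

Lemma rk_facet1 B : B \in facet_sets q1 A -> rk (hp q1) B = 4%N.
Proof. by rewrite inE (cert_rk R ok1) => /and3P[_ _ /eqP[->]]. Qed.

Lemma facet_simplex B : B \in facet_sets q1 A -> #|B| = 4%N -> simplex 3 (poly q1 B).
Proof. by move=> fB cB; apply: free_simplex => //; rewrite rk_facet1. Qed.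

Lemma rk_Rdg : rk (hp q1) Rdg = 3%N.
Proof.
rewrite (rk_subfree (A := F1)) ?card_vset //; first by rewrite -F1_cap_F2 finset.subsetIl.
by rewrite rk_facet1 ?F1_facet.
Qed.

Lemma rk_Rdg2 : rk (hp q2) Rdg = #|Rdg|.
Proof.
apply: rk_subfree (cert_rk_base R ok2).
apply/fintype.subsetP => i; rewrite /Rdg !inE.
by case: i => [[|[|[|[|[|[|[|[]]]]]]]]] //.
Qed.

Let a := q2 (inord 0).
Let b := q2 (inord 1).

Lemma poly_ab : Defs.conv [set a; b] = poly q2 [set inord 0; inord 1].
Proof.
congr Defs.conv; apply/seteqP; split=> [x [->|->]|x [i + <-]] /=.
- by exists (inord 0) => //; rewrite /= !inE eqxx.
- by exists (inord 1) => //; rewrite /= !inE eqxx orbT.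
- move=> iB; have : i \in [set inord 0; inord 1]%SET := iB.
  by rewrite !inE => /orP[]/eqP->; [left|right].
Qed.

Lemma coord2 (i : 'I_8) (j : 'I_4) : q2 i 0 j = ((nth [::] (pts D2) i)`_j)%:~R.
Proof. by rewrite mxE. Qed.

Lemma a_neq_b : a <> b.
Proof.
move=> /(q_inj c2 (finset.in_setT _) (finset.in_setT _)) /(congr1 (@nat_of_ord 8)).
by rewrite !inordK.
Qed.

Lemma coord_zero (B : {set 'I_8}) (j : 'I_4) x :
  (forall i, i \in B -> (nth [::] (pts D2) i)`_j = 0) -> poly q2 B x -> x 0 j = 0.
Proof.
move=> B0 /polyP[l [_ lB _ ->]]; rewrite summxE big1 // => i _; rewrite mxE coord2.
by have [/B0->|/lB->] := boolP (i \in B); rewrite ?mulr0 // mul0r.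
Qed.

(** The coefficients of [0] in terms of the vertices, given as a list so that the
required identities can be checked by evaluation. *)
Lemma relint_zero (B : {set 'I_8}) (l : seq R) : rk (hp q2) B = #|B| ->
  (forall i : 'I_8, i \in B -> 0 < l`_i) -> (forall i : 'I_8, i \notin B -> l`_i = 0) ->
  foldr +%R 0 (map (fun i => l`_i) (iota 0 8)) = 1 ->
  (forall j : 'I_4, foldr +%R 0 (map (fun i => l`_i * ((nth [::] (pts D2) i)`_j)%:~R) (iota 0 8)) = 0) ->
  relint (poly q2 B) 0.
Proof.
move=> rB lpos l0 l1 lq; apply: (simplex_relint (l := fun i : 'I_8 => l`_i) rB lpos l0).
  by rewrite (sum_iota8 (fun i => l`_i)).
apply/rowP => j; rewrite mxE summxE -[LHS](lq j) -sum_iota8.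
by apply: eq_bigr => i _; rewrite [RHS]mxE coord2.
Qed.

Let j4 (P : 'I_4 -> Prop) : P 0 -> P 1 -> P 2%:R -> P 3%:R -> forall j, P j.
Proof.
move=> p0 p1 p2 p3 [[|[|[|[|//]]]] lt4].
- by move: p0; congr P; apply/val_inj.
- by move: p1; congr P; apply/val_inj.
- by move: p2; congr P; apply/val_inj.
- by move: p3; congr P; apply/val_inj.
Qed.

(** The segment from [0] to [1] lies on the third coordinate axis, and the triangle
of the vertices [2], [3] and [4] in the plane where the last two coordinates
vanish; they meet in the origin. *)
Lemma bip_centre : relint (Defs.conv [set a; b]) `&` relint (poly q2 Rdg) = [set 0].
Proof.
rewrite poly_ab; apply/seteqP; split=> [x [[abx _] [Rx _]]|_ ->].
  apply/rowP; have ab0 (j : 'I_4) : j != 2%:R -> x 0 j = 0.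
    move=> j2; apply: coord_zero abx => i; rewrite !inE => /orP[]/eqP->; rewrite inordK //; move: j2;
    by elim/j4: j.
  have R0 : x 0 2%:R = 0.
    apply: coord_zero Rx => i; rewrite /Rdg inE.
    by case: i => [[|[|[|[|[|[|[|[]]]]]]]]] //.
  by move=> j; rewrite mxE; have [->//|] := eqVneq j 2%:R; exact: ab0.
have i01 : inord 0 != inord 1 :> 'I_8 by rewrite -val_eqE /= !inordK.
split.
  apply: (@relint_zero _ [:: 1/2; 1/2; 0; 0; 0; 0; 0; 0]).
  - by rewrite (rk_pair c2 (finset.in_setT _) (finset.in_setT _) i01) cards2 i01.
  - by move=> i; rewrite !inE => /orP[]/eqP->; rewrite inordK //=; lra.
  - move=> i; rewrite !inE -!val_eqE /= !inordK //.
    by case: i => [[|[|[|[|[|[|[|[]]]]]]]]] //.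
  - rewrite /=; lra.
  - by elim/j4; rewrite /=; lra.
apply: (@relint_zero _ [:: 0; 0; 1/4; 1/4; 1/2; 0; 0; 0]).
- exact: rk_Rdg2.
- move=> i; rewrite /Rdg inE.
  by case: i => [[|[|[|[|[|[|[|[]]]]]]]]] //= _ _; lra.
- move=> i; rewrite /Rdg inE.
  by case: i => [[|[|[|[|[|[|[|[]]]]]]]]] //.
- rewrite /=; lra.
- by elim/j4; rewrite /=; lra.
Qed.

(** The lists of facets of the two polytopes agree except for the two simplices
and the bipyramid. *)
Lemma example_glued : glued_along_ridge Q1 Q2.
Proof.
have fF1 := facet_is_face F1_facet; have fF2 := facet_is_face F2_facet.
have fBip := facet_is_face Bip_facet.
have F1F2 : poly q1 F1 `&` poly q1 F2 = poly q1 Rdg by rewrite (poly_faceI fF1 fF2) F1_cap_F2.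
have fR : is_face (hp q1) A Rdg by rewrite -F1_cap_F2; exact: faceI.
have vU : relabel @` (vertices (poly q1 F1) `|` vertices (poly q1 F2)) = q2 @` [set i | i \in Bip].
  rewrite !vertices_face // image_setU !relabel_image -image_setU -F1_cup_F2; congr image.
  apply/seteqP; split=> i /=; last by move=> /finset.setUP.
  by move=> h; apply/finset.setUP.
exists relabel, (poly q1 F1), (poly q1 F2); rewrite vU -/(poly q2 Bip) F1F2.
split.
- exact: relabel_bij.
- split; [exact: mem_facets F1_facet|exact: mem_facets F2_facet| |].
    by move=> /(poly_inj c1 (finset.subsetT _) (finset.subsetT _)) E; have := F1_neq_F2; rewrite E eqxx.
  split; first by apply/facesP; exists Rdg.
  exists 2%N; split; apply/has_dimP; first exact: rk_Rdg.
  exact: cert_rk ok1.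
- by split; exists 3%N; apply: facet_simplex; rewrite ?F1_facet ?F2_facet ?card_vset.
- pose im (B : {set 'I_8}) := q2 @` [set i | i \in B].
  have E2 : [set vertices G | G in facets Q2] = im @` [set B | B \in [seq vset f.2 | f <- fac D2]].
    rewrite facetsE; apply/seteqP; split=> [_ [_ [B fB <-] <-]|_ [B fB <-]].
      exists B; first by move: fB; rewrite /= (cert_facet_sets R ok2) inE.
      by rewrite (vertices_face c2 (facet_is_face fB)).
    have fB' : B \in facet_sets q2 A by rewrite (cert_facet_sets R ok2) inE.
    exists (poly q2 B); first by exists B.
    by rewrite (vertices_face c2 (facet_is_face fB')).
  pose others := [seq vset m | m <- map snd (behead (fac D2))].
  have L1 : [seq vset f.2 | f <- fac D1] = [:: F1, F2 & others] by [].
  have L2 : [seq vset f.2 | f <- fac D2] = Bip :: others by [].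
  move: others L1 L2 => others L1 L2.
  have := cert_uniq ok1; rewrite L1 /= !inE negb_or => /and3P[/andP[_ F1o] F2o _].
  have polyE B C : poly q1 B = poly q1 C -> B = C.
    exact: (poly_inj c1 (finset.subsetT _) (finset.subsetT _)).
  rewrite E2 L2; apply/seteqP; split.
    move=> _ [B + <-]; rewrite /= inE => /predU1P[->|BL]; first by right.
    left; have B1 : B \in facet_sets q1 A.
      by rewrite (cert_facet_sets R ok1) inE L1 !inE BL !orbT.
    exists (poly q1 B); last by rewrite (vertices_face c1 (facet_is_face B1)) relabel_image.
    split; first exact: mem_facets B1.
    by move=> [/polyE E|/polyE E]; [move: F1o|move: F2o]; rewrite -E BL.
  move=> _ [[G [/= + nG] <-]|->]; last by exists Bip => //=; rewrite inE eqxx.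
  rewrite facetsE => -[B fB EG]; exists B.
    move: (fB); rewrite /= (cert_facet_sets R ok1) inE L1 !inE => /or3P[/eqP E|/eqP E|->].
    - by case: nG; left; rewrite -EG E.
    - by case: nG; right; rewrite -EG E.
    - by rewrite orbT.
  by rewrite -EG (vertices_face c1 (facet_is_face fB)) relabel_image.
- split; first exact: mem_facets Bip_facet.
  exists a, b; split; first exact: a_neq_b.
    rewrite (vertices_face c1 fR) relabel_image -/(poly q2 Rdg).
    by exists 0; exact: bip_centre.
  rewrite (vertices_face c1 fR) relabel_image -/(poly q2 Rdg).
  apply/seteqP; split.
    apply: poly_sub_convex; first exact: conv_convex.
    move=> i iB; apply: (@sub_gen_smallest _ (@convex_set R _)).
    have [iR|iR] := boolP (i \in Rdg); first by left; exact: poly_vertex.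
    right; have : i = inord 0 \/ i = inord 1.
      move: iB iR; rewrite /Bip /Rdg !inE.
      case: i => [[|[|[|[|[|[|[|[]]]]]]]]] // i8 _ _; [left|right]; apply: val_inj; by rewrite /= inordK.
    by case=> ->; [left|right].
  apply: smallest_sub; first exact: poly_convex.
  have RB : Rdg \subset Bip by rewrite -F1_cap_F2 -F1_cup_F2; apply: fintype.subset_trans (finset.subsetIl _ _) (finset.subsetUl _ _).
  move=> x [/(polyS RB)//|[->|->]]; apply: poly_vertex; rewrite /Bip inE inordK //.
Qed.

Lemma example_polytopes :
  exists Q1 Q2 : set 'rV[R]_4,
     (forall Q : set 'rV[R]_4, Q = Q1 \/ Q = Q2 ->
        [/\ dpolytope 4 Q,
            (vertices Q #= `I_8)%card,
            (nonsimple_vertices Q #= `I_3)%card,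
            ~ simplicial_prism 4 Q &
            ~ pyramid Q]) /\
     [/\ (facets Q1 #= `I_8)%card,
         (facets Q2 #= `I_7)%card,
         ~ comb_equiv Q1 Q2,
         graph_iso Q1 Q2 &
         glued_along_ridge Q1 Q2].
Proof.
have f1 : (facets Q1 #= `I_8)%card by apply/(card_facets _ c1); exact: cert_card_facets ok1.
have f2 : (facets Q2 #= `I_7)%card by apply/(card_facets _ c2); exact: cert_card_facets ok2.
exists Q1, Q2; split.
  by move=> Q [->|->];
    [have [? ? ? np ?] := cert_polytope R ok1|have [? ? ? np ?] := cert_polytope R ok2];
    split=> //; apply: np.
split=> //; [|exact: example_graph_iso|exact: example_glued].
have rk1 (D : cert) (ok : valid D) : (1 < rk (hp (cq R D)) A)%N by rewrite (cert_rk R ok).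
move=> /(comb_equiv_facets c1 (rk1 _ ok1) c2 (rk1 _ ok2))/(_ f1) f2'.
have : (`I_8 #= `I_7)%card by rewrite card_eq_sym in f2'; exact: card_eq_trans f2' f2.
by move=> /card_eq_II.
Qed.

End Example.

Theorem proposition11 (R : realType) :
  (forall (n d k : nat) (P : set 'rV[R]_n),
     dpolytope d P ->
     (vertices P #= `I_(2 * d)%N)%card ->
     (nonsimple_vertices P #= `I_k)%card -> (k + 2 <= d)%N ->
     simplicial_prism d P \/ pyramid P) /\
  (exists Q1 Q2 : set 'rV[R]_4,
     (forall Q : set 'rV[R]_4, Q = Q1 \/ Q = Q2 ->
        [/\ dpolytope 4 Q,
            (vertices Q #= `I_8)%card,
            (nonsimple_vertices Q #= `I_3)%card,
            ~ simplicial_prism 4 Q &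
            ~ pyramid Q]) /\
     [/\ (facets Q1 #= `I_8)%card,
         (facets Q2 #= `I_7)%card,
         ~ comb_equiv Q1 Q2,
         graph_iso Q1 Q2 &
         glued_along_ridge Q1 Q2]).
Proof. by split; [exact: few_nonsimple_vertices|exact: example_polytopes]. Qed.
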